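(* Let $\mathbf{P}$ be a $d$-dimensional complete simplicial toric variety and let $X\subset\mathbf{P}$ be a Cartier divisor defined by $f=0$, where $f\in S_\beta$. Then $$H^0(\mathbf{P},\Omega^{d-1}_{\mathbf{P}}(X))=\Bigl\{\frac{\sum_{i\in\mathcal{I}_0}A_i\Omega_i+\sum_{(i,j)\in\mathcal{I}_1}A_{ij}\Omega_{ij}}{f}: A_i\in S_{\beta-\beta_0+\beta_i},\ A_{ij}\in S_{\beta-\beta_0+\beta_i+\beta_j}\Bigr\},$$ where $\beta_0=\sum_{i=1}^n\beta_i$ and $z_i\in S_{\beta_i}$. Moreover, if $S_\beta\subset B(\Sigma)$, then $$H^0(\mathbf{P},\Omega^{d-1}_{\mathbf{P}}(X))=\Bigl\{\frac{\sum_{i=1}^nA_i\Omega_i}{f}: A_i\in S_{\beta-\beta_0+\beta_i}\Bigr\}.$$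
   Context: Setting: $M$ is a free abelian group of rank $d$, $N=\operatorname{Hom}(M,\mathbf{Z})$, $\Sigma$ a rational simplicial complete $d$-dimensional fan in $N_{\mathbf{R}}$, $\rho_1,\dots,\rho_n$ its one-dimensional cones, $e_i\in N$ the primitive generator of $\rho_i$, and $\mathbf{P}=\mathbf{P}_\Sigma$ the associated toric variety over $\mathbf{C}$ with torus $\mathbf{T}$. $S=\mathbf{C}[z_1,\dots,z_n]$ is graded by $Cl(\Sigma)=\mathbf{Z}^n/\alpha(M)$, $\alpha(m)=(\langle m,e_i\rangle)_i$; $\beta_i=\deg z_i$ is the class of the $i$-th basis vector. For $\sigma\in\Sigma$ put $\widehat z_\sigma=\prod_{\rho_i\not\subset\sigma}z_i$, and $B(\Sigma)=\langle\widehat z_\sigma:\sigma\in\Sigma\rangle\subset S$. $\mathbf{P}=U(\Sigma)/\mathbf{D}(\Sigma)$ where $\mathbf{D}(\Sigma)=\operatorname{Spec}\mathbf{C}[Cl(\Sigma)]\subset(\mathbf{C}^* )^n$ and $U(\Sigma)=\mathbf{A}^n\setminus\mathbf{V}(B(\Sigma))$; a nonzero $f\in S_\beta$ defines the divisor $X=\{f=0\}\subset\mathbf{P}$ of class $\beta$. $\Omega^p_{\mathbf{P}}$ is the sheaf of Zariski $p$-forms ($j_*\Omega^p_W$ for $j:W\to\mathbf{P}$ the smooth locus) and $\Omega^p_{\mathbf{P}}(X)=\Omega^p_{\mathbf{P}}\otimes\mathcal{O}_{\mathbf{P}}(X)$; its local sections are rational $p$-forms that become sections of $\Omega^p_{\mathbf{P}}$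 after multiplication by a local equation of $X$. Rational forms on $\mathbf{P}$ are identified with their pullbacks to $U(\Sigma)$, written in $z_i,dz_i$; for $m\in M$ the character $t^m$ of $\mathbf{T}$ pulls back to $\prod_i z_i^{\langle m,e_i\rangle}$. Fix a $\mathbf{Z}$-basis $m_1,\dots,m_d$ of $M$. For an (ordered) $d$-element subset $I=\{i_1,\dots,i_d\}\subset\{1,\dots,n\}$ put $\det(e_I)=\det(\langle m_j,e_{i_k}\rangle_{1\le j,k\le d})$. For a subset $J=\{j_1,\dots,j_r\}$ put $dz_J=dz_{j_1}\wedge\cdots\wedge dz_{j_r}$ and $\widehat z_J=\prod_{l\notin J}z_l$. For $1\le i\le n$, $$\Omega_i=\sum_{|J|=d-1,\ i\notin J}\det(e_{J\cup\{i\}})\,\widehat z_{J\cup\{i\}}\,dz_J,$$ where $\det(e_{J\cup\{i\}})$ is computed by ordering $J\cup\{i\}$ with $i$ first, followed by $J$ in the order used for $dz_J$. Let $\mathcal{I}_0=\{i: -e_i\notin\{e_1,\dots,e_n\}\}$ and $\mathcal{I}_1=\{(i,j): i<j,\ e_i=-e_j\}$. For $(i,j)\in\mathcal{I}_1$, $$\Omega_{ij}=\sum_{|J|=d-1,\ i,j\notin J}\det(e_{J\cup\{i\}})\,\widehat z_{J\cup\{i,j\}}\,dz_J$$ (with the same ordering convention). *)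

(* Defs.v *)
From mathcomp Require Import all_boot all_order all_algebra.
From mathcomp Require Import fraction complex mpoly.
From mathcomp Require Import reals.

Set Implicit Arguments.
Unset Strict Implicit.
Unset Printing Implicit Defensive.

Import Order.TTheory GRing.Theory Num.Theory.
Local Open Scope ring_scope.

Notation "x %:F" := (FracField.tofrac x) : ring_scope.

(* A Z-basis m_1, ..., m_d of M is fixed once and for all: both M and N are
   'rV[int]_d, in the basis (m_k) and in the dual basis respectively.  A
   simplicial fan with rays rho_i = R_{>=0} e_i (i < n) is encoded by the set
   Sigma of the index sets {i | rho_i is a face of sigma} of its cones sigma. *)

Definition pairing d (m v : 'rV[int]_d) : int := \sum_k m 0 k * v 0 k.

Section Fan.
Variables (R : realType) (d n : nat).
Variables (e : 'I_n -> 'rV[int]_d) (Sigma : {set {set 'I_n}}).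

Definition lin_comb (c : 'I_n -> R) : 'rV[R]_d :=
  \sum_i c i *: map_mx intr (e i).

Definition in_cone (s : {set 'I_n}) (v : 'rV[R]_d) : Prop :=
  exists c : 'I_n -> R,
    [/\ forall i, 0 <= c i, forall i, i \notin s -> c i = 0
      & v = lin_comb c].

Definition primitive (v : 'rV[int]_d) : Prop :=
  forall (k : int) (w : 'rV[int]_d), v = k *: w -> `|k| = 1.

Definition simplicial_cone (s : {set 'I_n}) : Prop :=
  forall c : 'I_n -> R,
    (forall i, i \notin s -> c i = 0) -> lin_comb c = 0 -> forall i, c i = 0.

(* The faces of a simplicial cone correspond to the subsets of its set of
   rays, and (given primitivity) the fourth and fifth clauses force the e i to
   be distinct. *)
Definition complete_simplicial_fan : Prop :=
  [/\ forall i, primitive (e i),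
      forall s, s \in Sigma -> simplicial_cone s,
      forall s t : {set 'I_n}, s \in Sigma -> t \subset s -> t \in Sigma,
      forall i, [set i] \in Sigma
    & (forall s t, s \in Sigma -> t \in Sigma ->
         forall v, in_cone s v -> in_cone t v -> in_cone (s :&: t) v)
      /\ (forall v, exists2 s, s \in Sigma & in_cone s v)].

End Fan.

Section CoxRing.
Variables (R : realType) (d n : nat).
Variables (e : 'I_n -> 'rV[int]_d) (Sigma : {set {set 'I_n}}).

Local Notation S := {mpoly R[i][n]}.

Definition alpha (m : 'rV[int]_d) : 'rV[int]_n := \row_i pairing m (e i).

(* A class in Cl(Sigma) = Z^n / alpha(M) is given by a representative in Z^n,
   and two representatives of the same class are related by [same_class]. *)
Definition same_class (b c : 'rV[int]_n) : Prop := exists m, b - c = alpha m.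

Definition expo (k : 'X_{1..n}) : 'rV[int]_n := \row_i (k i)%:Z.

(* [inS b] is the graded piece S_beta, for beta the class of b. *)
Definition inS (b : 'rV[int]_n) (p : S) : Prop :=
  forall k, k \in msupp p -> same_class (expo k) b.

Definition homogeneous (p : S) : Prop := exists b, inS b p.

(* Representatives of beta_i = deg z_i and of beta_0 = sum_i beta_i. *)
Definition degz (i : 'I_n) : 'rV[int]_n := delta_mx 0 i.
Definition deg0 : 'rV[int]_n := \sum_i degz i.

Definition zhat (J : {set 'I_n}) : S := \prod_(l | l \notin J) 'X_l.

Definition inB (g : S) : Prop :=
  exists q : {set 'I_n} -> S, g = \sum_(s in Sigma) q s * zhat s.

(* The closed points of A^n lying in U(Sigma) = A^n \ V(B(Sigma)). *)
Definition inU (x : 'I_n -> R[i]) : Prop := exists2 g, inB g & g.@[x] != 0.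

End CoxRing.

(* The quotient P = U(Sigma) / D(Sigma).  Its closed points are represented by
   points x of U(Sigma); neighbourhoods of the image of x are the images of the
   D(Sigma)-stable sets {h != 0} with h homogeneous and h(x) != 0; and D(Sigma)
   acts on S with S_beta as weight spaces, so that rational functions on P are
   the fractions of degree 0 in C(z_1, ..., z_n). *)
Section Quotient.
Variables (R : realType) (d n : nat).
Variables (e : 'I_n -> 'rV[int]_d) (Sigma : {set {set 'I_n}}).

Local Notation S := {mpoly R[i][n]}.
Local Notation L := {fraction {mpoly R[i][n]}}.
Local Notation point := ('I_n -> R[i]).

Definition rat_fun (r : L) : Prop :=
  exists b, exists g h : S,
    [/\ inS e b g, inS e b h, h != 0 & r = g%:F / h%:F].

(* The local ring of P at the image of x and its maximal ideal. *)
Definition local_ring (x : point) (r : L) : Prop :=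
  exists b, exists g h : S,
    [/\ inS e b g, inS e b h, h.@[x] != 0 & r = g%:F / h%:F].

Definition max_ideal (x : point) (r : L) : Prop :=
  exists b, exists g h : S,
    [/\ inS e b g, inS e b h, h.@[x] != 0, g.@[x] = 0
      & r = g%:F / h%:F].

(* The local ring, of dimension d, is regular: its maximal ideal can be
   generated by d elements. *)
Definition smooth_at (x : point) : Prop :=
  exists t : 'I_d -> L,
    (forall k, max_ideal x (t k)) /\
    (forall r, max_ideal x r ->
       exists a : 'I_d -> L,
         (forall k, local_ring x (a k)) /\ r = \sum_k a k * t k).

(* The quotient rule, applied to the chosen representative of a fraction. *)
Definition dfrac (j : 'I_n) (r : L) : L :=
  let q := repr r in
  ((\n_q)^`M(j) * \d_q - \n_q * (\d_q)^`M(j))%:F / ((\d_q) ^+ 2)%:F.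

(* A rational p-form on A^n is given by its values on the p-tuples of
   coordinate vector fields d/dz_{k_1}, ..., d/dz_{k_p}. *)
Definition diff_form (p : nat) : Type := {ffun {ffun 'I_p -> 'I_n} -> L^o}.

(* d b_1 /\ ... /\ d b_p *)
Definition dwedge (p : nat) (b : 'I_p -> L) : diff_form p :=
  [ffun k : {ffun 'I_p -> 'I_n} => \det (\matrix_(s, t) dfrac (k t) (b s))].

Definition span_forms (A : L -> Prop) (p : nat) (w : diff_form p) : Prop :=
  exists r, exists a : 'I_r -> L, exists b : 'I_r -> 'I_p -> L,
    [/\ forall s, A (a s), forall s k, A (b s k)
      & w = \sum_s a s *: dwedge (b s)].

(* Rational p-forms on P (pulled back to U(Sigma)), and those that are regular
   at a smooth point of P. *)
Definition rational_form (p : nat) (w : diff_form p) : Prop :=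
  span_forms rat_fun w.

Definition regular_at (x : point) (p : nat) (w : diff_form p) : Prop :=
  span_forms (local_ring x) w.

(* Sections of Omega^p_P = j_* Omega^p_W over the image of {h != 0}. *)
Definition zariski_section (h : S) (p : nat) (w : diff_form p) : Prop :=
  rational_form w /\
  forall x, inU Sigma x -> h.@[x] != 0 -> smooth_at x -> regular_at x w.

(* u is a local equation of X = {f = 0} at the image of x: it is a rational
   function on P with the same divisor as f on U(Sigma) near x. *)
Definition local_equation_at (f : S) (x : point) (u : L) : Prop :=
  rat_fun u /\
  exists g h : S,
    [/\ g.@[x] != 0, h.@[x] != 0 & u = f%:F * (g%:F / h%:F)].

Definition local_equation (f h : S) (u : L) : Prop :=
  forall x, inU Sigma x -> h.@[x] != 0 -> local_equation_at f x u.

Definition cartier (f : S) : Prop :=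
  forall x, inU Sigma x ->
    exists h u, [/\ homogeneous e h, h.@[x] != 0 & local_equation f h u].

(* Global sections of Omega^p_P(X), X = {f = 0}. *)
Definition H0 (f : S) (p : nat) (w : diff_form p) : Prop :=
  rational_form w /\
  forall x, inU Sigma x ->
    exists h u,
      [/\ homogeneous e h, h.@[x] != 0, local_equation f h u
        & zariski_section h (u *: w)].

End Quotient.

Section Omega.
Variables (R : realType) (d n : nat) (e : 'I_n -> 'rV[int]_d).

Local Notation S := {mpoly R[i][n]}.
Local Notation L := {fraction {mpoly R[i][n]}}.

(* i0 is an irrelevant default in the next two definitions; the sequence I has
   d elements in the first one, and p in the second one. *)
Definition detE (i0 : 'I_n) (I : seq 'I_n) : int :=
  \det (\matrix_(j < d, k < d) e (nth i0 I k) 0 j).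

Definition dz (i0 : 'I_n) (p : nat) (I : seq 'I_n) : diff_form R n p :=
  dwedge (fun k : 'I_p => ('X_(nth i0 I k) : S)%:F).

(* [enum J] lists J in increasing order. *)
Definition Omega1 (i : 'I_n) : diff_form R n d.-1 :=
  \sum_(J : {set 'I_n} | (#|J| == d.-1) && (i \notin J))
     ((detE i (i :: enum J))%:~R * (zhat R (i |: J))%:F : L)
       *: dz i d.-1 (enum J).

Definition Omega2 (i j : 'I_n) : diff_form R n d.-1 :=
  \sum_(J : {set 'I_n} | [&& #|J| == d.-1, i \notin J & j \notin J])
     ((detE i (i :: enum J))%:~R * (zhat R (i |: (j |: J)))%:F : L)
       *: dz i d.-1 (enum J).

Definition I0 (i : 'I_n) : bool := [forall j, e j != - e i].

Definition I1 (i j : 'I_n) : bool := (i < j)%N && (e i == - e j).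

End Omega.

(* Main.v *)
(* Contracting the invariant volume form of the torus identifies the rational
   (d-1)-forms w on P with the rational vector fields V, in coordinates the
   vectors V with entries in the field of fractions of degree 0:
     w(k_1, ..., k_{d-1}) = det(V, e_{k_1}, ..., e_{k_{d-1}}) / (z_{k_1} ... z_{k_{d-1}}).
   Omega_i and Omega_ij correspond to the constant vector e_i multiplied by
   zhat_{i} and zhat_{i,j}.  If w is a section, the components of f w are
   regular at all the points of affine space with at most one zero coordinate
   (they are smooth points of P), hence are polynomials; so W = f V is a vector
   of homogeneous polynomials of class beta, and the components of f w being
   polynomials means that the coefficient of z^a in W is a multiple of e_i
   whenever a_i = 0.  As the e_i are primitive and distinct, W is then a sum of
   terms c z^a e_i such that a_l = 0 implies e_l = e_i or e_l = - e_i, and these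
   are the numerators of the theorem.  When S_beta is contained in B(Sigma), the
   vanishing exponents a_l belong to a common cone, so that e_l = - e_i does not
   occur together with a_i = 0.
   Conversely, let sigma be the cone of the zero coordinates of a smooth point.
   Its rays are part of a Z-basis: otherwise the semigroup sigma^vee /\ M has an
   irreducible element besides those on its extremal rays, and the cotangent
   space of P at the point has dimension greater than d.  In the dual basis,
   c z^a e_i / f is visibly regular after multiplication by a local equation. *)

From HB Require Import structures.
Require Import Defs.
From mathcomp Require Import all_boot all_order all_algebra.
From mathcomp Require Import fraction complex mpoly.
From mathcomp Require Import boolp reals.
From mathcomp Require Import ring zify.

Set Implicit Arguments.
Unset Strict Implicit.
Unset Printing Implicit Defensive.
Import Order.TTheory GRing.Theory Num.Theory.
Local Open Scope ring_scope.

(** * Polynomials regular in codimension one *)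

(** Regularity at points is turned into divisibility by restriction to generic lines, where it
    becomes a statement about polynomials in one variable over a closed field. A fraction of degree
    0 may be regular at a point of affine space through a representative that is not homogeneous;
    projecting its numerator and denominator to one class in which the denominator survives gives a
    homogeneous one. Smoothness provides only d generators of the maximal ideal, so it is exploited
    by duality, through linear forms on S that kill products of functions vanishing at the point.
    Two kinds are used: coefficients at irreducible exponents once the nonzero coordinates are
    frozen, and derivatives along the torus for the directions of the orbit. The vector dual to a
    ray becomes integral on the cone after multiplication by a least q, and this multiple is
    irreducible. If q > 1 for the ray i, a lattice point of least degree among those whose value on
    e_i is not divisible by q is one more irreducible element, and d + 1 independent forms
    result. *)

(** Induction on the number of variables: a nonzero coefficient with respect to the last variable
    survives at some point, and the resulting polynomial in one variable has finitely many roots in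
    an infinite field. *)
Lemma mpoly_neq0_meval (F : numFieldType) n (p : {mpoly F[n]}) :
  p != 0 -> exists x, p.@[x] != 0.
Proof.
elim: n p => [|n IHn] p p_neq0.
  exists (fun=> 0); move: p_neq0; rewrite (nvar0_mpolyC p) mevalC.
  by apply: contraNneq => ->; rewrite mpolyC0.
have [m m_p] : exists m, m \in msupp p.
  case E: (msupp p) => [|m s]; last by exists m; rewrite inE eqxx.
  by move: p_neq0; rewrite -msupp_eq0 E.
pose r (k : 'X_{1..n.+1}) : 'X_{1..n} := [multinom k (widen_ord (leqnSn n) i) | i < n].
(* The coefficient of the power of the last variable that occurs in [m]; it inherits the nonzero
   coefficient of [m]. *)
pose q := (muni p)`_(m ord_max).
have qE : q@_(r m) = p@_m.
  rewrite /q muniE coef_sum raddf_sum /= (bigD1_seq m) //= ?msupp_uniq //.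
  rewrite coefZ coefXn eqxx mulr1 mcoeffZ mcoeffX eqxx mulr1 big1 ?addr0 //.
  move=> k k_neq_m; rewrite coefZ coefXn; case: eqP => [Em|_]; last by rewrite mulr0 mcoeff0.
  rewrite mulr1 mcoeffZ mcoeffX; case: eqP => [Er|_]; last by rewrite mulr0.
  case/eqP: k_neq_m; apply/mnmP => i.
  case: (unliftP ord_max i) => [j ->|-> //].
  have := congr1 (fun u : 'X_{1..n} => u j) Er; rewrite !mnmE.
  by rewrite (_ : widen_ord _ j = lift ord_max j) //; apply: val_inj; rewrite /= /bump leqNgt ltn_ord.
have q_neq0 : q != 0.
  by apply: contraTneq m_p => q0; rewrite -mcoeff_eq0 -qE q0 mcoeff0.
have [x qx] := IHn q q_neq0.
pose u := map_poly (meval x) (muni p).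
have u_neq0 : u != 0.
  apply: contraNneq qx => u0; rewrite /q.
  by have := congr1 (fun v : {poly F} => v`_(m ord_max)) u0; rewrite coef_map coef0 => ->.
have [t ut] : exists t : F, ~~ root u t.
  have [//|H] := pselect (exists t : F, ~~ root u t).
  (* In characteristic zero these are as many distinct elements as the size of [u], one more than
     its degree, so they cannot all be roots. *)
  pose s : seq F := [seq i%:R | i <- iota 0 (size u)].
  have : (size s < size u)%N.
    apply: max_poly_roots => //; last first.
      by rewrite map_inj_uniq ?iota_uniq // => i j /eqP; rewrite eqr_nat => /eqP.
    by apply/allP => t _; apply: contrapT => /negP nt; apply: H; exists t.
  by rewrite size_map size_iota ltnn.
exists (fun i => if unlift ord_max i is Some j then x j else t).
move: ut; rewrite rootE; congr (_ != _).
rewrite /u muniE raddf_sum horner_sum mevalE; apply: eq_bigr => k _.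
rewrite /= map_polyZ map_polyXn hornerZ hornerXn /= mevalZ mevalX -mulrA; congr (_ * _).
rewrite [RHS]big_ord_recr /= unlift_none; congr (_ * _).
apply: eq_bigr => i _.
have E : widen_ord (leqnSn n) i = lift ord_max i.
  by apply: val_inj; rewrite /= /bump leqNgt ltn_ord.
by rewrite E liftK mnmE E.
Qed.

Lemma meval_inj (F : numFieldType) n (p q : {mpoly F[n]}) :
  (forall x, p.@[x] = q.@[x]) -> p = q.
Proof.
move=> pq; apply/eqP; rewrite -subr_eq0; apply/negPn/negP.
by move=> /mpoly_neq0_meval[x]; rewrite mevalB pq subrr eqxx.
Qed.

(** After division by the gcd, a root of the remaining denominator would also be a root of the
    numerator, against coprimality; over a closed field the denominator is therefore constant. *)
Lemma dvdp_local (F : closedFieldType) (p q : {poly F}) : q != 0 ->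
  (forall t, exists g h : {poly F}, h.[t] != 0 /\ p * h = q * g) -> q %| p.
Proof.
move=> q_neq0 loc; set a := gcdp p q.
have a_neq0 : a != 0 by rewrite gcdp_eq0 negb_and q_neq0 orbT.
have [p' Ep] : exists p', p = p' * a by apply/dvdpP/dvdp_gcdl.
have [q' Eq] : exists q', q = q' * a by apply/dvdpP/dvdp_gcdr.
have cop : coprimep p' q'.
  have := coprimep_div_gcd (p := p) (q := q); rewrite q_neq0 orbT => /(_ isT).
  by rewrite -/a {1}Ep {1}Eq !mulpK.
suff /eqP/size_poly1P[c c_neq0 Ec] : size q' = 1.
  by rewrite Eq Ec mul_polyC dvdpZl // dvdp_gcdl.
apply/eqP/negPn/negP => /closed_rootP[t q't].
have [g [h [ht ph]]] := loc t.
have ph' : p' * h = q' * g.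
  by apply: (mulIf a_neq0); rewrite mulrAC -Ep ph Eq mulrAC.
have := congr1 (horner^~ t) ph'; rewrite !hornerM (rootP q't) mul0r => /eqP.
rewrite mulf_eq0 (negPf ht) orbF => p't.
by have /coprimepP/(_ ('X - t%:P)) := cop; rewrite !dvdp_XsubCl {1}/root p't q't -size_poly_eq1 size_XsubC => /(_ isT isT).
Qed.

Section Line.
Variables (F : numFieldType) (n : nat) (y : 'I_n -> F).
Implicit Types p : {mpoly F[n]}.

(** The variable of the outer polynomial ring is the parameter t; the base point of the line stays
    generic, so that all lines of direction [y] are handled at once. *)
Definition line_var (i : 'I_n) : {poly {mpoly F[n]}} :=
  ('X_i)%:P + (y i)%:MP *: 'X.

Definition line : {mpoly F[n]} -> {poly {mpoly F[n]}} :=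
  mmap (polyC \o @mpolyC n F) line_var.

HB.instance Definition _ := GRing.RMorphism.on line.

Lemma line_eval x t p :
  (map_poly (meval x) (line p)).[t] = p.@[fun i => x i + t * y i].
Proof.
rewrite /line /mmap raddf_sum /= horner_sum mevalE.
apply: eq_bigr => m _.
rewrite rmorphM hornerM /= map_polyC /= mevalC hornerC; congr (_ * _).
rewrite rmorph_prod /= horner_prod; apply: eq_bigr => i _.
rewrite rmorphXn /= horner_exp; congr (_ ^+ _).
rewrite raddfD /= map_polyC /= map_polyZ map_polyX hornerD hornerC hornerZ hornerX /=.
by rewrite mevalXU mevalC mulrC.
Qed.

Lemma line_evalM x p q :
  map_poly (meval x) (line (p * q)) =
    map_poly (meval x) (line p) * map_poly (meval x) (line q).
Proof.
have -> : line (p * q) = line p * line q by exact: rmorphM.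
exact: rmorphM.
Qed.

Hypothesis y_neq0 : forall i, y i != 0.

Lemma size_line_var i : size (line_var i) = 2.
Proof.
rewrite /line_var addrC size_polyDl size_scale ?size_polyX ?mpolyC_eq0 //.
by rewrite size_polyC; case: (_ == _).
Qed.

Lemma lead_line_var i : lead_coef (line_var i) = (y i)%:MP.
Proof.
rewrite /lead_coef size_line_var /line_var coefD coefC coefZ coefX /=.
by rewrite add0r mulr1.
Qed.

Lemma line_mon (m : 'X_{1..n}) :
  (size (mmap1 line_var m) = (mdeg m).+1)%N /\
  lead_coef (mmap1 line_var m) = (\prod_i y i ^+ m i)%:MP.
Proof.
split; last first.
  rewrite lead_coef_prod rmorph_prod /=; apply: eq_bigr => i _.
  by rewrite lead_coef_exp lead_line_var rmorphXn.
have nz i : line_var i ^+ m i != 0.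
  by rewrite expf_neq0 // -size_poly_eq0 size_line_var.
have E i : size (line_var i ^+ m i) = (m i).+1.
  by rewrite -[LHS]prednK ?size_exp ?size_line_var ?mul1n // lt0n size_poly_eq0.
rewrite size_prod // (eq_bigr (fun i => (m i).+1)) => [|i _]; last exact: E.
have -> : (\sum_(i < n) (m i).+1 = mdeg m + n)%N.
  under eq_bigr do rewrite -addn1.
  by rewrite big_split /= sum_nat_const card_ord muln1 mdegE.
by rewrite -addSn -[X in (_ - X)%N]sum1_card sum_nat_const card_ord muln1 addnK.
Qed.

(** Each factor X_i + t y_i contributes y_i to the highest power of t, so monomials of maximal
    degree contribute their value at [y] and the others do not reach that power. *)
Lemma line_top p : (msize p > 0)%N ->
  (line p)`_(msize p).-1 = ((pihomog mdeg (msize p).-1 p).@[y])%:MP /\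
  (size (line p) <= msize p)%N.
Proof.
move=> p_gt0; split.
  rewrite /line /mmap coef_sum pihomogE (raddf_sum (meval y)) raddf_sum /= [RHS]big_mkcond /=.
  apply: eq_big_seq => m /msize_mdeg_lt m_lt; rewrite coefCM.
  have [Es El] := line_mon m.
  case: ifP => [/eqP Em|/eqP nEm].
    by rewrite -Em -[mdeg m]/(mdeg m).+1.-1 -Es -/(lead_coef _) El mevalZ mevalX rmorphM.
  rewrite nth_default ?mulr0 // Es.
  by move: m_lt nEm; lia.
apply: (leq_trans (size_sum _ _ _)); apply/bigmax_leqP_seq => m /msize_mdeg_lt m_lt _.
have [Es _] := line_mon m.
apply: leq_trans (size_polyMleq _ _) _; rewrite Es /=.
by rewrite size_polyC; case: (_ == _); move: m_lt; rewrite /= ?add0n ?add1n //; lia.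
Qed.
End Line.

(* The points of a generic line x + t y have at most one zero coordinate, and
   q(x + t y) has a constant leading coefficient in t, so that the division of
   p by q can be performed with polynomial coefficients. *)
Lemma hartogs (F : numClosedFieldType) n (p q : {mpoly F[n]}) : q != 0 ->
  (forall x : 'I_n -> F, (forall i j, x i = 0 -> x j = 0 -> i = j) ->
     exists g h : {mpoly F[n]}, h.@[x] != 0 /\ p * h = q * g) ->
  exists s, p = s * q.
Proof.
move=> q_neq0 loc.
have q_gt0 : (0 < msize q)%N by rewrite lt0n msize_poly_eq0.
pose qtop := pihomog mdeg (msize q).-1 q.
have qtop_neq0 : qtop != 0.
  apply/eqP => qtop0; case/negP: (q_neq0); rewrite -mleadc_eq0; apply/eqP.
  have := congr1 (mcoeff (mlead q)) qtop0.
  rewrite mcoeff0 /qtop pihomogE (raddf_sum (mcoeff _)) /= big_mkcond.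
  rewrite (bigD1_seq (mlead q)) /= ?msupp_uniq ?mlead_supp //.
  rewrite -(mlead_deg q_neq0) eqxx mcoeffZ mcoeffX eqxx mulr1 big1 ?addr0 // => m nm.
  by case: ifP => // _; rewrite mcoeffZ mcoeffX (negPf nm) mulr0.
(* The direction must avoid the zeros of the top form of [q], which makes [q'] below monic in t, and
   must have no zero coordinate. *)
have [y] : exists y, (qtop * \prod_i 'X_i).@[y] != 0.
  apply: mpoly_neq0_meval; rewrite mulf_neq0 //; apply/prodf_neq0 => i _.
  by rewrite -msupp_eq0 msuppX.
rewrite mevalM rmorph_prod /= mulf_eq0 negb_or => /andP[qtopy /prodf_neq0 yP].
have y_neq0 i : y i != 0 by have := yP i isT; rewrite mevalXU.
have [qtopE q_size] := line_top y_neq0 q_gt0.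
have [p_size0|p_gt0] := posnP (msize p).
  by exists 0; rewrite mul0r; apply/eqP; rewrite -msize_poly_eq0 p_size0.
set c := qtop.@[y] in qtopE.
pose q' := c^-1%:MP *: line y q.
have q'_size : size q' = msize q.
  rewrite /q' size_scale ?mpolyC_eq0 ?invr_eq0 //.
  apply/eqP; rewrite eqn_leq q_size /= -(ltn_predK q_gt0) ltnNge; apply/negP => /leq_sizeP.
  by move=> /(_ _ (leqnn _)) /eqP; rewrite qtopE mpolyC_eq0 (negPf qtopy).
have q'_monic : q' \is monic.
  rewrite monicE /lead_coef q'_size /q' coefZ qtopE -rmorphM mulVf ?mpolyC1 //.
have pE := Pdiv.RingMonic.rdivp_eq q'_monic (line y p).
set s := Pdiv.Ring.rdivp _ _ in pE; set r := Pdiv.Ring.rmodp _ _ in pE.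
have r_lt : (size r < size q')%N by rewrite Pdiv.Ring.ltn_rmodpN0 // monic_neq0.
(* Where [G] does not vanish, no point of the line has two zero coordinates; the remainder vanishes
   there, hence identically. *)
pose G := \prod_i \prod_(j | j != i) (y j *: 'X_i - y i *: 'X_j) : {mpoly F[n]}.
have G_neq0 : G != 0.
  apply/prodf_neq0 => i _; apply/prodf_neq0 => j ji.
  apply: contraNneq (y_neq0 j) => /(congr1 (mcoeff U_(i))).
  rewrite mcoeffB !mcoeffZ !mcoeffX eqxx mcoeff0 mulr1 eq_mnm1 (negPf ji) mulr0 subr0.
  by move/eqP.
have rG x : G.@[x] != 0 -> map_poly (meval x) r = 0.
  rewrite rmorph_prod => /prodf_neq0 GP.
  have xP t i j : x i + t * y i = 0 -> x j + t * y j = 0 -> i = j.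
    move=> /eqP; rewrite addr_eq0 => /eqP xi /eqP; rewrite addr_eq0 => /eqP xj.
    apply/eqP/negPn/negP => ij.
    have := GP i isT; rewrite rmorph_prod => /prodf_neq0/(_ j); rewrite eq_sym => /(_ ij).
    by rewrite /= mevalB !mevalZ !mevalXU xi xj => /eqP; apply; ring.
  have q'x_size : size (map_poly (meval x) q') = size q'.
    rewrite size_map_poly_id0 // (monicP q'_monic) meval1 oner_eq0 //.
  have q'x_neq0 : map_poly (meval x) q' != 0.
    by rewrite -size_poly_eq0 q'x_size q'_size -lt0n.
  have : map_poly (meval x) q' %| map_poly (meval x) (line y p).
    apply: dvdp_local => // t.
    have [g [h [hx ph]]] := loc _ (xP t).
    exists (c *: map_poly (meval x) (line y g)), (map_poly (meval x) (line y h)).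
    rewrite line_eval; split=> //.
    have -> : map_poly (meval x) q' = c^-1 *: map_poly (meval x) (line y q).
      by rewrite /q' map_polyZ /= mevalC.
    rewrite -!mul_polyC mulrACA -polyCM mulVf // mul1r.
    have E1 := line_evalM y x p h.
    have E2 := line_evalM y x q g.
    rewrite ph in E1.
    exact: etrans (esym E1) E2.
  rewrite pE rmorphD rmorphM /= dvdp_addr ?dvdp_mull // => dvd.
  apply/eqP/negPn/negP => r_neq0.
  have := dvdp_leq r_neq0 dvd; rewrite q'x_size leqNgt => /negP[].
  by apply: leq_ltn_trans r_lt; apply: size_poly.
have r0 : r = 0.
  apply/polyP => k; rewrite coef0; apply: (mulIf G_neq0); rewrite mul0r.
  apply: meval_inj => x; rewrite mevalM meval0.
  have [->|/rG rx] := eqVneq G.@[x] 0; first by rewrite mulr0.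
  by have := congr1 (fun u : {poly F} => u`_k) rx; rewrite coef_map coef0 /= => ->; rewrite mul0r.
(* Setting t = 0 recovers the original polynomials. *)
exists (c^-1 *: s.[0]); apply: meval_inj => x.
have l0 u : u.@[x] = (line y u).[0].@[x].
  have := line_eval y x 0 u; rewrite horner_coef0 coef_map /= horner_coef0 => ->.
  by apply: meval_eq => i; rewrite mul0r addr0.
rewrite l0 pE r0 addr0 hornerM mevalM mevalM mevalZ /q' hornerZ mevalM mevalC.
by rewrite -(l0 q); ring.
Qed.

(** * Bordered determinants *)

Section BorderedDeterminant.
Variables (F : comNzRingType) (p : nat).
Implicit Types (v w : 'rV[F]_p.+1) (Y mu : 'M[F]_(p, p.+1)) (G : 'M[F]_p.+1).

Definition border v Y : 'M[F]_p.+1 := col_mx v Y.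
Definition bdet v Y : F := \det (border v Y).
(** The signed maximal minors, a generalized cross product of the rows of [mu]. *)
Definition minors mu : 'rV[F]_p.+1 := \row_l ((-1) ^+ l * \det (col' l mu)).

Lemma row'_border v Y : row' ord0 (border v Y) = Y.
Proof.
apply/matrixP => i j; rewrite mxE /border.
by rewrite (_ : lift ord0 i = rshift 1 i); [exact: col_mxEd | exact: ord_inj].
Qed.

Lemma border0 v Y j : border v Y ord0 j = v 0 j.
Proof. by rewrite /border (_ : @ord0 p = @lshift 1 p ord0); [exact: col_mxEu | exact: ord_inj]. Qed.

Lemma borderS v Y i j : border v Y (lift ord0 i) j = Y i j.
Proof. by have := congr1 (fun M : 'M_(p, p.+1) => M i j) (row'_border v Y); rewrite mxE. Qed.

Lemma cofactor_border v Y l : cofactor (border v Y) ord0 l = minors Y 0 l.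
Proof.
rewrite /cofactor add0n mxE; congr (_ * \det _).
by apply/matrixP => i j; rewrite [LHS]mxE [LHS]mxE borderS mxE.
Qed.

Lemma bdetE v Y : bdet v Y = \sum_l v 0 l * minors Y 0 l.
Proof.
rewrite /bdet (expand_det_row _ ord0); apply: eq_bigr => l _.
by rewrite border0 cofactor_border.
Qed.

Lemma bdet_sum (I : finType) (P : pred I) (c : I -> F) (v : I -> 'rV_p.+1) Y :
  bdet (\sum_(i | P i) c i *: v i) Y = \sum_(i | P i) c i * bdet (v i) Y.
Proof.
rewrite bdetE; under eq_bigr => l _.
  rewrite summxE mulr_suml.
  under eq_bigr => i _ do rewrite mxE -mulrA.
over.
by rewrite exchange_big; apply: eq_bigr => i _; rewrite bdetE mulr_sumr.
Qed.

Lemma bdetZ c v Y : bdet (c *: v) Y = c * bdet v Y.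
Proof. by rewrite !bdetE mulr_sumr; apply: eq_bigr => l _; rewrite mxE mulrA. Qed.

Lemma bdet_row i Y : bdet (row i Y) Y = 0.
Proof.
apply: (determinant_alternate (i1 := ord0) (i2 := lift ord0 i)) => // j.
by rewrite border0 borderS mxE.
Qed.

Lemma mul_tr_minors Y mu : Y *m (minors mu)^T = \col_i bdet (row i Y) mu.
Proof.
apply/matrixP => i j; rewrite ord1 !mxE bdetE; apply: eq_bigr => l _.
by rewrite !mxE.
Qed.

Lemma mul_row_tr_minors v mu : v *m (minors mu)^T = (bdet v mu)%:M.
Proof.
apply/matrixP => i j; rewrite !ord1 !mxE bdetE mulr1n; apply: eq_bigr => l _.
by rewrite !mxE.
Qed.

(** Cramer's rule: when [Y] is a square matrix without one row, bordering by [v] computes a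
    coordinate of [v] in the rows of that matrix. *)
Lemma bdet_row' v G t : bdet v (row' t G) = (-1) ^+ t * (v *m \adj G) 0 t.
Proof.
rewrite bdetE mxE mulr_sumr; apply: eq_bigr => l _; rewrite !mxE /cofactor.
rewrite exprD [RHS]mulrCA; congr (_ * _).
rewrite 2!mulrA -expr2 sqrr_sign mul1r; congr (_ * \det _).
by apply/matrixP => i j; rewrite !mxE.
Qed.

(** Expansion of the determinant of [G] times the transposed bordered matrix along its first column;
    it will express a contraction in an arbitrary basis of characters. *)
Lemma bdet_mul G v Y :
  \det G * bdet v Y =
    \sum_l (G *m v^T) l 0 * ((-1) ^+ l * \det (row' l G *m Y^T)).
Proof.
rewrite /bdet -(det_tr (border v Y)) -det_mulmx (expand_det_col _ ord0).
apply: eq_bigr => l _; congr (_ * _).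
  rewrite [LHS]mxE [RHS]mxE; apply: eq_bigr => k _; congr (_ * _).
  by rewrite [LHS]mxE [RHS]mxE border0.
rewrite /cofactor addn0; congr (_ * \det _).
apply/matrixP => i j; rewrite [LHS]mxE [LHS]mxE [LHS]mxE [RHS]mxE.
apply: eq_bigr => k _; congr (_ * _); first by rewrite mxE.
by rewrite [LHS]mxE [RHS]mxE borderS.
Qed.

End BorderedDeterminant.

Lemma map_border (F F' : comNzRingType) (f : {rmorphism F -> F'}) p
    (v : 'rV[F]_p.+1) (Y : 'M_(p, p.+1)) :
  border (map_mx f v) (map_mx f Y) = map_mx f (border v Y).
Proof. by rewrite /border -map_col_mx. Qed.

Lemma map_bdet (F F' : comNzRingType) (f : {rmorphism F -> F'}) p
    (v : 'rV[F]_p.+1) (Y : 'M_(p, p.+1)) :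
  bdet (map_mx f v) (map_mx f Y) = f (bdet v Y).
Proof. by rewrite /bdet map_border det_map_mx. Qed.

(* Every p-form mu_1 /\ ... /\ mu_p in p + 1 variables is the contraction of
   the volume form by the vector of the maximal minors of mu. *)
Lemma bdet_minors (F : fieldType) p (mu Y : 'M[F]_(p, p.+1)) :
  bdet (minors mu) Y = \det (mu *m Y^T).
Proof.
(* The product of one bordered matrix by the transpose of the other is block triangular, because the
   minors of [mu] are orthogonal to its rows. *)
have E v : bdet v mu * bdet (minors mu) Y = bdet v mu * \det (mu *m Y^T).
  rewrite /bdet -[X in _ * X]det_tr -det_mulmx.
  have -> : border v mu *m (border (minors mu) Y)^T =
            block_mx (bdet v mu)%:M (v *m Y^T) 0 (mu *m Y^T).
    rewrite -[LHS]/((col_mx v mu : 'M_(1 + p, p.+1)) *m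
                    (col_mx (minors mu) Y : 'M_(1 + p, p.+1))^T).
    rewrite tr_col_mx mul_col_mx !mul_mx_row mul_row_tr_minors mul_tr_minors.
    rewrite (_ : \col_i _ = 0) //; apply/matrixP => i j.
    by rewrite mxE bdet_row mxE.
  have := det_ublock ((bdet v mu)%:M : 'M_1) (v *m Y^T) (mu *m Y^T).
  by rewrite det_scalar1.
have [[v v_neq0]|bdet0] := pselect (exists v, bdet v mu != 0).
  exact: (mulfI v_neq0).
have bdet_eq0 v : bdet v mu = 0 by apply/eqP/negPn/negP => nz; apply: bdet0; exists v.
have -> : minors mu = 0.
  apply/rowP => l; rewrite [RHS]mxE -(bdet_eq0 (delta_mx 0 l)) bdetE (bigD1 l) //=.
  rewrite [X in X * _]mxE !eqxx mul1r big1 ?addr0 // => k /negPf kl.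
  by rewrite mxE eqxx kl mul0r.
rewrite -[0](scale0r 0) bdetZ mul0r; apply/esym/eqP/negPn/negP => det_neq0.
have mu_free : row_free mu.
  by apply/row_freeP; exists (Y^T *m invmx (mu *m Y^T)); rewrite mulmxA mulmxV // unitmxE unitfE.
(* If [mu] has full row rank while every bordered determinant vanishes, each [v] lies in the row
   space of [mu], whose rank is at most p. *)
suff : (1%:M <= mu)%MS.
  by move/mxrankS; rewrite mxrank1 leqNgt ltnS rank_leq_row.
apply/row_subP => i; move: (row i _) => v.
have [w w_neq0] : exists2 w : 'rV_(1 + p), w != 0 & w *m (col_mx v mu : 'M_(1 + p)) = 0.
  exact/det0P/eqP/bdet_eq0.
rewrite -{1}[w]hsubmxK mul_row_col [lsubmx w]mx11_scalar mul_scalar_mx.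
set a := lsubmx w 0 0; have [a0|a_neq0] := eqVneq a 0.
  rewrite a0 scale0r add0r => /eqP; rewrite (mulmx_free_eq0 _ mu_free) => /eqP w0.
  by move: w_neq0; rewrite -[w]hsubmxK w0 [lsubmx w]mx11_scalar -/a a0 raddf0 row_mx0 eqxx.
move=> /(canRL (addrK _)); rewrite sub0r => av.
by rewrite -[v](scalerK a_neq0) av scalemx_sub // -mulNmx submxMl.
Qed.

(** * Lattice vectors and fans *)

Section IntegerVectors.
Variable d : nat.
Implicit Types m v w : 'rV[int]_d.

Lemma pairingE m v : pairing m v = (m *m v^T) 0 0.
Proof. by rewrite mxE; apply: eq_bigr => k _; rewrite mxE. Qed.

Lemma pairingDl m m' v : pairing (m + m') v = pairing m v + pairing m' v.
Proof. by rewrite !pairingE mulmxDl mxE. Qed.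

Lemma pairingNl m v : pairing (- m) v = - pairing m v.
Proof. by rewrite !pairingE mulNmx mxE. Qed.

Lemma pairingZl c m v : pairing (c *: m) v = c * pairing m v.
Proof. by rewrite !pairingE -scalemxAl mxE. Qed.

Lemma pairing0l v : pairing 0 v = 0.
Proof. by rewrite pairingE mul0mx mxE. Qed.

Lemma pairingNr m v : pairing m (- v) = - pairing m v.
Proof. by rewrite !pairingE linearN /= mulmxN mxE. Qed.

Lemma pairing_suml (I : finType) (P : pred I) (c : I -> 'rV[int]_d) v :
  pairing (\sum_(i | P i) c i) v = \sum_(i | P i) pairing (c i) v.
Proof. by rewrite pairingE mulmx_suml summxE; apply: eq_bigr => i _; rewrite pairingE. Qed.

Lemma pairing_rowE k (B : 'M[int]_(k, d)) l v : pairing (row l B) v = (B *m v^T) l 0.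
Proof. by rewrite pairingE -row_mul mxE. Qed.

Lemma primitive_neq0 v : primitive v -> v != 0.
Proof.
by move=> prim; apply/eqP => v0; have := prim 0 0; rewrite v0 scale0r normr0 => /(_ erefl).
Qed.

Lemma primitive_dvd v c : primitive v -> (forall k, (c %| v ord0 k)%Z) -> `|c| = 1.
Proof.
move=> prim c_dvd; apply: (prim c (\row_k (v ord0 k %/ c)%Z)); apply/rowP => k.
by rewrite !mxE mulrC divzK.
Qed.

(** Dividing the two proportionality factors by their gcd makes them coprime; each then divides
    every entry of one primitive vector and is a unit. *)
Lemma primitive_parallel v w : primitive v -> primitive w ->
  (forall k l, v 0 k * w 0 l = v 0 l * w 0 k) -> v = w \/ v = - w.
Proof.
move=> prim_v prim_w par; have /rV0Pn[l wl] := primitive_neq0 prim_w.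
set a := v 0 l; set b := w 0 l in wl.
have E k : b * v 0 k = a * w 0 k by rewrite mulrC par.
set g := gcdz a b; have g_neq0 : g != 0 by rewrite gcdz_eq0 negb_and wl orbT.
have [Ea Eb] : a = (a %/ g)%Z * g /\ b = (b %/ g)%Z * g.
  by rewrite !divzK ?dvdz_gcdl ?dvdz_gcdr.
set a' := (a %/ g)%Z in Ea; set b' := (b %/ g)%Z in Eb.
have E' k : b' * v 0 k = a' * w 0 k.
  by apply: (mulIf g_neq0); rewrite mulrAC -Eb E Ea mulrAC.
have cop : coprimez a' b'.
  rewrite /coprimez; apply/eqP; apply: (mulIf g_neq0).
  have Eg : (`|g|%N)%:Z = g by [].
  by rewrite -{1}Eg mulz_gcdl -Ea -Eb mul1r.
have a1 : `|a'| = 1.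
  apply: (primitive_dvd prim_v) => k.
  by rewrite -(Gauss_dvdzr _ cop) E' dvdz_mulr.
have b1 : `|b'| = 1.
  apply: (primitive_dvd prim_w) => k; rewrite coprimez_sym in cop.
  by rewrite -(Gauss_dvdzr _ cop) -E' dvdz_mulr.
have [Ev|Ev] : (forall k, v 0 k = w 0 k) \/ (forall k, v 0 k = - w 0 k).
- have : (a' == 1) || (a' == -1).
    by have /eqP := a1; rewrite eqr_norml ler01 andbT.
  have : (b' == 1) || (b' == -1).
    by have /eqP := b1; rewrite eqr_norml ler01 andbT.
  move=> /orP[] /eqP Eb' /orP[] /eqP Ea';
   [left|right|right|left] => k; move: (E' k); rewrite Ea' Eb'; lia.
- by left; apply/rowP.
- by right; apply/rowP => k; rewrite mxE.
Qed.

End IntegerVectors.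

(** The Smith form of a single row writes [v] as a multiple of the first vector of a basis;
    primitivity forces the factor to be 1 or -1. *)
Lemma primitive_dual_basis p (v : 'rV[int]_p.+1) : primitive v ->
  exists2 B : 'M[int]_p.+1, B \in unitmx & forall l, pairing (row l B) v = (l == 0)%:R.
Proof.
move=> prim; have [L _ [Q Q_unit [s _ Ev]]] := int_Smith_normal_form v.
set u := L 0 0 * s`_0.
have {}Ev : v = u *: row 0 Q.
  rewrite Ev [L]mx11_scalar mul_scalar_mx -scalemxAl /u -scalerA; congr (_ *: _).
  apply/rowP => k; rewrite !mxE (bigD1 0) //= mxE big1 ?addr0 // => j /negPf j0.
  rewrite mxE (_ : _ == _ = false) ?mul0r //.
  by apply: contraFF j0 => /eqP E; apply/eqP/val_inj; rewrite /= -E.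
have u1 := prim _ _ Ev.
have uu : u * u = 1 by rewrite -expr2 -real_normK ?num_real // u1 expr1n.
exists (u *: invmx Q)^T => [|l].
  by rewrite unitmx_tr unitmxZ ?unitmx_inv //; apply/unitrP; exists u.
have -> : pairing (row l (u *: invmx Q)^T) v = (v *m (u *: invmx Q)) 0 l.
  rewrite pairing_rowE !mxE; apply: eq_bigr => k _.
  by rewrite [(u *: _)^T l k]mxE [v^T k 0]mxE mulrC.
rewrite Ev -scalemxAl -scalemxAr scalerA uu scale1r -row_mul mulmxV // !mxE.
by rewrite eq_sym.
Qed.

Section FanFacts.
Variables (R : realType) (p n : nat) (e : 'I_n -> 'rV[int]_p.+1).
Variable Sigma : {set {set 'I_n}}.
Hypothesis fan : complete_simplicial_fan R e Sigma.

Definition rays (g : 'I_p.+1 -> 'I_n) : 'M[int]_p.+1 := \matrix_t e (g t).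

Lemma fan_primitive i : primitive (e i).
Proof. by case: fan. Qed.

Lemma lin_combE (c : 'I_n -> R) :
  lin_comb e c = (\row_i c i) *m map_mx intr (\matrix_i e i).
Proof.
rewrite mulmx_sum_row; apply: eq_bigr => i _.
by rewrite mxE -map_row rowK.
Qed.

Lemma exists_rays_basis : exists g, \det (rays g) != 0.
Proof.
pose A : 'M[R]_(n, p.+1) := map_mx intr (\matrix_i e i).
have fullA : row_full A.
  rewrite -sub1mx; apply/row_subP => i; case: fan => _ _ _ _ [_ /(_ (row i 1%:M))].
  by case=> s _ [c [_ _ ->]]; rewrite lin_combE submxMl.
exists (fullrankfun fullA).
have := fullrowsub_unit fullA; rewrite unitmxE unitfE.
have -> : rowsub (fullrankfun fullA) A = map_mx intr (rays (fullrankfun fullA)).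
  by apply/matrixP => i j; rewrite !mxE.
by rewrite det_map_mx intr_eq0.
Qed.

(** Exchange argument: some coordinate of [e i *m \adj G] is nonzero, and it is the determinant
    obtained by replacing the corresponding row by [e i]. *)
Lemma exists_rays_basis_through i :
  exists g t, g t = i /\ \det (rays g) != 0.
Proof.
have [g gP] := exists_rays_basis; set G := rays g in gP.
have : e i *m \adj G != 0.
  apply/eqP => ei0; case/negP: (primitive_neq0 (@fan_primitive i)).
  have : e i *m \adj G *m G = 0 by rewrite ei0 mul0mx.
  rewrite -mulmxA mul_adj_mx mul_mx_scalar => detG.
  apply/eqP/rowP => k; rewrite mxE; apply: (mulfI gP); rewrite mulr0.
  by have := congr1 (fun v : 'rV_p.+1 => v 0 k) detG; rewrite !mxE.
move=> /rV0Pn[t eit]; exists (fun s => if s == t then i else g s), t.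
rewrite eqxx; split=> //; rewrite (expand_det_row _ t); move: eit; congr (_ != _).
rewrite mxE; apply: eq_bigr => l _; rewrite [X in _ = X * _]mxE eqxx; congr (_ * _).
rewrite mxE /cofactor; congr (_ * \det _); apply/matrixP => a b.
by rewrite !mxE eq_sym (negPf (neq_lift _ _)).
Qed.

Lemma ray_in_cone i : in_cone e [set i] (map_mx intr (e i) : 'rV[R]_p.+1).
Proof.
exists (fun j => (j == i)%:R); split=> [j|j|].
- exact: ler0n.
- by rewrite inE => /negPf ->.
- rewrite /lin_comb (bigD1 i) //= eqxx scale1r big1 ?addr0 // => j /negPf ->.
  by rewrite scale0r.
Qed.

(** A vector common to two different rays would lie in the cone of their empty intersection, which
    is zero. *)
Lemma fan_inj : injective e.
Proof.
move=> i j eij; apply/eqP/negPn/negP => ij.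
case: fan => prim _ _ raysP [capP _].
have /capP := raysP i => /(_ _ (raysP j) _ (ray_in_cone i)).
rewrite eij => /(_ (ray_in_cone j)) [c [_ c0 ej]].
have ej0 : map_mx intr (e j) = 0 :> 'rV[R]_p.+1.
  rewrite ej /lin_comb big1 // => k _; rewrite c0 ?scale0r // !inE.
  by apply/negP => /andP[/eqP ki /eqP kj]; case/eqP: ij; rewrite -ki kj.
case/eqP: (primitive_neq0 (@fan_primitive j)); apply/rowP => k.
have := congr1 (fun v : 'rV[R]_p.+1 => v 0 k) ej0.
by rewrite !mxE => /eqP; rewrite intr_eq0 => /eqP.
Qed.

(** The relation e_i + e_j = 0 contradicts the linear independence of the rays of a simplicial
    cone. *)
Lemma opp_not_in_cone i j s : e i = - e j -> s \in Sigma -> i \in s -> j \notin s.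
Proof.
move=> eij sS i_s; apply/negP => j_s.
have ij : i != j.
  apply/eqP => ij; have := primitive_neq0 (@fan_primitive i).
  case/eqP; apply/rowP => k; have := congr1 (fun v : 'rV_p.+1 => v 0 k) eij.
  by rewrite -ij !mxE => /eqP; rewrite -addr_eq0 -mulr2n mulrn_eq0 => /eqP.
case: fan => _ simp _ _ _.
pose c k : R := (k == i)%:R + (k == j)%:R.
have : c i = 0.
  apply: (simp s sS) => [k k_s|].
    by rewrite /c !(introF eqP) ?addr0 // => E; move: k_s; rewrite E ?i_s ?j_s.
  rewrite /lin_comb; under eq_bigr do rewrite scalerDl.
  rewrite big_split /= (bigD1 i) //= eqxx big1 => [|k /negPf ->]; last by rewrite scale0r.
  rewrite (bigD1 j) //= eqxx big1 => [|k /negPf ->]; last by rewrite scale0r.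
  rewrite !addr0 !scale1r eij; apply/rowP => k; rewrite !mxE rmorphN; ring.
by rewrite /c eqxx (negPf ij) addr0 => /eqP; rewrite oner_eq0.
Qed.

(** An element of the ideal that is nonzero at [x] has a summand that is nonzero at [x], and the
    cone of this summand contains all the zero coordinates; closure under faces does the rest. *)
Lemma inU_zeros (x : 'I_n -> R[i]) : inU Sigma x <-> [set i | x i == 0] \in Sigma.
Proof.
case: fan => _ _ subS _ _; split=> [[g [q ->]]|xS]; last first.
  exists (zhat R [set i | x i == 0]).
    exists (fun s => (s == [set i | x i == 0])%:R).
    rewrite (bigD1 _ xS) /= eqxx mul1r big1 ?addr0 // => s /andP[_ /negPf ->].
    by rewrite mul0r.
  rewrite rmorph_prod; apply/prodf_neq0 => i; rewrite inE => xi.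
  by rewrite /= mevalXU.
rewrite raddf_sum => nz.
have [s sS s_nz] : exists2 s, s \in Sigma & (q s * zhat R s).@[x] != 0.
  apply: contrapT => H; case/eqP: nz; apply: big1 => s sS.
  by apply/eqP/negPn/negP => s_nz; apply: H; exists s.
apply: subS sS _; apply/subsetP => i; rewrite inE => xi; apply: contraNT s_nz => i_s.
by rewrite mevalM rmorph_prod (bigD1 i) //= mevalXU (eqP xi) mul0r mulr0.
Qed.

End FanFacts.

(** * Derivations of fractions *)

Section QuotientRule.
Variables (K : fieldType) (g h g' h' dg dh dg' dh' : K).
Hypotheses (h0 : h != 0) (h'0 : h' != 0).

Lemma quotient_ruleM :
  ((dg * g' + g * dg') * (h * h') - g * g' * (dh * h' + h * dh')) / (h * h') ^+ 2
  = (dg * h - g * dh) / h ^+ 2 * (g' / h') + g / h * ((dg' * h' - g' * dh') / h' ^+ 2).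
Proof. by field; rewrite h0 h'0. Qed.

Lemma quotient_ruleV : g != 0 ->
  (dh * g - h * dg) / g ^+ 2 = - ((dg * h - g * dh) / h ^+ 2) / (g / h) ^+ 2.
Proof. by move=> g0; field; rewrite h0 g0. Qed.
End QuotientRule.

Section FractionDerivation.
Variables (A : idomainType) (D : A -> A).
Hypothesis DM : forall g h, D (g * h) = D g * h + g * D h.
Local Notation L := {fraction A}.
Implicit Types (g h : A) (r s : L).

(** [dfrac] for an arbitrary derivation; it is defined on a chosen representative, and
    [frac_deriv_div] removes this choice. *)
Definition frac_deriv r : L :=
  let q := repr r in
  (D \n_q * \d_q - \n_q * D \d_q)%:F / (\d_q ^+ 2)%:F.

Lemma frac_repr r : r * (\d_(repr r))%:F = (\n_(repr r))%:F.
Proof.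
rewrite -{1}[r]reprK; set q := repr r; unlock FracField.tofrac.
rewrite -[LHS]FracField.pi_mul; apply/eqmodP; rewrite /= FracField.equivfE /FracField.mulf /=.
by rewrite !numden_Ratio ?mulr1 ?oner_neq0 ?denom_ratioP // mulrC.
Qed.

Lemma frac_div_eq g h g' h' : h != 0 -> h' != 0 ->
  (g%:F / h%:F == g'%:F / h'%:F) = (g * h' == g' * h).
Proof. by move=> h0 h'0; rewrite eqr_div ?tofrac_eq0 // -!tofracM tofrac_eq. Qed.

Lemma fracP r : exists g h, h != 0 /\ r = g%:F / h%:F.
Proof.
exists (\n_(repr r)), (\d_(repr r)); split; first exact: denom_ratioP.
by rewrite -frac_repr mulfK // tofrac_eq0 denom_ratioP.
Qed.

Lemma frac_deriv_div g h : h != 0 ->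
  frac_deriv (g%:F / h%:F) = (D g * h - g * D h)%:F / (h ^+ 2)%:F.
Proof.
move=> h_neq0; set r := _ / _; rewrite /frac_deriv.
have := frac_repr r; set a := \n_(repr r); set b := \d_(repr r).
have b_neq0 : b != 0 := denom_ratioP _.
have hF : h%:F != 0 by rewrite tofrac_eq0.
rewrite /r => E0; have E : g * b = a * h.
  by apply/eqP; rewrite -tofrac_eq !tofracM -E0 mulrAC divfK.
apply/eqP; rewrite frac_div_eq ?expf_neq0 //; apply/eqP.
have dE : D g * b + g * D b = D a * h + a * D h by rewrite -!DM E.
transitivity (b * h * (D a * h) - (a * h) * h * D b); first by ring.
rewrite -E (_ : D a * h = D g * b + g * D b - a * D h).
  transitivity (b ^+ 2 * h * D g - b * (a * h) * D h); first by ring.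
  by rewrite -E; ring.
by rewrite dE; ring.
Qed.

Lemma deriv1 : D 1 = 0.
Proof.
by apply: (addrI (D 1 * 1)); rewrite addr0 {2}mulr1 -{2}[D 1]mul1r -DM mulr1.
Qed.

Lemma frac_deriv_tofrac g : frac_deriv g%:F = (D g)%:F.
Proof.
have -> : g%:F = g%:F / 1%:F :> L by rewrite tofrac1 divr1.
by rewrite frac_deriv_div ?oner_neq0 // deriv1 mulr0 subr0 expr1n mulr1 tofrac1 divr1.
Qed.

Lemma frac_derivM r s : frac_deriv (r * s) = frac_deriv r * s + r * frac_deriv s.
Proof.
have [g [h [h0 ->]]] := fracP r; have [g' [h' [h'0 ->]]] := fracP s.
rewrite mulf_div -!tofracM !frac_deriv_div ?mulf_neq0 // !DM.
by rewrite !tofracXn !(tofracB, tofracD, tofracM) quotient_ruleM // tofrac_eq0.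
Qed.

Lemma frac_derivV r : r != 0 -> frac_deriv r^-1 = - frac_deriv r / r ^+ 2.
Proof.
have [g [h [h0 ->]]] := fracP r.
rewrite mulf_eq0 negb_or invr_eq0 !tofrac_eq0 => /andP[g0 _].
by rewrite invf_div !frac_deriv_div // !tofracXn !(tofracB, tofracM) quotient_ruleV // tofrac_eq0.
Qed.
End FractionDerivation.

Section PartialDerivative.
Variables (R : realType) (n : nat).
Local Notation S := {mpoly R[i][n]}.
Local Notation L := {fraction S}.
Implicit Types (g h : S) (r s : L) (j : 'I_n).

Lemma dfrac_div j g h : h != 0 ->
  dfrac j (g%:F / h%:F) = (g^`M(j) * h - g * h^`M(j))%:F / (h ^+ 2)%:F.
Proof. exact: (frac_deriv_div (mderivM j)). Qed.

Lemma dfrac_tofrac j g : dfrac j g%:F = (g^`M(j))%:F.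
Proof. exact: (frac_deriv_tofrac (mderivM j)). Qed.

Lemma dfracM j r s : dfrac j (r * s) = dfrac j r * s + r * dfrac j s.
Proof. exact: (frac_derivM (mderivM j)). Qed.

Lemma dfracV j r : r != 0 -> dfrac j r^-1 = - dfrac j r / r ^+ 2.
Proof. exact: (frac_derivV (mderivM j)). Qed.
End PartialDerivative.

(** * The grading by the class group *)

Section Grading.
Variables (R : realType) (d n : nat) (e : 'I_n -> 'rV[int]_d).
Local Notation C := R[i].
Local Notation S := {mpoly C[n]}.
Local Notation L := {fraction S}.
Implicit Types (b c : 'rV[int]_n) (g h : S) (r s : L) (m : 'rV[int]_d) (k : 'X_{1..n}).

Lemma alphaD m m' : alpha e (m + m') = alpha e m + alpha e m'.
Proof. by apply/rowP => i; rewrite !mxE pairingDl. Qed.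

Lemma alphaN m : alpha e (- m) = - alpha e m.
Proof. by apply/rowP => i; rewrite !mxE pairingNl. Qed.

Lemma same_class_refl b : same_class e b b.
Proof. by exists 0; rewrite subrr; apply/rowP => i; rewrite !mxE pairing0l. Qed.

Lemma same_class_sym b c : same_class e b c -> same_class e c b.
Proof. by case=> m E; exists (- m); rewrite alphaN -E opprB. Qed.

Lemma same_class_trans c b b' : same_class e b c -> same_class e c b' -> same_class e b b'.
Proof. by case=> m E [m' E']; exists (m + m'); rewrite alphaD -E -E' addrA subrK. Qed.

Lemma same_classD b b' c c' :
  same_class e b c -> same_class e b' c' -> same_class e (b + b') (c + c').
Proof. by case=> m E [m' E']; exists (m + m'); rewrite alphaD -E -E' addrACA opprD. Qed.

Lemma same_classDr b c c' : same_class e (b + c) (c' + c) -> same_class e b c'.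
Proof. by case=> m E; exists m; rewrite -E opprD addrACA subrr addr0. Qed.

Lemma expoD k k' : expo (k + k')%MM = expo k + expo k'.
Proof. by apply/rowP => i; rewrite !mxE mnmDE PoszD. Qed.

Lemma inS_class b c g : same_class e b c -> inS e b g -> inS e c g.
Proof. by move=> bc gb k /gb /same_class_trans; apply. Qed.

Lemma inS0 b : inS e b (0 : S).
Proof. by move=> k; rewrite msupp0. Qed.

Lemma inSX k : inS e (expo k) ('X_[k] : S).
Proof. by move=> k'; rewrite msuppX inE => /eqP ->; apply: same_class_refl. Qed.

Lemma inSC (a : C) : inS e 0 (a%:MP : S).
Proof.
move=> k; rewrite msuppC; case: ifP => //; rewrite inE => _ /eqP ->.
rewrite (_ : expo 0%MM = 0); first exact: same_class_refl.
by apply/rowP => i; rewrite !mxE mnm0E.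
Qed.

Lemma inSZ b (a : C) g : inS e b g -> inS e b (a *: g).
Proof. by move=> gb k /msuppZ_le/gb. Qed.

Lemma inSD b g h : inS e b g -> inS e b h -> inS e b (g + h).
Proof. by move=> gb hb k /msuppD_le; rewrite mem_cat => /orP[/gb|/hb]. Qed.

Lemma inSN b g : inS e b g -> inS e b (- g).
Proof. by rewrite -scaleN1r; apply: inSZ. Qed.

Lemma inSM b c g h : inS e b g -> inS e c h -> inS e (b + c) (g * h).
Proof.
move=> gb hc k /msuppM_le /allpairsP[[k1 k2] /= [/gb k1b /hc k2c ->]].
by rewrite expoD; apply: same_classD.
Qed.

Lemma inS_sum b (I : Type) (s : seq I) (P : pred I) (F : I -> S) :
  (forall i, P i -> inS e b (F i)) -> inS e b (\sum_(i <- s | P i) F i).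
Proof. by move=> Fb; elim/big_ind: _ => //; [exact: inS0 | exact: inSD]. Qed.

(** The homogeneous component of class [b]; equality of classes is an existential statement, hence
    the classical boolean. *)
Definition part b g : S :=
  \sum_(k <- msupp g | `[< same_class e (expo k) b >]) g@_k *: 'X_[k].

Lemma mcoeff_part b g k :
  (part b g)@_k = if `[< same_class e (expo k) b >] then g@_k else 0.
Proof.
rewrite /part raddf_sum /= big_mkcond /=.
have [k_g|k_g] := boolP (k \in msupp g).
  rewrite (bigD1_seq k) ?msupp_uniq //= big1 => [|k' /negPf kk'].
    by rewrite addr0; case: ifP => // _; rewrite mcoeffZ mcoeffX eqxx mulr1.
  by case: ifP => // _; rewrite mcoeffZ mcoeffX kk' mulr0.
rewrite (memN_msupp_eq0 k_g) if_same big1_seq // => k' /= k'_g.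
case: ifP => // _; rewrite mcoeffZ mcoeffX; case: eqP => [kk'|_]; last by rewrite mulr0.
by rewrite -kk' k'_g in k_g.
Qed.

Lemma part_inS b g : inS e b (part b g).
Proof.
by move=> k; rewrite mcoeff_msupp mcoeff_part; case: asboolP => // _; rewrite eqxx.
Qed.

Lemma part_id b g : inS e b g -> part b g = g.
Proof.
move=> gb; apply/mpolyP => k; rewrite mcoeff_part; case: asboolP => // nkb.
by apply/esym/memN_msupp_eq0; apply: contra_notN nkb => /gb.
Qed.

Lemma partD b g h : part b (g + h) = part b g + part b h.
Proof.
by apply/mpolyP => k; rewrite mcoeffD !mcoeff_part mcoeffD; case: ifP; rewrite ?addr0.
Qed.

Lemma part_eq0 b g :
  (forall k, k \in msupp g -> ~ same_class e (expo k) b) -> part b g = 0.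
Proof.
move=> ngb; apply/mpolyP => k; rewrite mcoeff_part mcoeff0; case: asboolP => // kb.
by apply: memN_msupp_eq0; apply/negP => /ngb.
Qed.

(** Classes can be cancelled: a monomial outside class [b], times one of class [c], never falls into
    class [b + c]. *)
Lemma partMr b c g h : inS e c h -> part (b + c) (g * h) = part b g * h.
Proof.
move=> hc; have {1}-> : g = part b g + (g - part b g) by rewrite addrC subrK.
rewrite mulrDl partD part_id ?[X in _ + X]part_eq0 ?addr0 //; last first.
  by apply: inSM => //; apply: part_inS.
move=> k /msuppM_le /allpairsP[[k1 k2] /= [k1g /hc k2c ->]]; rewrite expoD => k1k2.
have k1b : same_class e (expo k1) b.
  apply: (same_classDr (c := expo k2)); apply: same_class_trans k1k2 _.
  by apply: same_classD; [exact: same_class_refl | exact: same_class_sym].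
by move: k1g; rewrite mcoeff_msupp mcoeffB mcoeff_part asboolT // subrr eqxx.
Qed.

Lemma inS_mulr b c g h : h != 0 -> inS e c h -> inS e (b + c) (g * h) -> inS e b g.
Proof.
move=> h0 hc /part_id; rewrite (partMr _ _ hc) => /(mulIf h0) <-.
exact: part_inS.
Qed.

(** A polynomial is the sum of its components; the induction removes the class of one monomial at a
    time. This is how denominators are made homogeneous. *)
Lemma part_meval_neq0 (x : 'I_n -> C) g : g.@[x] != 0 -> exists b, (part b g).@[x] != 0.
Proof.
move=> gx; apply: contrapT => H; case/negP: gx; apply/eqP.
have {H} : forall b, (part b g).@[x] = 0.
  by move=> b; apply/eqP/negPn/negP => nz; apply: H; exists b.
have [N] := ubnP (size (msupp g)); elim: N g => // N IHN g.
case E: (msupp g) => [|k s] gN part0; first by rewrite (msuppnil0 E) meval0.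
have k_g : k \in msupp g by rewrite E inE eqxx.
pose g' := g - part (expo k) g.
have g'E k' : g'@_k' = if `[< same_class e (expo k') (expo k) >] then 0 else g@_k'.
  by rewrite mcoeffB mcoeff_part; case: ifP => _; rewrite ?subrr ?subr0.
have -> : g = g' + part (expo k) g by rewrite subrK.
rewrite mevalD part0 addr0; apply: IHN => [|b].
  rewrite -ltnS; apply: leq_ltn_trans gN; rewrite -E.
  have : {subset msupp g' <= rem k (msupp g)}.
    move=> k'; rewrite mem_rem_uniq ?msupp_uniq // inE !mcoeff_msupp g'E.
    case: asboolP; rewrite ?eqxx // => nk' ->; rewrite andbT.
    by apply/eqP => kk'; apply: nk'; rewrite kk'; apply: same_class_refl.
  move/(uniq_leq_size (msupp_uniq _))/leq_ltn_trans; apply.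
  by rewrite size_rem // E.
have [bk|nbk] := pselect (same_class e b (expo k)).
  rewrite part_eq0 ?meval0 // => k' k'_g' k'b; move: k'_g'.
  by rewrite mcoeff_msupp g'E asboolT ?eqxx //; apply: same_class_trans k'b bk.
rewrite -(part0 b); congr meval; apply/mpolyP => k'; rewrite !mcoeff_part g'E.
case: asboolP => // k'b; case: asboolP => // k'k; case: nbk.
by apply: same_class_trans k'k; apply: same_class_sym.
Qed.

Section FractionsOfDegreeZero.
Variable Q : S -> Prop.
Hypotheses (Q1 : Q 1) (QM : forall g h, Q g -> Q h -> Q (g * h)).
Hypothesis Q_neq0 : forall h, Q h -> h != 0.

(** Common generalization of [rat_fun] ([Q] says nonzero) and [local_ring] ([Q] says nonzero at the
    point), so that closure properties are proved once. *)
Definition deg0_frac r : Prop :=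
  exists b, exists g h, [/\ inS e b g, inS e b h, Q h & r = g%:F / h%:F].

Lemma deg0_frac_const (a : C) : deg0_frac (a%:MP%:F).
Proof.
exists 0, a%:MP, 1; split; rewrite ?tofrac1 ?divr1 //; first exact: inSC.
by rewrite -mpolyC1; apply: inSC.
Qed.

Lemma deg0_frac_int (a : int) : deg0_frac a%:~R.
Proof. by rewrite -(rmorph_int (FracField.tofrac (R := S))) -(rmorph_int (mpolyC n (R := C))); apply: deg0_frac_const. Qed.

Lemma deg0_fracM r s : deg0_frac r -> deg0_frac s -> deg0_frac (r * s).
Proof.
move=> [b [g [h [gb hb Qh ->]]]] [c [g' [h' [g'c h'c Qh' ->]]]].
exists (b + c), (g * g'), (h * h'); split; [exact: inSM..|exact: QM|].
by rewrite mulf_div -!tofracM.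
Qed.

Lemma deg0_fracD r s : deg0_frac r -> deg0_frac s -> deg0_frac (r + s).
Proof.
move=> [b [g [h [gb hb Qh ->]]]] [c [g' [h' [g'c h'c Qh' ->]]]].
exists (b + c), (g * h' + g' * h), (h * h'); split; [|exact: inSM|exact: QM|].
  by apply: inSD; rewrite 1?[g' * h]mulrC; apply: inSM.
by rewrite addf_div ?tofrac_eq0 ?Q_neq0 // -!tofracM -tofracD.
Qed.

Lemma deg0_frac0 : deg0_frac 0.
Proof. exact: (deg0_frac_int 0). Qed.

Lemma deg0_frac1 : deg0_frac 1.
Proof. exact: (deg0_frac_int 1). Qed.

Lemma deg0_frac_sum (I : Type) (s : seq I) (P : pred I) (F : I -> L) :
  (forall i, P i -> deg0_frac (F i)) -> deg0_frac (\sum_(i <- s | P i) F i).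
Proof. by move=> FP; elim/big_ind: _ => //; [exact: deg0_frac0 | exact: deg0_fracD]. Qed.

Lemma deg0_frac_prod (I : Type) (s : seq I) (P : pred I) (F : I -> L) :
  (forall i, P i -> deg0_frac (F i)) -> deg0_frac (\prod_(i <- s | P i) F i).
Proof. by move=> FP; elim/big_ind: _ => //; [exact: deg0_frac1 | exact: deg0_fracM]. Qed.

Lemma deg0_frac_sign (k : nat) : deg0_frac ((-1) ^+ k).
Proof.
rewrite -signr_odd; case: odd; [exact: (deg0_frac_int (-1)) | exact: deg0_frac1].
Qed.

Lemma deg0_frac_det (k : nat) (M : 'M[L]_k) : (forall i j, deg0_frac (M i j)) -> deg0_frac (\det M).
Proof.
move=> MP; apply: deg0_frac_sum => s _.
by apply: deg0_fracM; [exact: deg0_frac_sign | apply: deg0_frac_prod].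
Qed.

Lemma deg0_frac_minors (k : nat) (M : 'M[L]_(k, k.+1)) l :
  (forall i j, deg0_frac (M i j)) -> deg0_frac (minors M 0 l).
Proof.
move=> MP; rewrite mxE; apply: deg0_fracM; first exact: deg0_frac_sign.
by apply: deg0_frac_det => i j; rewrite mxE.
Qed.

End FractionsOfDegreeZero.

End Grading.

(** * Differential forms *)

Section Forms.
Variables (R : realType) (p n : nat) (e : 'I_n -> 'rV[int]_p.+1).
Local Notation C := R[i].
Local Notation S := {mpoly C[n]}.
Local Notation L := {fraction S}.
Implicit Types (b c : 'rV[int]_n) (g h : S) (r s : L) (m : 'rV[int]_p.+1) (k : 'X_{1..n}).

Definition z (i : 'I_n) : L := ('X_i : S)%:F.

Lemma mpolyX_neq0 k : 'X_[k] != 0 :> S.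
Proof. by rewrite -msupp_eq0 msuppX. Qed.

Lemma z_neq0 i : z i != 0.
Proof. by rewrite tofrac_eq0 mpolyX_neq0. Qed.

Lemma tofrac_int (a : int) : (a%:~R : S)%:F = a%:~R :> L.
Proof. exact: rmorph_int. Qed.

Lemma intr_const (a : int) : a%:~R = (a%:~R%:MP)%:F :> L.
Proof. by rewrite -tofrac_int; congr _%:F; rewrite rmorph_int. Qed.

Lemma intrL_eq0 (a : int) : (a%:~R == 0 :> L) = (a == 0).
Proof. by rewrite intr_const tofrac_eq0 mpolyC_eq0 intr_eq0. Qed.

Lemma mulX_mderivX j k : 'X_j * ('X_[k] : S)^`M(j) = (k j)%:Z%:~R * 'X_[k].
Proof.
rewrite mderivX scaler_nat mulrnAr -mpolyXD -pmulrn mulr_natl.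
have [->|kj] := posnP (k j); first by rewrite !mulr0n.
by rewrite addmC submK ?lep1mP -?lt0n.
Qed.

Lemma intr_scale (a : int) g : a%:~R * g = (a%:~R : C) *: g.
Proof. by rewrite mulrzl scaler_int. Qed.

(** On a monomial of class [b] the exponents are b_j + <m, e_j> for some m; [G l] weights each
    monomial by the l-th coordinate of its m. The term in [b] is the same for numerator and
    denominator of a fraction of degree 0 and cancels. *)
Lemma euler_poly b g : inS e b g -> exists G : 'I_p.+1 -> S,
  (forall l, inS e b (G l)) /\
  forall j, 'X_j * g^`M(j) = (b 0 j)%:~R * g + \sum_l (e j 0 l)%:~R * G l.
Proof.
move=> gb.
have /choice[mm mmP] : forall k, exists m, k \in msupp g -> expo k - b = alpha e m.
  move=> k; have [k_g|k_g] := boolP (k \in msupp g); last by exists 0.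
  by have [m E] := gb k k_g; exists m.
exists (fun l => \sum_(k <- msupp g) (g@_k * (mm k 0 l)%:~R) *: 'X_[k]); split=> [l|j].
  rewrite big_seq; apply: inS_sum => k k_g; apply: inSZ.
  by apply: (inS_class (gb k k_g)); apply: inSX.
rewrite {1 2}[g]mpolyE raddf_sum /= !mulr_sumr.
under [X in _ = _ + X]eq_bigr do rewrite mulr_sumr.
rewrite exchange_big /= -big_split /=; apply: eq_big_seq => k k_g.
rewrite mderivZ -scalerAr mulX_mderivX.
have -> : (k j)%:Z = b 0 j + \sum_l e j 0 l * mm k 0 l.
  have /(congr1 (fun v : 'rV[int]_n => v 0 j)) := mmP k k_g.
  rewrite !mxE => /(canRL (subrK _)) ->; rewrite addrC; congr (_ + _).
  by apply: eq_bigr => l _; rewrite mulrC.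
rewrite rmorphD rmorph_sum /= mulrDl scalerDr scalerAr; congr (_ + _).
rewrite mulr_suml scaler_sumr; apply: eq_bigr => l _.
by rewrite !intr_scale !scalerA intrM mulrCA.
Qed.

Section DegreeZero.
Variable Q : S -> Prop.
Hypotheses (Q1 : Q 1) (QM : forall g h, Q g -> Q h -> Q (g * h)).
Hypothesis Q_neq0 : forall h, Q h -> h != 0.

(* The Euler relation: the logarithmic derivatives of a function of degree 0
   are determined by its derivatives along the d-dimensional torus. *)
Lemma euler_frac r : deg0_frac e Q r -> exists mu : 'rV[L]_p.+1,
  (forall l, deg0_frac e Q (mu 0 l)) /\
  forall j, z j * dfrac j r = \sum_l mu 0 l * (e j 0 l)%:~R.
Proof.
move=> [b [g [h [gb hb Qh ->]]]].
have [G [Gb dg]] := euler_poly gb; have [H [Hb dh]] := euler_poly hb.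
exists (\row_l ((G l * h - g * H l)%:F / (h ^+ 2)%:F)); split=> [l|j].
  rewrite mxE; exists (b + b), (G l * h - g * H l), (h ^+ 2).
  split; [apply: inSD; last apply: inSN; exact: inSM|exact: inSM|exact: QM|by []].
rewrite dfrac_div ?Q_neq0 // mulrA -tofracM.
have -> : 'X_j * (g^`M(j) * h - g * h^`M(j)) =
          \sum_l (e j 0 l)%:~R * (G l * h - g * H l).
  transitivity ('X_j * g^`M(j) * h - g * ('X_j * h^`M(j))).
    by rewrite mulrBr !mulrA [g * 'X_j]mulrC.
  rewrite dg dh mulrDl mulrDr opprD addrACA mulrCA mulrA subrr add0r.
  rewrite mulr_suml mulr_sumr -sumrB; apply: eq_bigr => l _.
  by rewrite mulrBr [X in _ = X - _]mulrA [X in _ = _ - X]mulrCA.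
rewrite raddf_sum mulr_suml; apply: eq_bigr => l _.
by rewrite mxE [RHS]mulrC mulrA -tofrac_int -tofracM.
Qed.
End DegreeZero.

Definition ray_rows (k : {ffun 'I_p -> 'I_n}) : 'M[int]_(p, p.+1) := \matrix_t e (k t).

(* The contraction of the invariant volume form of the torus by V. *)
Definition Phi (V : 'rV[L]_p.+1) : diff_form R n p :=
  [ffun k => bdet V (map_mx intr (ray_rows k)) / \prod_t z (k t)].

Lemma Phi_sum (I : finType) (P : pred I) (a : I -> L) (V : I -> 'rV[L]_p.+1) :
  Phi (\sum_(s | P s) a s *: V s) = \sum_(s | P s) a s *: Phi (V s).
Proof.
apply/ffunP => k; rewrite ffunE sum_ffunE bdet_sum mulr_suml; apply: eq_bigr => s _.
by rewrite !ffunE -mulrA.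
Qed.

Lemma PhiZ a V : Phi (a *: V) = a *: Phi V.
Proof. by apply/ffunP => k; rewrite !ffunE bdetZ -mulrA. Qed.

(** The matrix of partial derivatives factors as [mu], the transposed matrix of rays and the
    diagonal matrix of the 1/z; [bdet_minors] then reads its determinant as a contraction. *)
Lemma dwedgeE (b : 'I_p -> L)
    (mu : 'M[L]_(p, p.+1)) :
  (forall (s : 'I_p) j, z j * dfrac j (b s) = \sum_l mu s l * (e j 0 l)%:~R) ->
  dwedge b = Phi (minors mu).
Proof.
move=> dbE; apply/ffunP => k; rewrite !ffunE bdet_minors.
have -> : \matrix_(s, t) dfrac (k t) (b s) =
    mu *m (map_mx intr (ray_rows k))^T *m diag_mx (\row_t (z (k t))^-1).
  apply/matrixP => s t; rewrite mul_mx_diag !mxE.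
  apply: (canRL (mulfK (z_neq0 _))); rewrite mulrC dbE.
  by apply: eq_bigr => l _; rewrite !mxE.
rewrite det_mulmx det_diag -prodfV; congr (_ * _).
by apply: eq_bigr => t _; rewrite mxE.
Qed.

(** The pullback of the character t^m of the torus. *)
Definition tmon m : L := \prod_i z i ^ pairing m (e i).

Lemma tmon_neq0 m : tmon m != 0.
Proof. by apply/prodf_neq0 => i _; rewrite expfz_neq0 ?z_neq0. Qed.

Lemma tmonD m m' : tmon (m + m') = tmon m * tmon m'.
Proof.
by rewrite -big_split; apply: eq_bigr => i _; rewrite pairingDl expfzDr ?z_neq0.
Qed.

Lemma tmon0 : tmon 0 = 1.
Proof. by rewrite /tmon big1 // => i _; rewrite pairing0l. Qed.

Lemma tmonN m : tmon (- m) = (tmon m)^-1.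
Proof.
apply: (mulfI (tmon_neq0 m)); rewrite -tmonD subrr tmon0 divff ?tmon_neq0 //.
Qed.

Lemma tmon_sum (I : Type) (s : seq I) (P : pred I) (F : I -> 'rV[int]_p.+1) :
  tmon (\sum_(i <- s | P i) F i) = \prod_(i <- s | P i) tmon (F i).
Proof. by elim/big_rec2: _ => [|i x y _ <-]; rewrite ?tmon0 ?tmonD. Qed.

(** The positive part of the exponents of t^m; the negative part is the positive part for [- m]. *)
Definition mpos m : 'X_{1..n} := [multinom `|Num.max (pairing m (e i)) 0|%N | i < n].

Lemma mpos_sub m i : (mpos m i)%:Z - (mpos (- m) i)%:Z = pairing m (e i).
Proof. by rewrite !mnmE pairingNl; lia. Qed.

Lemma tmonE m : tmon m = 'X_[mpos m]%:F / 'X_[mpos (- m)]%:F.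
Proof.
rewrite !mpolyXE_id !rmorph_prod -prodfV -big_split; apply: eq_bigr => i _ /=.
rewrite -(mpos_sub m i) expfzDr ?z_neq0 // -invr_expz !tofracXn //.
Qed.

Lemma expo_mpos m : expo (mpos m) - expo (mpos (- m)) = alpha e m.
Proof. by apply/rowP => i; rewrite !mxE mpos_sub. Qed.

Lemma deg0_tmon (Q : S -> Prop) m : Q 'X_[mpos (- m)] -> deg0_frac e Q (tmon m).
Proof.
move=> Qm; exists (expo (mpos (- m))), 'X_[mpos m], 'X_[mpos (- m)]; split=> //.
- by apply: (@inS_class _ _ _ _ (expo (mpos m))); [exists m; exact: expo_mpos | exact: inSX].
- exact: inSX.
- exact: tmonE.
Qed.

Lemma dfrac_z j i : dfrac j (z i) = (i == j)%:R.
Proof.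
rewrite /z dfrac_tofrac mderivX -[X in X *: _]/((U_(i)%MM j)%:R) mnm1E.
case: eqP => [->|_]; last by rewrite scale0r tofrac0.
rewrite scale1r (_ : (U_(j) - U_(j))%MM = 0%MM) ?mpolyX0 ?tofrac1 //.
by apply/mnmP => l; rewrite mnmBE subnn mnm0E.
Qed.

Definition logder j r := dfrac j r / r.

Lemma logderM j r s : r != 0 -> s != 0 -> logder j (r * s) = logder j r + logder j s.
Proof.
move=> r0 s0; rewrite /logder dfracM invfM mulrDl; congr (_ + _).
  by rewrite [r^-1 * _]mulrC mulrA mulfK.
by rewrite mulrA [r * _]mulrC mulfK.
Qed.

Lemma logderV j r : r != 0 -> logder j r^-1 = - logder j r.
Proof.
by move=> r0; rewrite /logder dfracV // invrK !mulNr expr2 invfM mulrA divfK.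
Qed.

Lemma logder1 j : logder j 1 = 0.
Proof. by rewrite /logder -tofrac1 dfrac_tofrac -mpolyC1 mderivC tofrac0 mul0r. Qed.

Lemma logderXz j r (a : int) : r != 0 -> logder j (r ^ a) = a%:~R * logder j r.
Proof.
move=> r0; have En (q : nat) : logder j (r ^+ q) = q%:R * logder j r.
  elim: q => [|q IH]; first by rewrite expr0 logder1 mul0r.
  by rewrite exprS logderM ?expf_neq0 // IH -natr1 mulrDl mul1r addrC.
case: a => q; first exact: En.
by rewrite NegzE -invr_expz -[r ^ _]/(r ^+ q.+1) logderV ?expf_neq0 // En mulrNz mulNr.
Qed.

Lemma logder_prod j (I : Type) (s : seq I) (F : I -> L) : (forall i, F i != 0) ->
  logder j (\prod_(i <- s) F i) = \sum_(i <- s) logder j (F i).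
Proof.
move=> F0; elim: s => [|i s IH]; first by rewrite !big_nil logder1.
by rewrite !big_cons logderM ?IH //; elim/big_ind: _ => [|x y|//]; [exact: oner_neq0 | exact: mulf_neq0].
Qed.

Lemma mulz_dfrac_tmon j m : z j * dfrac j (tmon m) = tmon m * (pairing m (e j))%:~R.
Proof.
have -> : dfrac j (tmon m) = logder j (tmon m) * tmon m by rewrite divfK ?tmon_neq0.
rewrite mulrA [RHS]mulrC; congr (_ * _).
rewrite logder_prod => [|i]; last by rewrite expfz_neq0 ?z_neq0.
rewrite (bigD1 j) //= big1 ?addr0 => [|i /negPf ij].
  by rewrite logderXz ?z_neq0 // /logder dfrac_z eqxx mul1r mulrCA mulfV ?mulr1 ?z_neq0.
by rewrite logderXz ?z_neq0 // /logder dfrac_z ij mul0r mulr0.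
Qed.
End Forms.

Section SpanForms.
Variables (R : realType) (n : nat) (A : {fraction {mpoly R[i][n]}} -> Prop) (p : nat).
Local Notation L := {fraction {mpoly R[i][n]}}.
Implicit Types w : diff_form R n p.

Lemma span_forms0 : span_forms A (0 : diff_form R n p).
Proof.
by exists 0%N, (fun=> 0), (fun _ _ => 0); split=> [[]//|[]//|]; rewrite big_ord0.
Qed.

Lemma span_formsD w w' : span_forms A w -> span_forms A w' -> span_forms A (w + w').
Proof.
move=> [r [a [b [aA bA ->]]]] [r' [a' [b' [a'A b'A ->]]]].
exists (r + r')%N.
exists (fun s => match split s with inl i => a i | inr i => a' i end).
exists (fun s => match split s with inl i => b i | inr i => b' i end).
split=> [s|s k|]; [by case: (split s) | by case: (split s) |].
have splitl i : split (lshift r' i) = inl i := unsplitK (inl i).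
have splitr i : split (rshift r i) = inr i := unsplitK (inr i).
rewrite big_split_ord /=; under [X in _ = X + _]eq_bigr do rewrite splitl.
by under [X in _ = _ + X]eq_bigr do rewrite splitr.
Qed.

Lemma span_forms_sum (I : Type) (s : seq I) (P : pred I) (F : I -> diff_form R n p) :
  (forall i, P i -> span_forms A (F i)) -> span_forms A (\sum_(i <- s | P i) F i).
Proof. by move=> FA; elim/big_ind: _ => //; [exact: span_forms0 | exact: span_formsD]. Qed.

Lemma span_formsZ (c : L) w : (forall r s, A r -> A s -> A (r * s)) ->
  A c -> span_forms A w -> span_forms A (c *: w).
Proof.
move=> AM Ac [r [a [b [aA bA ->]]]]; exists r, (fun s => c * a s), b.
by split=> // [s|]; [exact: AM | rewrite scaler_sumr; apply: eq_bigr => s _; rewrite scalerA].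
Qed.

Lemma span_dwedge (c : L) (b : 'I_p -> L) :
  A c -> (forall s, A (b s)) -> span_forms A (c *: dwedge b : diff_form R n p).
Proof.
by move=> Ac bA; exists 1%N, (fun=> c), (fun=> b); split; rewrite ?big_ord1.
Qed.
End SpanForms.

(** * Contractions of the invariant volume form *)

Section Contractions.
Variables (R : realType) (p n : nat) (e : 'I_n -> 'rV[int]_p.+1).
Local Notation C := R[i].
Local Notation S := {mpoly C[n]}.
Local Notation L := {fraction S}.
Local Notation ray i := (map_mx intr (e i) : 'rV[L]_p.+1).
Local Notation Phi := (Phi (R := R) e).
Local Notation tmon := (tmon R e).
Local Notation z := (z R).

(** Minors are polynomials in the logarithmic derivatives, so the vector keeps its entries in the
    same ring of fractions of degree 0 as the form. *)
Lemma span_forms_Phi (Q : S -> Prop) (w : diff_form R n p) :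
  Q 1 -> (forall g h, Q g -> Q h -> Q (g * h)) -> (forall h, Q h -> h != 0) ->
  span_forms (deg0_frac e Q) w ->
  exists V : 'rV[L]_p.+1, (forall l, deg0_frac e Q (V 0 l)) /\ w = Phi V.
Proof.
move=> Q1 QM Q_neq0 [r [a [b [aQ bQ ->]]]].
have muP s : exists mu : 'M[L]_(p, p.+1), (forall t l, deg0_frac e Q (mu t l)) /\
    forall t j, z j * dfrac j (b s t) = \sum_l mu t l * (e j 0 l)%:~R.
  have /choice[mu muP] := fun t => euler_frac QM Q_neq0 (bQ s t).
  exists (\matrix_t mu t); split=> [t l|t j]; first by rewrite mxE; case: (muP t).
  by have [_ ->] := muP t; apply: eq_bigr => l _; rewrite mxE.
have {muP} /choice[mu muP] := muP.
exists (\sum_s a s *: minors (mu s)); split=> [l|].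
  rewrite summxE; apply: deg0_frac_sum => // s _; rewrite mxE; apply: deg0_fracM => //.
  by apply: deg0_frac_minors => // t l'; case: (muP s).
rewrite Phi_sum; apply: eq_bigr => s _; congr (_ *: _); apply: dwedgeE.
by case: (muP s).
Qed.

Lemma dwedge_tmon (B : 'M[int]_(p, p.+1)) (k : {ffun 'I_p -> 'I_n}) :
  (dwedge (fun s => tmon (row s B)) : diff_form R n p) k =
  (\prod_s tmon (row s B)) * (\det (B *m (ray_rows e k)^T))%:~R / \prod_t z (k t).
Proof.
pose mu := \matrix_(s, l) (tmon (row s B) * (B s l)%:~R).
rewrite (dwedgeE (mu := mu) (e := e)) => [|s j]; last first.
  rewrite mulz_dfrac_tmon; have -> : (pairing (row s B) (e j))%:~R =
      \sum_l (B s l)%:~R * (e j 0 l)%:~R :> L.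
    by rewrite rmorph_sum; apply: eq_bigr => l _; rewrite mxE rmorphM.
  by rewrite mulr_sumr; apply: eq_bigr => l _; rewrite mxE mulrA.
rewrite ffunE bdet_minors; congr (_ / _).
have -> : mu = diag_mx (\row_s tmon (row s B)) *m map_mx intr B.
  by apply/matrixP => s l; rewrite mul_diag_mx !mxE.
rewrite -mulmxA det_mulmx det_diag map_trmx -map_mxM det_map_mx; congr (_ * _).
by apply: eq_bigr => s _; rewrite mxE.
Qed.

(** The volume form is, up to [\det B], the wedge of the logarithmic differentials of the characters
    in the rows of [B]; contracting it drops one factor at a time, with the sign and the pairing
    shown. The inverse character makes the remaining differentials logarithmic. *)
Lemma Phi_tmon (B : 'M[int]_p.+1) (v : 'rV[int]_p.+1) : \det B != 0 ->
  Phi (map_mx intr v) = \sum_(l < p.+1)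
    ((\det B)%:~R^-1 * ((-1) ^+ l * pairing (row l B) v)%:~R
       * (tmon (\sum_s row s (row' l B)))^-1)
    *: dwedge (fun s => tmon (row s (row' l B))).
Proof.
move=> B0; have B0' : (\det B)%:~R != 0 :> L by rewrite intrL_eq0.
apply/ffunP => k; rewrite ffunE sum_ffunE map_bdet /=.
have -> : (bdet v (ray_rows e k))%:~R = (\det B)%:~R^-1 *
    \sum_(l < p.+1) ((-1) ^+ l * pairing (row l B) v)%:~R * (\det (row' l B *m (ray_rows e k)^T))%:~R :> L.
  apply: (mulfI B0'); rewrite mulVKf // -intrM bdet_mul rmorph_sum.
  by apply: eq_bigr => l _; rewrite -intrM pairing_rowE mulrCA mulrA.
rewrite mulr_sumr mulr_suml; apply: eq_bigr => l _.
rewrite ffunE dwedge_tmon -tmon_sum; set t := tmon _.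
have t0 : t != 0 by exact: tmon_neq0.
by rewrite -[RHS]/(_ * t^-1 * (t * _ / _)) -!mulrA mulKf.
Qed.

Lemma minors_mull (F : comNzRingType) (A : 'M[F]_p) (Y : 'M[F]_(p, p.+1)) :
  minors (A *m Y) = \det A *: minors Y.
Proof.
apply/rowP => l; rewrite !mxE mulrCA; congr (_ * _).
by rewrite -det_mulmx; congr (\det _); apply/matrixP => i j; rewrite !mxE; apply: eq_bigr => k _; rewrite mxE.
Qed.

Lemma bdet_mull (F : comNzRingType) (A : 'M[F]_p) v (Y : 'M[F]_(p, p.+1)) :
  bdet v (A *m Y) = \det A * bdet v Y.
Proof.
rewrite !bdetE minors_mull mulr_sumr; apply: eq_bigr => l _.
by rewrite [in LHS]mxE mulrCA.
Qed.

Lemma detE_cons (i i0 : 'I_n) (I : seq 'I_n) :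
  detE e i0 (i :: I) = bdet (e i) (\matrix_(s < p) e (nth i0 I s)).
Proof.
rewrite /detE /bdet -det_tr; congr (\det _); apply/matrixP => s j; rewrite mxE mxE.
case: (unliftP ord0 s) => [s' ->|->]; first by rewrite borderS !mxE.
by rewrite border0.
Qed.

Definition incidence (i : 'I_n) (J : {set 'I_n}) (k : {ffun 'I_p -> 'I_n}) : 'M[int]_p :=
  \matrix_(s, t) (nth i (enum J) s == k t)%:R.

Lemma dz_incidence i (J : {set 'I_n}) k :
  (dz R i p (enum J) : diff_form R n p) k = (\det (incidence i J k))%:~R.
Proof.
rewrite ffunE -det_map_mx; congr (\det _); apply/matrixP => s t; rewrite !mxE.
by rewrite -[FracField.tofrac _]/(z _) dfrac_z rmorph_nat.
Qed.

Lemma nth_enum_mem i (J : {set 'I_n}) (s : 'I_p) : #|J| = p -> nth i (enum J) s \in J.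
Proof. by move=> Jp; rewrite -mem_enum mem_nth // -cardE Jp. Qed.

Lemma det_incidence0 i (J : {set 'I_n}) (k : {ffun 'I_p -> 'I_n}) t : #|J| = p -> k t \notin J ->
  \det (incidence i J k) = 0.
Proof.
move=> Jp ktJ; rewrite (expand_det_col _ t) big1 // => s _; rewrite mxE.
case: eqP => [E|_]; last by rewrite mul0r.
by case/negP: ktJ; rewrite -E nth_enum_mem.
Qed.

Lemma bdet_incidence i (J : {set 'I_n}) (k : {ffun 'I_p -> 'I_n}) : #|J| = p -> (forall t, k t \in J) ->
  \det (incidence i J k) * bdet (e i) (\matrix_(s < p) e (nth i (enum J) s)) =
  bdet (e i) (ray_rows e k).
Proof.
move=> Jp kJ; rewrite -det_tr -bdet_mull; congr bdet; apply/row_matrixP => t.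
rewrite row_mul rowK mulmx_sum_row.
have kt : (index (k t) (enum J) < p)%N.
  by have := kJ t; rewrite -mem_enum -index_mem -cardE Jp.
rewrite (bigD1 (Ordinal kt)) //= big1 ?addr0 => [|s s_neq].
  by rewrite !mxE /= nth_index ?mem_enum // eqxx scale1r rowK nth_index ?mem_enum.
rewrite !mxE; case: eqP => [E|_]; last by rewrite scale0r.
by case/eqP: s_neq; apply: val_inj; rewrite /= -E index_uniq ?enum_uniq // -cardE Jp.
Qed.

(** Treats both families at once, with [A] equal to {i} or {i, j}. At a tuple [k] only the set of
    values of [k] contributes; if [k] repeats an index or meets [A], both sides vanish, on the right
    because two rows of the determinant are equal or opposite. *)
Lemma sum_incidence (A : {set 'I_n}) i : i \in A ->
  (forall j, j \in A -> e j = e i \/ e j = - e i) ->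
  \sum_(J : {set 'I_n} | (#|J| == p) && [disjoint A & J])
     ((detE e i (i :: enum J))%:~R * (zhat R (A :|: J))%:F : L)
       *: dz R i p (enum J) =
  Phi ((zhat R A)%:F *: ray i).
Proof.
move=> iA eA; apply/ffunP => k; rewrite sum_ffunE ffunE bdetZ map_bdet /=.
have termE (J : {set 'I_n}) : (((detE e i (i :: enum J))%:~R * (zhat R (A :|: J))%:F : L)
       *: dz R i p (enum J)) k =
   (\det (incidence i J k) * bdet (e i) (\matrix_(s < p) e (nth i (enum J) s)))%:~R
     * (zhat R (A :|: J))%:F.
  by rewrite ffunE dz_incidence detE_cons -[LHS]/(_ * _ * _) intrM mulrAC [X in X * _]mulrC.
under eq_bigr do rewrite termE.
have [/andP[/injectiveP k_inj /forallP kA]|/nandP k_sing] :=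
  boolP (injectiveb k && [forall t, k t \notin A]).
  pose J0 := [set k t | t in 'I_p].
  have J0p : #|J0| = p by rewrite card_imset // card_ord.
  have J0A : [disjoint A & J0].
    rewrite disjoint_sym; apply/pred0P => l /=; apply/negP => /andP[/imsetP[t _ ->]].
    by apply/negP.
  rewrite (bigD1 J0) ?J0p ?eqxx //= big1 ?addr0 => [|J /andP[/andP[/eqP Jp _] JJ0]].
    rewrite bdet_incidence // => [|t]; last exact: imset_f.
    rewrite [(zhat R A)%:F * _]mulrC -mulrA; congr (_ * _).
    apply: (canRL (mulfK _)); first by apply/prodf_neq0 => t _; apply: z_neq0.
    have <- : \prod_(l in J0) z l = \prod_t z (k t).
      by rewrite big_imset //= => t t' _ _; apply: k_inj.
    (* The denominator of the contraction consists exactly of the factors indexed by [J0], which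
       [zhat] of the union omits. *)
    rewrite /zhat !rmorph_prod /= [RHS](bigID (mem J0)) /= mulrC; congr (_ * _).
      apply: eq_bigl => l; rewrite andb_idl // => lJ0.
      by rewrite (disjointFl J0A).
    by apply: eq_bigl => l; rewrite inE negb_or.
  have [t ktJ] : exists t, k t \notin J.
    apply: contrapT => H; case/eqP: JJ0; apply/esym/eqP; rewrite eqEcard Jp J0p leqnn andbT.
    apply/subsetP => _ /imsetP[t _ ->]; apply/negPn/negP => ktJ; apply: H.
    by exists t.
  by rewrite (det_incidence0 _ Jp ktJ) mul0r mul0r.
suff [-> det0] : bdet (e i) (ray_rows e k) = 0 /\
    forall J : {set 'I_n}, #|J| = p -> [disjoint A & J] -> \det (incidence i J k) = 0.
  rewrite mulr0z mulr0 mul0r big1 // => J /andP[/eqP Jp AJ].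
  by rewrite det0 // mul0r mul0r.
case: k_sing => [/injectivePn[t [t' tt' ktt']]|].
  split=> [|J _ _].
    apply: (determinant_alternate (i1 := lift ord0 t) (i2 := lift ord0 t')).
      by rewrite (inj_eq lift_inj).
    by move=> j; rewrite !borderS !mxE ktt'.
  by rewrite -det_tr; apply: (determinant_alternate tt') => s; rewrite !mxE ktt'.
rewrite negb_forall => /existsP[t]; rewrite negbK => ktA; split=> [|J Jp AJ].
  have Et : row t (ray_rows e k) = e (k t) by rewrite rowK.
  have [E|E] := eA _ ktA; first by rewrite -E -Et bdet_row.
  have -> : e i = -1 *: e (k t) by rewrite E scaleN1r opprK.
  by rewrite bdetZ -Et bdet_row mulr0.
by apply: (det_incidence0 _ Jp (t := t)); rewrite (disjointFr AJ).
Qed.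

Lemma Omega1E i : Omega1 R e i = Phi ((zhat R [set i])%:F *: ray i).
Proof.
rewrite -(sum_incidence (A := [set i])) ?set11 // => [|j /set1P ->]; last by left.
by apply: eq_bigl => J; rewrite disjoints1.
Qed.

Lemma Omega2E i j : e i = - e j -> Omega2 R e i j = Phi ((zhat R [set i; j])%:F *: ray i).
Proof.
move=> eij; rewrite -(sum_incidence (A := [set i; j])) ?set21 // => [|l /set2P[]->].
- apply: eq_big => [J|J _]; first by rewrite -setI_eq0 setIUl setU_eq0 !setI_eq0 !disjoints1.
  by rewrite setUA.
- by left.
- by right; rewrite eij opprK.
Qed.

End Contractions.

(** * Smooth points *)

Section LocalRings.
Variables (R : realType) (p n : nat) (e : 'I_n -> 'rV[int]_p.+1).
Local Notation C := R[i].
Local Notation S := {mpoly C[n]}.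
Local Notation L := {fraction S}.
Local Notation tmon := (tmon R e).
Variable x : 'I_n -> C.
Implicit Types (b c : 'rV[int]_n) (g h : S) (r s : L) (m : 'rV[int]_p.+1) (k : 'X_{1..n}).

Definition nonvanishing g : Prop := g.@[x] != 0.

Lemma nonvanishing1 : nonvanishing 1.
Proof. by rewrite /nonvanishing meval1 oner_neq0. Qed.

Lemma nonvanishingM g h : nonvanishing g -> nonvanishing h -> nonvanishing (g * h).
Proof. by rewrite /nonvanishing mevalM; apply: mulf_neq0. Qed.

Lemma nonvanishing_neq0 g : nonvanishing g -> g != 0.
Proof. by apply: contra_neq => ->; rewrite meval0. Qed.

Hint Resolve nonvanishing1 nonvanishingM nonvanishing_neq0 : core.

Lemma nonvanishingX k : nonvanishing 'X_[k] <-> forall j, x j = 0 -> k j = 0%N.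
Proof.
rewrite /nonvanishing mevalX; split=> [/prodf_neq0 xk j xj|xk].
  apply/eqP; have := xk j isT; rewrite xj; apply: contraNT; rewrite -lt0n => kj.
  by rewrite expr0n -(prednK kj).
apply/prodf_neq0 => j _; have [/xk ->|xj] := eqVneq (x j) 0; first by rewrite oner_neq0.
exact: expf_neq0.
Qed.

(** The condition for t^m to be regular at the image of [x]. *)
Definition effective m : Prop := forall j, x j = 0 -> 0 <= pairing m (e j).

Lemma effectiveP m : effective m <-> nonvanishing 'X_[mpos e (- m)].
Proof.
rewrite nonvanishingX; split=> E j /E; rewrite mnmE pairingNl; lia.
Qed.

Lemma effectiveD m m' : effective m -> effective m' -> effective (m + m').
Proof. by move=> E E' j xj; rewrite pairingDl addr_ge0 ?E ?E'. Qed.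

Lemma local_tmon m : effective m -> local_ring e x (tmon m).
Proof. by move/effectiveP => E; apply: (deg0_tmon (Q := nonvanishing)). Qed.

Lemma localM r s : local_ring e x r -> local_ring e x s -> local_ring e x (r * s).
Proof. exact: (deg0_fracM nonvanishingM). Qed.

Lemma localD r s : local_ring e x r -> local_ring e x s -> local_ring e x (r + s).
Proof. exact: (deg0_fracD nonvanishingM nonvanishing_neq0). Qed.

Lemma local_const (a : C) : local_ring e x (a%:MP%:F).
Proof. exact: (deg0_frac_const _ nonvanishing1). Qed.

Lemma max_idealM r s : local_ring e x r -> max_ideal e x s -> max_ideal e x (r * s).
Proof.
move=> [b [g [h [gb hb hx ->]]]] [c [g' [h' [g'c h'c h'x g'x ->]]]].
exists (b + c), (g * g'), (h * h'); split; [exact: inSM|exact: inSM|exact: nonvanishingM| |].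
  by rewrite mevalM g'x mulr0.
by rewrite mulf_div -!tofracM.
Qed.

Lemma max_idealD r s : max_ideal e x r -> max_ideal e x s -> max_ideal e x (r + s).
Proof.
move=> [b [g [h [gb hb hx gx ->]]]] [c [g' [h' [g'c h'c h'x g'x ->]]]].
exists (b + c), (g * h' + g' * h), (h * h').
split; [|exact: inSM|exact: nonvanishingM| |].
- by apply: inSD; rewrite 1?[g' * h]mulrC; apply: inSM.
- by rewrite mevalD !mevalM gx g'x !mul0r addr0.
- by rewrite addf_div ?tofrac_eq0 ?nonvanishing_neq0 // -!tofracM -tofracD.
Qed.

Lemma max_ideal_sum (I : Type) (s : seq I) (P : pred I) (F : I -> L) :
  (forall i, P i -> max_ideal e x (F i)) -> max_ideal e x (\sum_(i <- s | P i) F i).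
Proof.
move=> FP; elim/big_ind: _ => //; last exact: max_idealD.
exists 0, 0, 1; split; rewrite ?meval0 ?meval1 ?oner_neq0 ?tofrac0 ?mul0r //.
  exact: inS0.
by rewrite -mpolyC1; apply: inSC.
Qed.

Lemma max_ideal_const (a : C) : max_ideal e x (a%:MP%:F) -> a = 0.
Proof.
move=> [b [g [h [gb hb hx gx E]]]].
have : a%:MP * h = g.
  apply/eqP; rewrite -tofrac_eq tofracM E divfK //.
  by rewrite tofrac_eq0 nonvanishing_neq0.
move/(congr1 (meval x)); rewrite mevalM mevalC gx => /eqP.
by rewrite mulf_eq0 (negPf hx) orbF => /eqP.
Qed.

Definition tmon_at m : C := 'X_[mpos e m].@[x] / 'X_[mpos e (- m)].@[x].

Lemma max_ideal_tmon m : effective m -> max_ideal e x (tmon m - (tmon_at m)%:MP%:F).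
Proof.
move/effectiveP => E.
exists (expo (mpos e (- m))), ('X_[mpos e m] - tmon_at m *: 'X_[mpos e (- m)]), 'X_[mpos e (- m)].
split=> //.
- apply: inSD; last by apply/inSN/inSZ/inSX.
  by apply: (@inS_class _ _ _ _ (expo (mpos e m))); [exists m; exact: expo_mpos | exact: inSX].
- exact: inSX.
- by rewrite mevalB mevalZ divfK // subrr.
- rewrite tmonE tofracB -mul_mpolyC tofracM mulrBl mulfK // tofrac_eq0.
  exact: nonvanishing_neq0.
Qed.

Lemma tmon_expo k k' m : expo k - expo k' = alpha e m ->
  tmon m = 'X_[k]%:F / 'X_[k']%:F.
Proof.
move=> E; rewrite !mpolyXE_id !rmorph_prod -prodfV -big_split; apply: eq_bigr => i _ /=.
have /(congr1 (fun v : 'rV[int]_n => v 0 i)) := E; rewrite !mxE => <-.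
by rewrite expfzDr ?z_neq0 // -invr_expz !tofracXn.
Qed.

Section OneZero.
Variables (i : 'I_n) (B : 'M[int]_p.+1).
Hypotheses (B_unit : B \in unitmx)
  (B_dual : forall l, pairing (row l B) (e i) = (l == 0)%:R)
  (x_neq0 : forall j, j != i -> x j != 0).

Lemma effective_i m : 0 <= pairing m (e i) -> effective m.
Proof.
by move=> mi j; have [->//|/x_neq0/negP jx /eqP] := eqVneq j i.
Qed.

(** The generators required by [smooth_at]: the characters of a basis containing the dual vector of
    [e i], shifted so as to vanish at [x]. *)
Let t (l : 'I_p.+1) : L := tmon (row l B) - (tmon_at (row l B))%:MP%:F.

Lemma effective_row l : effective (row l B).
Proof. by apply: effective_i; rewrite B_dual ler0n. Qed.

Let ideal r : Prop := exists a : 'I_p.+1 -> L,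
  (forall l, local_ring e x (a l)) /\ r = \sum_l a l * t l.

Lemma ideal_max r : ideal r -> max_ideal e x r.
Proof.
move=> [a [aL ->]]; apply: max_ideal_sum => l _; apply: max_idealM => //.
exact/max_ideal_tmon/effective_row.
Qed.

Lemma idealD r s : ideal r -> ideal s -> ideal (r + s).
Proof.
move=> [a [aL ->]] [a' [a'L ->]]; exists (fun l => a l + a' l); split=> [l|].
  exact: localD.
by rewrite -big_split; apply: eq_bigr => l _; rewrite mulrDl.
Qed.

Lemma idealM r s : local_ring e x r -> ideal s -> ideal (r * s).
Proof.
move=> rL [a [aL ->]]; exists (fun l => r * a l); split=> [l|]; first exact: localM.
by rewrite mulr_sumr; apply: eq_bigr => l _; rewrite mulrA.
Qed.

Lemma ideal0 : ideal 0.
Proof.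
exists (fun=> 0); split=> [l|]; last by rewrite big1 // => l _; rewrite mul0r.
by rewrite -tofrac0 -mpolyC0; apply: local_const.
Qed.

Lemma ideal_t l : ideal (t l).
Proof.
exists (fun j => ((j == l)%:R : C)%:MP%:F); split=> [j|]; first exact: local_const.
rewrite (bigD1 l) //= eqxx mpolyC1 tofrac1 mul1r big1 ?addr0 // => j /negPf ->.
by rewrite mpolyC0 tofrac0 mul0r.
Qed.

(** The goal is that every character regular at [x] is constant modulo the ideal of the [t l];
    effectiveness is carried along so that sums of exponents can be treated as products of regular
    functions. *)
Let constant_mod m : Prop :=
  effective m /\ exists a : C, ideal (tmon m - a%:MP%:F).

Lemma constant_modD m m' :
  constant_mod m -> constant_mod m' -> constant_mod (m + m').
Proof.
move=> [mE [a ma]] [m'E [a' ma']]; split; first exact: effectiveD.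
exists (a * a'); rewrite (_ : _ - _ =
    tmon m * (tmon m' - a'%:MP%:F) + a'%:MP%:F * (tmon m - a%:MP%:F)).
  by apply: idealD; apply: idealM => //; [exact: local_tmon | exact: local_const].
rewrite tmonD mpolyCM tofracM !mulrBr addrA; congr (_ - _); last exact: mulrC.
by rewrite [a'%:MP%:F * _]mulrC subrK.
Qed.

Lemma constant_modN m : effective (- m) -> constant_mod m -> constant_mod (- m).
Proof.
move=> mE [_ [a ma]]; split=> //.
(* With residue 0, the identity t^(-m) = t^(-2m) t^m places t^(-m) in the ideal, since t^(-m) is
   regular. *)
have [a0|a0] := eqVneq a 0.
  exists 0; move: ma; rewrite a0 !mpolyC0 !tofrac0 !subr0 => ma.
  have -> : tmon (- m) = tmon (- m) * tmon (- m) * tmon m.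
    by rewrite -mulrA [X in _ * X]mulrC -tmonD subrr tmon0 mulr1.
  by apply: idealM => //; apply: localM; apply: local_tmon.
exists a^-1; have -> : tmon (- m) - (a^-1)%:MP%:F =
    ((- a^-1)%:MP%:F * tmon (- m)) * (tmon m - a%:MP%:F).
  have E : tmon (- m) * tmon m = 1 by rewrite -tmonD addNr tmon0.
  rewrite mulrBr -!mulrA E mulr1 [X in _ = _ - X]mulrCA -tofracM -mpolyCM mulNr mulVf //.
  by rewrite !mpolyCN !tofracN mpolyC1 tofrac1 mulrN1 opprK addrC.
by apply: idealM => //; apply: localM; [exact: local_const | exact: local_tmon].
Qed.

Lemma constant_mod0 : constant_mod 0.
Proof.
split=> [j _|]; first by rewrite pairing0l.
by exists 1; rewrite tmon0 mpolyC1 tofrac1 subrr; apply: ideal0.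
Qed.

Lemma constant_modZ (a : int) m : 0 <= a \/ effective (- m) ->
  constant_mod m -> constant_mod (a *: m).
Proof.
move=> am mG; have mGn (q : nat) : constant_mod (q%:Z *: m).
  elim: q => [|q IH]; first by rewrite scale0r; apply: constant_mod0.
  by rewrite intS scalerDl scale1r; apply: constant_modD.
case: a am => q am; first exact: mGn.
rewrite NegzE scaleNr; apply: constant_modN; last exact: mGn.
case: am => // E j xj; rewrite -scalerN pairingZl mulr_ge0 //.
exact: E.
Qed.

(** All rows but the first pair to zero with [e i], so they enter with any integer coefficient; the
    coefficient of the first row is [pairing m (e i)], nonnegative if [x i] is zero. If [x i] is
    nonzero, every character is invertible at [x]. *)
Lemma constant_mod_effective m : effective m -> constant_mod m.
Proof.
move=> mE; have -> : m = \sum_l (m *m invmx B) 0 l *: row l B.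
  by rewrite -mulmx_sum_row mulmxKV.
elim/big_ind: _ => [|m1 m2|l _]; [exact: constant_mod0 | exact: constant_modD |].
apply: constant_modZ; last first.
  split; first exact: effective_row.
  by exists (tmon_at (row l B)); apply: ideal_t.
have [xi|xi] := eqVneq (x i) 0; last first.
  by right=> j xj; case: (eqVneq j i) xj xi => [-> -> /eqP//|/x_neq0/eqP jx /jx].
have [->|l0] := eqVneq l 0; last first.
  by right; apply: effective_i; rewrite pairingNl B_dual (negPf l0) oppr0.
left; have := mE i xi; congr (0 <= _).
rewrite -{1}[m](mulmxKV B_unit) mulmx_sum_row pairing_suml (bigD1 0) //= big1 => [|j /negPf j0].
  by rewrite addr0 pairingZl B_dual eqxx mulr1.
by rewrite pairingZl B_dual j0 mulr0.
Qed.

Lemma smooth_at_one_zero : smooth_at e x.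
Proof.
exists t; split=> [l|r]; first exact/max_ideal_tmon/effective_row.
move=> r_max; have [b [g [h [gb hb hx gx rE]]]] := r_max; change (ideal r).
(* A monomial of the denominator that is nonzero at [x]: up to the regular factor [v], the function
   becomes a combination [u] of effective characters. *)
have [k0 k0_h k0x] : exists2 k0, k0 \in msupp h & nonvanishing 'X_[k0].
  apply: contrapT => H; case/eqP: hx; rewrite mevalE big_seq big1 // => k k_h.
  rewrite -mevalX; have [->|nz] := eqVneq ('X_[k]).@[x] 0; first by rewrite mulr0.
  by case: H; exists k.
have hF : h%:F != 0 by rewrite tofrac_eq0 nonvanishing_neq0.
have XF : 'X_[k0]%:F != 0 :> L by rewrite tofrac_eq0 mpolyX_neq0.
pose u : L := g%:F / 'X_[k0]%:F; pose v : L := 'X_[k0]%:F / h%:F.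
have ruv : r = v * u by rewrite rE /u /v [RHS]mulrC mulrA divfK.
have k0b : same_class e (expo k0) b := hb k0 k0_h.
have vL : local_ring e x v.
  by exists b, 'X_[k0], h; split=> //; apply: (inS_class k0b); apply: inSX.
have u_max : max_ideal e x u.
  by exists b, g, 'X_[k0]; split=> //; apply: (inS_class k0b); apply: inSX.
rewrite ruv; apply: idealM => //.
have /choice[mm mmP] : forall k, exists m, k \in msupp g -> expo k - expo k0 = alpha e m.
  move=> k; have [k_g|_] := boolP (k \in msupp g); last by exists 0.
  by have [m E] := same_class_trans (gb k k_g) (same_class_sym k0b); exists m.
have /choice[a aP] : forall k, exists a : C, k \in msupp g -> ideal (tmon (mm k) - a%:MP%:F).
  move=> k; have [k_g|_] := boolP (k \in msupp g); last by exists 0.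
  have [|_ [a ma]] := @constant_mod_effective (mm k); last by exists a.
  move=> j xj; have /(congr1 (fun v : 'rV[int]_n => v 0 j)) := mmP k k_g.
  by rewrite !mxE => <-; rewrite (nonvanishingX k0).1 // subr0.
pose c := \sum_(k <- msupp g) g@_k * a k.
have uE : u = \sum_(k <- msupp g) (g@_k)%:MP%:F * (tmon (mm k) - (a k)%:MP%:F) + c%:MP%:F.
  rewrite /u {1}[g]mpolyE !raddf_sum mulr_suml -big_split; apply: eq_big_seq => k k_g /=.
  rewrite -mul_mpolyC tofracM -mulrA -(tmon_expo (mmP k k_g)) mulrBr.
  by rewrite -tofracM -mpolyCM subrK.
have sum_ideal : ideal (\sum_(k <- msupp g) (g@_k)%:MP%:F * (tmon (mm k) - (a k)%:MP%:F)).
  rewrite big_seq; elim/big_ind: _ => [|r1 r2|k k_g]; [exact: ideal0 | exact: idealD |].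
  by apply: idealM; [exact: local_const | exact: aP].
(* [c] is the residue of [u] modulo the ideal; both [u] and the ideal vanish at [x], so the constant
   does too. *)
suff c0 : c = 0 by rewrite uE c0 mpolyC0 tofrac0 addr0.
apply: max_ideal_const.
have -> : c%:MP%:F = u + (-1)%:MP%:F * (u - c%:MP%:F).
  by rewrite mpolyCN tofracN mpolyC1 tofrac1 mulN1r opprB addrC subrK.
apply: max_idealD => //; apply: max_idealM; first exact: local_const.
by apply: ideal_max; rewrite uE addrK.
Qed.

End OneZero.
End LocalRings.

(** * The cotangent space at a point *)

Section CotangentSpace.
Variables (R : realType) (p n : nat) (e : 'I_n -> 'rV[int]_p.+1).
Local Notation C := R[i].
Local Notation S := {mpoly C[n]}.
Local Notation L := {fraction S}.
Variable x : 'I_n -> C.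
Implicit Types (b c : 'rV[int]_n) (g h : S) (r s : L) (m : 'rV[int]_p.+1) (k : 'X_{1..n}).

(* A linear form on S inducing one on the cotangent space of the local ring. *)
Definition cotangent (f : S -> C) : Prop :=
  (forall g h, f (g + h) = f g + f h) /\
  forall b g h1 c h h2,
    inS e b g -> inS e b h1 -> h1.@[x] != 0 -> g.@[x] = 0 ->
    inS e c h -> inS e c h2 -> h2.@[x] != 0 -> f (g * h) = f g * h.@[x].

(** The value of the induced form on the class of g/h modulo the square of the maximal ideal, as a
    relation because it is read off a representation. *)
Definition cotangent_value (f : S -> C) r (v : C) : Prop :=
  exists b, exists g h,
    [/\ inS e b g, inS e b h, h.@[x] != 0, g.@[x] = 0 &
     r = g%:F / h%:F /\ v = f g / h.@[x]].

Section Values.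
Variable f : S -> C.
Hypothesis f_cot : cotangent f.

Lemma cotangent_value_fun r v v' :
  cotangent_value f r v -> cotangent_value f r v' -> v = v'.
Proof.
move=> [b [g [h [gb hb hx gx [-> ->]]]]] [c [g' [h' [g'c h'c h'x g'x [E ->]]]]].
have [_ fM] := f_cot; apply/eqP; rewrite eqr_div //.
have gh : g * h' = g' * h.
  by apply/eqP; move/eqP: E; rewrite frac_div_eq ?(nonvanishing_neq0 (x := x)) // => /eqP.
by rewrite -(fM _ _ _ _ _ _ gb hb hx gx h'c h'c h'x) -(fM _ _ _ _ _ _ g'c h'c h'x g'x hb hb hx) gh.
Qed.

Lemma cotangent_valueD r s v w : cotangent_value f r v -> cotangent_value f s w ->
  cotangent_value f (r + s) (v + w).
Proof.
move=> [b [g [h [gb hb hx gx [-> ->]]]]] [c [g' [h' [g'c h'c h'x g'x [-> ->]]]]].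
have [fD fM] := f_cot.
exists (b + c), (g * h' + g' * h), (h * h').
split; [|exact: inSM|exact: nonvanishingM|by rewrite mevalD !mevalM gx g'x !mul0r addr0|].
  by apply: inSD; rewrite 1?[g' * h]mulrC; apply: inSM.
split; first by rewrite addf_div ?tofrac_eq0 ?(nonvanishing_neq0 (x := x)) // -!tofracM -tofracD.
rewrite fD (fM _ _ _ _ _ _ gb hb hx gx h'c h'c h'x) (fM _ _ _ _ _ _ g'c h'c h'x g'x hb hb hx).
by rewrite mevalM addf_div.
Qed.

Lemma cotangent_valueM b g h r v : inS e b g -> inS e b h -> h.@[x] != 0 ->
  cotangent_value f r v -> cotangent_value f (g%:F / h%:F * r) (g.@[x] / h.@[x] * v).
Proof.
move=> gb hb hx [c [g' [h' [g'c h'c h'x g'x [-> ->]]]]].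
have [_ fM] := f_cot.
exists (c + b), (g' * g), (h' * h).
split; [exact: inSM|exact: inSM|exact: nonvanishingM|by rewrite mevalM g'x mul0r|].
split; first by rewrite mulf_div -!tofracM [g * _]mulrC [h * _]mulrC.
rewrite (fM _ _ _ _ _ _ g'c h'c h'x g'x gb hb hx) mevalM mulf_div.
by rewrite [g.@[x] * _]mulrC [h.@[x] * _]mulrC.
Qed.

Lemma cotangent_value0 : cotangent_value f 0 0.
Proof.
have [fD _] := f_cot.
have f0 : f 0 = 0 by apply: (addrI (f 0)); rewrite -fD !addr0.
exists 0, 0, 1; split; rewrite ?meval0 ?meval1 ?oner_neq0 ?f0 ?tofrac0 ?mul0r //.
  exact: inS0.
by rewrite -mpolyC1; apply: inSC.
Qed.
End Values.

(** Expanding the [s j] in the generators factors an identity matrix of size [#|T|] through a space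
    of dimension [p.+1]. *)
Lemma smooth_at_cotangent (T : finType) (f : T -> S -> C) (s : T -> L) (v : T -> C) :
  smooth_at e x -> (forall i, cotangent (f i)) -> (forall i, max_ideal e x (s i)) ->
  (forall i, v i != 0) ->
  (forall i j, cotangent_value (f i) (s j) (if i == j then v i else 0)) ->
  (#|T| <= p.+1)%N.
Proof.
move=> [t [t_max t_gen]] f_cot s_max v0 fsv.
have tP l : exists gh : S * S, exists b,
    [/\ inS e b gh.1, inS e b gh.2, gh.2.@[x] != 0, gh.1.@[x] = 0 & t l = gh.1%:F / gh.2%:F].
  by have [b [g [h H]]] := t_max l; exists (g, h), b.
have {tP} /choice[gh ghP] := tP.
pose A i l : C := f i (gh l).1 / (gh l).2.@[x].
have aP j : exists a : 'I_p.+1 -> C, forall i,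
    cotangent_value (f i) (s j) (\sum_l a l * A i l).
  have [a [aL ->]] := t_gen _ (s_max j).
  have qP l : exists gh : S * S, exists b,
      [/\ inS e b gh.1, inS e b gh.2, gh.2.@[x] != 0 & a l = gh.1%:F / gh.2%:F].
    by have [b [g [h H]]] := aL l; exists (g, h), b.
  have {qP} /choice[q qP] := qP.
  exists (fun l => (q l).1.@[x] / (q l).2.@[x]) => i.
  elim/big_rec2: _ => [|l r w _ IH]; first exact: cotangent_value0.
  apply: cotangent_valueD => //.
  have [b [qb q'b qx ->]] := qP l; apply: (cotangent_valueM (f_cot i) qb) => //.
  by have [c [gc hc hx gx ->]] := ghP l; exists c, (gh l).1, (gh l).2.
have {aP} /choice[a aP] := aP.
pose MA := \matrix_(i < #|T|, l < p.+1) A (enum_val i) l.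
pose Ma := \matrix_(l < p.+1, j < #|T|) (a (enum_val j) l / v (enum_val j)).
apply: (mulmx1_min (A := MA) (B := Ma)); apply/matrixP => i j; rewrite !mxE.
under eq_bigr do rewrite !mxE mulrA [X in X / _]mulrC.
rewrite -mulr_suml.
have := cotangent_value_fun (f_cot _) (fsv (enum_val i) (enum_val j)) (aP _ _).
rewrite (inj_eq enum_val_inj) => E.
by rewrite -E; case: eqP => [->|_]; rewrite ?divff ?mul0r.
Qed.

(** The derivative at [x] along the element [c] of the Lie algebra of the torus acting on affine
    space. *)
Definition torus_deriv (c : 'I_n -> C) g : C := \sum_j c j * (x j * g^`M(j).@[x]).

Lemma cotangent_torus_deriv (c : 'I_n -> C) : cotangent (torus_deriv c).
Proof.
split=> [g h|b g h1 b' h h2 _ _ _ gx _ _ _].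
  rewrite -big_split; apply: eq_bigr => j _.
  by rewrite mderivD mevalD !mulrDr.
rewrite mulr_suml; apply: eq_bigr => j _.
by rewrite mderivM mevalD !mevalM gx mul0r addr0 !mulrA.
Qed.

Lemma torus_derivX (c : 'I_n -> C) k : torus_deriv c 'X_[k] = (\sum_j c j * (k j)%:R) * ('X_[k]).@[x].
Proof.
rewrite mulr_suml; apply: eq_bigr => j _; rewrite -mulrA; congr (_ * _).
have /(congr1 (meval x)) := mulX_mderivX R j k.
by rewrite intr_scale mevalZ mevalM mevalXU.
Qed.

Lemma torus_derivZ (c : 'I_n -> C) (a : C) g : torus_deriv c (a *: g) = a * torus_deriv c g.
Proof.
rewrite mulr_sumr; apply: eq_bigr => j _.
by rewrite mderivZ mevalZ [x j * _]mulrCA [c j * _]mulrCA.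
Qed.

Definition restr k : 'X_{1..n} := [multinom (if x i == 0%R then k i else 0%N) | i < n].

Definition wt k : C := \prod_j (if x j == 0 then 1 else x j) ^+ k j.

Lemma wt_neq0 k : wt k != 0.
Proof. by apply/prodf_neq0 => j _; apply: expf_neq0; case: ifP => [|->]; rewrite ?oner_neq0. Qed.

(** Fixing the nonzero coordinates at their values in [x] leaves the directions transversal to the
    orbit. *)
Definition freeze : S -> S :=
  mmap (@mpolyC n C) (fun j => if x j == 0 then 'X_j else (x j)%:MP).

HB.instance Definition _ := GRing.RMorphism.on freeze.

Lemma freezeX k : freeze 'X_[k] = wt k *: 'X_[restr k].
Proof.
rewrite /freeze mmapX /mmap1 [X in _ *: X]mpolyXE_id -mul_mpolyC rmorph_prod -big_split.
apply: eq_bigr => j _; rewrite /= mnmE; case: ifP => xj.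
  by rewrite expr1n mpolyC1 mul1r.
by rewrite expr0 mulr1 rmorphXn.
Qed.

Lemma freezeE g : freeze g = \sum_(k <- msupp g) (g@_k * wt k) *: 'X_[restr k].
Proof.
rewrite {1}[g]mpolyE raddf_sum; apply: eq_bigr => k _.
by rewrite /= {1}/freeze mmapZ -/(freeze _) freezeX mul_mpolyC scalerA.
Qed.

Lemma freeze0 g : (freeze g)@_0 = g.@[x].
Proof.
rewrite freezeE mevalE raddf_sum; apply: eq_bigr => k _ /=.
rewrite mcoeffZ mcoeffX -mulrA; congr (_ * _).
have [E|/eqP E] := eqVneq (restr k) 0%MM.
  rewrite mulr1; apply: eq_bigr => j _; case: eqP => // xj.
  have := congr1 (fun k : 'X_{1..n} => k j) E; rewrite !mnmE (introT eqP xj) => ->.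
  by rewrite !expr0.
rewrite mulr0; have [j kj] : exists j, restr k j != 0%N.
  by apply: contrapT => H; apply: E; apply/mnmP => j; rewrite mnm0E; apply/eqP/negPn/negP => kj; apply: H; exists j.
move: kj; rewrite mnmE; case: ifP => // /eqP xj kj; rewrite (bigD1 j) //= xj.
by rewrite expr0n (negPf kj) mul0r.
Qed.

(** An element of sigma^vee /\ M modulo the orthogonal of sigma, recorded by its values on the rays
    of sigma; natural exponents encode their nonnegativity. *)
Definition lattice_point k : Prop :=
  k = restr k /\ exists m, forall j, x j = 0 -> (k j)%:Z = pairing m (e j).

Definition irreducible_point k : Prop :=
  [/\ lattice_point k, k != 0%MM &
    forall k1 k2, lattice_point k1 -> lattice_point k2 -> k = (k1 + k2)%MM ->
      k1 = 0%MM \/ k2 = 0%MM].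

Lemma restr_id k : restr (restr k) = restr k.
Proof. by apply/mnmP => j; rewrite !mnmE; case: (x j == 0). Qed.

(** A form [h1] of the same class that is nonzero at [x] has a monomial free of the vanishing
    variables; comparing exponents with it identifies those of [g] on the cone with the values of a
    character. *)
Lemma msupp_freeze b g h1 k : inS e b g -> inS e b h1 -> h1.@[x] != 0 ->
  k \in msupp (freeze g) -> lattice_point k.
Proof.
move=> gb h1b h1x k_g.
have [k' k'_g ->] : exists2 k', k' \in msupp g & k = restr k'.
  apply: contrapT => H; move: k_g; rewrite mcoeff_msupp freezeE raddf_sum big_seq big1 ?eqxx //.
  move=> k' k'_g /=; rewrite mcoeffZ mcoeffX; case: eqP => [E|_]; last by rewrite mulr0.
  by case: H; exists k'.
have [k0 k0_h1 k0x] : exists2 k0, k0 \in msupp h1 & nonvanishing x 'X_[k0].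
  apply: contrapT => H; case/eqP: h1x; rewrite mevalE big_seq big1 // => k1 k1_h1.
  rewrite -mevalX; have [->|nz] := eqVneq ('X_[k1]).@[x] 0; first by rewrite mulr0.
  by case: H; exists k1.
split; first by rewrite restr_id.
have [m E] := same_class_trans (gb _ k'_g) (same_class_sym (h1b _ k0_h1)).
exists m => j xj; have /(congr1 (fun v : 'rV[int]_n => v 0 j)) := E.
by rewrite !mxE mnmE xj eqxx => <-; rewrite ((nonvanishingX x k0).1 k0x) // subr0.
Qed.

(** A product of two frozen polynomials without constant term has only decomposable exponents, so an
    irreducible coefficient sees only the constant term of the second factor. *)
Lemma cotangent_coef k : irreducible_point k -> cotangent (fun g => (freeze g)@_k).
Proof.
move=> [_ k0 k_irr]; split=> [g h|b g h1 c h h2 gb h1b h1x gx hc h2c h2x].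
  have -> : freeze (g + h) = freeze g + freeze h by exact: raddfD.
  exact: mcoeffD.
have -> : freeze (g * h) = freeze g * freeze h by exact: rmorphM.
pose h' := freeze h - (h.@[x])%:MP.
have -> : freeze h = h' + (h.@[x])%:MP by rewrite subrK.
rewrite mulrDr mcoeffD [_ * _%:MP]mulrC mcoeffCM [RHS]mulrC.
rewrite [X in X + _](_ : _ = 0) ?add0r //; apply: memN_msupp_eq0; apply/negP.
move=> /msuppM_le /allpairsP[[k1 k2] /= [k1_g k2_h kE]].
have h'0 : h'@_0 = 0 by rewrite mcoeffB freeze0 mcoeffC eqxx mulr1 subrr.
have k2_neq0 : k2 != 0%MM.
  by apply: contraTneq k2_h => ->; rewrite mcoeff_msupp h'0 eqxx.
have k1_neq0 : k1 != 0%MM.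
  by apply: contraTneq k1_g => ->; rewrite mcoeff_msupp freeze0 gx eqxx.
have k2_h0 : k2 \in msupp (freeze h).
  by move: k2_h; rewrite !mcoeff_msupp mcoeffB mcoeffC (negPf k2_neq0) mulr0 subr0.
have := k_irr _ _ (msupp_freeze gb h1b h1x k1_g) (msupp_freeze hc h2c h2x k2_h0) kE.
by case=> /eqP; apply/negP.
Qed.
End CotangentSpace.

(** * Irreducible lattice points of a simplicial cone *)

Section SmoothCone.
Variables (R : realType) (p n : nat) (e : 'I_n -> 'rV[int]_p.+1).
Variable Sigma : {set {set 'I_n}}.
Hypothesis fan : complete_simplicial_fan R e Sigma.
Local Notation C := R[i].
Local Notation S := {mpoly C[n]}.
Variable x : 'I_n -> C.
Local Notation sigma := [set i | x i == 0].
Hypothesis xS : sigma \in Sigma.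
Local Notation lattice_point := (lattice_point e x).
Local Notation irreducible_point := (irreducible_point e x).
Implicit Types (m : 'rV[int]_p.+1) (k : 'X_{1..n}).

Definition zero_rays : seq 'I_n := enum sigma.
Local Notation r := (size zero_rays).

Lemma mem_zero_rays j : (j \in zero_rays) = (x j == 0).
Proof. by rewrite mem_enum inE. Qed.

Definition cone_mx : 'M[int]_(r, p.+1) := \matrix_s e (tnth (in_tuple zero_rays) s).

Lemma tnth_zero_rays s : x (tnth (in_tuple zero_rays) s) = 0.
Proof. by apply/eqP; rewrite -mem_zero_rays; apply: mem_tnth. Qed.

Lemma zero_raysP j : x j = 0 -> exists s, j = tnth (in_tuple zero_rays) s.
Proof. by move/eqP; rewrite -mem_zero_rays => xj; apply/(tnthP (in_tuple zero_rays)). Qed.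

Lemma tnth_zero_rays_inj : injective (tnth (in_tuple zero_rays)).
Proof. by apply/tuple_uniqP; apply: enum_uniq. Qed.

Lemma cone_mx_free (v : 'rV[int]_r) : v *m cone_mx = 0 -> v = 0.
Proof.
move=> v0; case: fan => _ simp _ _ _.
pose c j : R := \sum_(s | tnth (in_tuple zero_rays) s == j) (v 0 s)%:~R.
have cE s : c (tnth (in_tuple zero_rays) s) = (v 0 s)%:~R.
  rewrite /c (big_pred1 s) // => s'; exact: (inj_eq tnth_zero_rays_inj).
have c0 : forall i, c i = 0.
  apply: (simp _ xS) => [i|].
    rewrite inE => xi; apply: big_pred0 => s; apply/negbTE; apply: contra xi => /eqP <-.
    by rewrite tnth_zero_rays.
  apply/rowP => l; have /(congr1 (fun v : 'rV[int]_p.+1 => (v 0 l)%:~R : R)) := v0.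
  rewrite mxE rmorph_sum !mxE => v0l; rewrite /lin_comb summxE -[RHS]v0l.
  rewrite (eq_bigr (fun j => \sum_(s | tnth (in_tuple zero_rays) s == j)
       (v 0 s * cone_mx s l)%:~R)) => [|j _]; last first.
    rewrite !mxE mulr_suml; apply: eq_bigr => s /eqP <-.
    by rewrite mxE intrM.
  by rewrite [RHS](partition_big (tnth (in_tuple zero_rays)) xpredT).
apply/rowP => s; rewrite mxE; have := c0 (tnth (in_tuple zero_rays) s).
by rewrite cE => /eqP; rewrite intr_eq0 => /eqP.
Qed.

(* The Gram matrix of the rays of a simplicial cone is nonsingular. *)
Lemma exists_multiple j : x j = 0 -> exists q : nat, (0 < q)%N /\
  exists m, forall i, x i = 0 -> pairing m (e i) = (q * (i == j))%:Z.
Proof.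
move=> xj; pose G := cone_mx *m cone_mx^T.
have G0 : \det G != 0.
  apply/det0P => -[v v_neq0 vG]; case/eqP: v_neq0; apply: cone_mx_free.
  have : (v *m cone_mx) *m (v *m cone_mx)^T = 0.
    by rewrite trmx_mul mulmxA -[v *m _ *m _]mulmxA vG mul0mx.
  move/(congr1 (fun M : 'M[int]_1 => M 0 0)); rewrite mxE mxE.
  under eq_bigr do rewrite [X in _ * X]mxE.
  move/eqP; rewrite psumr_eq0 => [/allP H|l _]; last by rewrite -expr2 sqr_ge0.
  apply/rowP => l; have := H l (mem_index_enum _).
  by rewrite /= -expr2 sqrf_eq0 [RHS]mxE => /eqP.
have [s Ej] := zero_raysP xj.
(* A column of the adjugate Gram matrix gives coefficients on the rays: the combination pairs to
   [\det G] with the ray [j] and to 0 with the others. The sign is corrected afterwards. *)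
pose m0 := row s (\adj G)^T *m cone_mx.
have m0E i : x i = 0 -> pairing m0 (e i) = \det G *+ (i == j).
  case/zero_raysP => s' ->; rewrite Ej (inj_eq tnth_zero_rays_inj).
  have : G *m \adj G = (\det G)%:M by exact: mul_mx_adj.
  move/(congr1 (fun M : 'M[int]_r => M s' s)); rewrite !mxE => <-.
  rewrite pairingE -mulmxA mxE; apply: eq_bigr => l _.
  rewrite !mxE mulrC; congr (_ * _); apply: eq_bigr => t _.
  by rewrite !mxE mulrC.
have [detG|detG] := ltP 0 (\det G).
  exists `|\det G|%N; split; first by rewrite absz_gt0.
  by exists m0 => i xi; rewrite m0E //; case: (i == j); lia.
exists `|\det G|%N; split; first by rewrite absz_gt0.
by exists (- m0) => i xi; rewrite pairingNl m0E //; case: (i == j); lia.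
Qed.

(** [q] times the dual vector of the ray [j] is integral on the cone; the cone is unimodular when 1
    is such a multiple for each of its rays. *)
Definition is_multiple j (q : nat) : bool := (0 < q)%N &&
  `[< exists m, forall i, x i = 0 -> pairing m (e i) = (q * (i == j))%:Z >].

Lemma exists_min_multiple j : x j = 0 -> exists2 q, is_multiple j q &
  forall q', is_multiple j q' -> (q <= q')%N.
Proof.
move=> xj; have ex : exists q, is_multiple j q.
  by have [q [q0 qP]] := exists_multiple xj; exists q; rewrite /is_multiple q0; apply/asboolP.
by exists (ex_minn ex); case: ex_minnP.
Qed.

Lemma lattice_point_ray j q : x j = 0 ->
  (exists m, forall i, x i = 0 -> pairing m (e i) = (q * (i == j))%:Z) ->
  lattice_point (U_(j) *+ q)%MM.
Proof.
move=> xj [m mE]; split.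
  apply/mnmP => i; rewrite mnmE mulmnE mnm1E; have [//|xi] := eqVneq (x i) 0.
  by have [ji|//] := eqVneq j i; rewrite -ji xj eqxx in xi.
by exists m => i xi; rewrite mE // mulmnE mnm1E eq_sym mulnC.
Qed.

(** Both parts of a decomposition are supported at [j]; if both were nonzero, they would be smaller
    multiples. *)
Lemma irreducible_ray j q : x j = 0 -> is_multiple j q ->
  (forall q', is_multiple j q' -> (q <= q')%N) -> irreducible_point (U_(j) *+ q)%MM.
Proof.
move=> xj /andP[q0 /asboolP qP] q_min; split; first exact: lattice_point_ray.
  apply/eqP => /mnmP/(_ j); rewrite mulmnE mnm1E eqxx mul1n mnm0E.
  by move=> qE; rewrite qE in q0.
move=> k1 k2 [E1 [m1 m1E]] [E2 [m2 m2E]] kE.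
have k_neqj i : i != j -> (k1 i = 0 /\ k2 i = 0)%N.
  move=> /negPf ij; have /mnmP/(_ i) := kE.
  by rewrite mnmDE mulmnE mnm1E eq_sym ij mul0n => /esym/eqP; rewrite addn_eq0 => /andP[/eqP-> /eqP->].
have [k1j|k1j] := posnP (k1 j).
  left; apply/mnmP => i; rewrite mnm0E; have [->//|/k_neqj[-> //]] := eqVneq i j.
right; apply/mnmP => i; rewrite mnm0E; have [->|/k_neqj[_ -> //]] := eqVneq i j.
have : (q <= k1 j)%N.
  apply: q_min; rewrite /is_multiple k1j /=; apply/asboolP; exists m1 => l xl.
  rewrite -m1E //; have [->|/k_neqj[-> _]] := eqVneq l j; first by rewrite muln1.
  by rewrite muln0.
have /mnmP/(_ j) := kE; rewrite mnmDE mulmnE mnm1E eqxx mul1n; lia.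
Qed.

(** Among the lattice points whose value at [i] is not divisible by [q], one of least degree is
    irreducible: in a decomposition one part keeps the property, hence the whole degree. *)
Lemma exists_irreducible i (q : nat) : x i = 0 -> (1 < q)%N ->
  exists2 k, irreducible_point k & ~~ (q %| k i)%N.
Proof.
move=> xi q1.
pose bad N := `[< exists2 k, lattice_point k & ~~ (q %| k i)%N && (mdeg k == N) >].
have ex : exists N, bad N.
  have [B _ B_dual] := primitive_dual_basis (@fan_primitive _ _ _ _ _ fan i).
  pose m1 := row 0 B.
  have m1i : pairing m1 (e i) = 1 by rewrite B_dual eqxx.
  have /choice[M ME] : forall j, exists m, x j = 0 -> exists qj : nat, (0 < qj)%N /\
      forall l, x l = 0 -> pairing m (e l) = (qj * (l == j))%:Z.
    move=> j; have [xj|xj] := eqVneq (x j) 0; last by exists 0 => /eqP; rewrite (negPf xj).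
    by have [qj [qj0 [m mE]]] := exists_multiple xj; exists m => _; exists qj.
  (* Adding multiples of [q] preserves the value 1 on [e i] modulo [q], and these are large enough
     to make all values on the cone nonnegative. *)
  pose m2 := m1 + \sum_(j | x j == 0) ((q * `|pairing m1 (e j)|)%N%:Z *: M j).
  have m2E j : x j = 0 -> exists2 t : nat, (0 < t)%N &
      pairing m2 (e j) = pairing m1 (e j) + (q * `|pairing m1 (e j)| * t)%N%:Z.
    move=> xj; have [t [t0 tP]] := ME j xj; exists t => //.
    rewrite /m2 pairingDl pairing_suml (bigD1 j) ?xj ?eqxx //= big1 ?addr0 => [|l /andP[/eqP xl lj]].
      by rewrite pairingZl tP // eqxx muln1 PoszM.
    have [tl [_ tlP]] := ME l xl.
    by rewrite pairingZl tlP // eq_sym (negPf lj) muln0 mulr0.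
  have m2_ge0 j : x j = 0 -> 0 <= pairing m2 (e j).
    move=> /m2E[t t0 ->]; move: (pairing m1 (e j)) => a.
    have : (`|a| <= q * `|a| * t)%N by rewrite mulnAC leq_pmull // muln_gt0 t0 (ltn_trans _ q1).
    lia.
  pose k : 'X_{1..n} := [multinom (if x j == 0%R then `|pairing m2 (e j)|%N else 0%N) | j < n].
  exists (mdeg k); apply/asboolP; exists k; rewrite ?eqxx ?andbT.
    split; first by apply/mnmP => j; rewrite !mnmE; case: (x j == 0).
    by exists m2 => j xj; rewrite mnmE xj eqxx gez0_abs // m2_ge0.
  rewrite mnmE xi eqxx; have [t t0 ->] := m2E i xi; rewrite m1i.
  rewrite (_ : `|_|%N = (q * t).+1); last by rewrite absz1 muln1; lia.
  by rewrite -addn1 dvdn_addr ?dvdn_mulr // dvdn1 neq_ltn q1 orbT.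
case: (ex_minnP ex) => N /asboolP[k kL /andP[ki /eqP kN]] N_min; exists k => //.
split=> // [|k1 k2 k1L k2L kE].
  by apply: contraNneq ki => ->; rewrite mnm0E dvdn0.
have degE : (mdeg k1 + mdeg k2 = N)%N by rewrite -mdegD -kE.
have [k1i|k1i] := boolP (q %| k1 i)%N; last first.
  right; apply/eqP; rewrite -mdeg_eq0.
  have : (N <= mdeg k1)%N by apply: N_min; apply/asboolP; exists k1; rewrite ?k1i ?eqxx.
  lia.
left; apply/eqP; rewrite -mdeg_eq0.
have k2i : ~~ (q %| k2 i)%N by apply: contra ki => k2i; rewrite kE mnmDE dvdn_add.
have : (N <= mdeg k2)%N by apply: N_min; apply/asboolP; exists k2; rewrite ?k2i ?eqxx.
lia.
Qed.

End SmoothCone.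

Section CotangentValues.
Variables (R : realType) (p n : nat) (e : 'I_n -> 'rV[int]_p.+1).
Local Notation C := R[i].
Local Notation S := {mpoly C[n]}.
Local Notation tmon := (tmon R e).
Variable x : 'I_n -> C.
Local Notation lattice_point := (lattice_point e x).
Implicit Types (m : 'rV[int]_p.+1) (k : 'X_{1..n}).

Definition coef k (g : S) : C := (freeze x g)@_k.

Lemma coefX k k' : coef k 'X_[k'] = if k == restr x k' then wt x k' else 0.
Proof.
rewrite /coef freezeX mcoeffZ mcoeffX eq_sym; case: eqP; by rewrite ?mulr1 ?mulr0.
Qed.

Lemma coefZB k (a : C) (g h : S) : coef k (g - a *: h) = coef k g - a * coef k h.
Proof.
rewrite /coef -mul_mpolyC; have -> : freeze x (g - a%:MP * h) = freeze x g - a%:MP * freeze x h.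
  have E : freeze x a%:MP = a%:MP by rewrite /freeze mmapC.
  rewrite -[in RHS]E; transitivity (freeze x g - freeze x (a%:MP * h)); first exact: raddfB.
  by congr (_ - _); exact: rmorphM.
by rewrite mcoeffB mcoeffCM.
Qed.

Section Points.
Variables (k : 'X_{1..n}) (m : 'rV[int]_p.+1).
Hypotheses (kL : lattice_point k) (k_neq0 : k != 0%MM).
Hypothesis kE : forall j, x j = 0 -> (k j)%:Z = pairing m (e j).

Lemma restr_mpos : restr x (mpos e m) = k.
Proof.
case: kL => -> _; apply/mnmP => j; rewrite !mnmE; case: eqP => // xj.
by rewrite -kE //; lia.
Qed.

Lemma effective_point : effective e x m.
Proof. by move=> j /kE <-. Qed.

Lemma mpos_meval0 : ('X_[mpos e m]).@[x] = 0 :> C.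
Proof.
apply/eqP/negPn/negP => /nonvanishingX E; case/eqP: k_neq0.
case: kL => -> _; apply/mnmP => j; rewrite mnmE mnm0E; case: eqP => // xj.
by have := E j xj; rewrite mnmE -kE //; lia.
Qed.

Definition point_value : C := wt x (mpos e m) / ('X_[mpos e (- m)]).@[x].

Lemma point_value_neq0 : point_value != 0.
Proof.
rewrite mulf_neq0 ?wt_neq0 // invr_eq0.
exact: ((effectiveP e x m).1 effective_point).
Qed.

Lemma cotangent_value_point f :
  cotangent_value e x f (tmon m) (f 'X_[mpos e m] / ('X_[mpos e (- m)]).@[x]).
Proof.
exists (expo (mpos e (- m))), 'X_[mpos e m], 'X_[mpos e (- m)]; split.
- by apply: (@inS_class _ _ _ _ (expo (mpos e m))); [exists m; exact: expo_mpos | exact: inSX].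
- exact: inSX.
- exact: ((effectiveP e x m).1 effective_point).
- exact: mpos_meval0.
- by split; first exact: tmonE.
Qed.

Lemma coef_point k' : cotangent_value e x (coef k') (tmon m) (if k' == k then point_value else 0).
Proof.
have := cotangent_value_point (coef k'); rewrite coefX restr_mpos.
by case: ifP => // _; rewrite mul0r.
Qed.

Lemma torus_deriv_point c : cotangent_value e x (torus_deriv x c) (tmon m) 0.
Proof.
have := cotangent_value_point (torus_deriv x c).
by rewrite torus_derivX mpos_meval0 mulr0 mul0r.
Qed.
End Points.

Section Orthogonal.
(** A character orthogonal to the cone is a unit at [x]; minus its value it gives a cotangent vector
    along the orbit, invisible to the coefficients of nonzero exponents. *)
Variable m : 'rV[int]_p.+1.
Hypothesis m_orth : forall j, x j = 0 -> pairing m (e j) = 0.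

Lemma orth_nonvanishing m' : m' = m \/ m' = - m -> ('X_[mpos e m']).@[x] != 0 :> C.
Proof.
move=> mE; apply/nonvanishingX => j xj; rewrite mnmE.
by case: mE => ->; rewrite ?pairingNl m_orth.
Qed.

Lemma restr_orth m' : m' = m \/ m' = - m -> restr x (mpos e m') = 0%MM.
Proof.
move=> mE; apply/mnmP => j; rewrite mnmE mnm0E; case: eqP => // xj.
by rewrite mnmE; case: mE => ->; rewrite ?pairingNl m_orth.
Qed.

Lemma tmon_at_neq0 : tmon_at e x m != 0.
Proof. by rewrite mulf_neq0 ?invr_eq0 ?orth_nonvanishing //; [left|right]. Qed.

Lemma cotangent_value_orth f :
  cotangent_value e x f (tmon m - (tmon_at e x m)%:MP%:F)
   (f ('X_[mpos e m] - tmon_at e x m *: 'X_[mpos e (- m)]) / ('X_[mpos e (- m)]).@[x]).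
Proof.
have nz : ('X_[mpos e (- m)]).@[x] != 0 :> C by apply: orth_nonvanishing; right.
exists (expo (mpos e (- m))), ('X_[mpos e m] - tmon_at e x m *: 'X_[mpos e (- m)]), 'X_[mpos e (- m)].
split=> //.
- apply: inSD; last by apply/inSN/inSZ/inSX.
  by apply: (@inS_class _ _ _ _ (expo (mpos e m))); [exists m; exact: expo_mpos | exact: inSX].
- exact: inSX.
- by rewrite mevalB mevalZ divfK // subrr.
- split=> //; rewrite tmonE tofracB -mul_mpolyC tofracM mulrBl mulfK // tofrac_eq0.
  exact: mpolyX_neq0.
Qed.

Lemma coef_orth k : k != 0%MM ->
  cotangent_value e x (coef k) (tmon m - (tmon_at e x m)%:MP%:F) 0.
Proof.
move=> /negPf k0; have := cotangent_value_orth (coef k).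
rewrite coefZB !coefX !restr_orth; [|by right|by left].
by rewrite k0 mulr0 subr0 mul0r.
Qed.

Lemma torus_deriv_orth (c : 'I_n -> C) :
  cotangent_value e x (torus_deriv x c) (tmon m - (tmon_at e x m)%:MP%:F)
    (tmon_at e x m * \sum_j c j * (pairing m (e j))%:~R).
Proof.
have := cotangent_value_orth (torus_deriv x c).
have [fD _] := cotangent_torus_deriv e x c.
rewrite -scaleNr fD torus_derivZ !torus_derivX.
set A := \sum_j c j * (mpos e m j)%:R; set A' := \sum_j c j * (mpos e (- m) j)%:R.
have -> : \sum_j c j * (pairing m (e j))%:~R = A - A'.
  rewrite -sumrB; apply: eq_bigr => j _; rewrite -mpos_sub rmorphB /= -!pmulrn.
  by rewrite mulrBr.
have {fD} := orth_nonvanishing (or_intror (erefl (- m))); rewrite /tmon_at.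
clearbody A A'; move: ('X_[mpos e m]).@[x] ('X_[mpos e (- m)]).@[x] => N D D0.
have -> // : (A * N + - (N / D) * (A' * D)) / D = N / D * (A - A').
rewrite mulrBr mulrDl; congr (_ + _); first by rewrite [RHS]mulrC mulrA.
by rewrite !mulNr -[N / D * _ / _]mulrA mulfK.
Qed.
End Orthogonal.
End CotangentValues.

(** * Cones of smooth points are unimodular *)

Section UnimodularCone.
Variables (R : realType) (p n : nat) (e : 'I_n -> 'rV[int]_p.+1).
Variable Sigma : {set {set 'I_n}}.
Hypothesis fan : complete_simplicial_fan R e Sigma.
Local Notation C := R[i].
Local Notation S := {mpoly C[n]}.
Local Notation tmon := (tmon R e).
Variable x : 'I_n -> C.
Local Notation sigma := [set i | x i == 0].
Hypothesis xS : sigma \in Sigma.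
Hypothesis smooth : smooth_at e x.
Local Notation lattice_point := (lattice_point e x).
Local Notation irreducible_point := (irreducible_point e x).
Implicit Types (m : 'rV[int]_p.+1) (k : 'X_{1..n}).
Local Notation r := (size (zero_rays x)).
Local Notation ray s := (tnth (in_tuple (zero_rays x)) s).

(* A basis of N adapted to the linear span of the cone, and its dual basis. *)
Lemma adapted_basis : exists Q : 'M[int]_p.+1, exists N : 'M[int]_p.+1,
  (forall l l', pairing (row l N) (row l' Q) = (l == l')%:R) /\
  forall l : 'I_p.+1, (r <= l)%N -> forall j, x j = 0 -> pairing (row l N) (e j) = 0.
Proof.
have [U _ [Q Q_unit [s _ E]]] := int_Smith_normal_form (cone_mx e x).
exists Q, (invmx Q)^T; split=> [l l'|l rl j xj].
  rewrite pairing_rowE -[_ *m _]trmxK mxE trmx_mul !trmxK -row_mul mulmxV // !mxE.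
  by rewrite eq_sym.
have [t ->] := zero_raysP xj.
have -> : e (ray t) = row t (cone_mx e x) by rewrite rowK.
rewrite pairing_rowE -[_ *m _]trmxK mxE trmx_mul !trmxK -row_mul E mulmxK // mxE mxE.
rewrite big1 // => u _; rewrite mxE (_ : (u : nat) == l = false) ?mulr0 //.
by apply/negbTE; rewrite neq_ltn (leq_trans (ltn_ord u)).
Qed.

(** Completeness makes [v] a combination of rays, so that derivatives along the big torus realize
    every direction of N. *)
Lemma real_combination (v : 'rV[int]_p.+1) : exists c : 'I_n -> C,
  forall m, \sum_j c j * (pairing m (e j))%:~R = (pairing m v)%:~R.
Proof.
case: fan => _ _ _ _ [_ /(_ (map_mx intr v))] [s _ [c [_ _ cE]]].
exists (fun j => (c j)%:C%C) => m.
have E : \sum_j c j * (pairing m (e j))%:~R = (pairing m v)%:~R.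
  rewrite [in RHS]/pairing rmorph_sum /=.
  transitivity (\sum_l (m 0 l)%:~R * (lin_comb e c) 0 l); last first.
    by apply: eq_bigr => l _; rewrite -cE mxE intrM.
  under [RHS]eq_bigr do rewrite summxE mulr_sumr.
  rewrite exchange_big; apply: eq_bigr => j _; rewrite rmorph_sum mulr_sumr.
  by apply: eq_bigr => l _; rewrite !mxE /= intrM mulrCA.
rewrite -(rmorph_int (real_complex R)) -E rmorph_sum; apply: eq_bigr => j _.
by rewrite rmorphM /= rmorph_int.
Qed.

Lemma exists_lattice_lift : exists M : 'X_{1..n} -> 'rV[int]_p.+1,
  forall k, lattice_point k -> forall j, x j = 0 -> (k j)%:Z = pairing (M k) (e j).
Proof.
suff /choice[M MP] : forall k, exists m, lattice_point k ->
    forall j, x j = 0 -> (k j)%:Z = pairing m (e j) by exists M.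
move=> k; have [[kE [m mE]]|kL] := pselect (lattice_point k); first by exists m.
by exists 0 => /kL.
Qed.

(* Otherwise the rays of the semigroup and one further irreducible element
   would give too many independent cotangent vectors. *)
Lemma min_multiple1 i q : x i = 0 -> is_multiple e x i q ->
  (forall q', is_multiple e x i q' -> (q <= q')%N) -> q = 1%N.
Proof.
move=> xi q_mul q_min; apply/eqP; rewrite eqn_leq; apply/andP; split; last by case/andP: q_mul.
rewrite leqNgt; apply/negP => q1.
have [k0 k0_irr k0i] := exists_irreducible fan xS xi q1.
have /choice[qq qqP] : forall j, exists q, x j = 0 -> is_multiple e x j q /\
    forall q', is_multiple e x j q' -> (q <= q')%N.
  move=> j; have [xj|xj] := eqVneq (x j) 0; last by exists 0%N => /eqP; rewrite (negPf xj).
  by have [q' q'P q'_min] := exists_min_multiple fan xS xj; exists q'.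
have qqi : qq i = q.
  have [ai bi] := qqP i xi; apply/eqP; rewrite eqn_leq; apply/andP; split; [exact: bi|exact: q_min].
pose a j : 'X_{1..n} := (U_(j) *+ qq j)%MM.
have a_irr j : x j = 0 -> irreducible_point (a j).
  by move=> xj; have [q1P q2P] := qqP j xj; exact: (irreducible_ray xS xj q1P q2P).
have aE j l : a j l = (if j == l then qq j else 0)%N.
  by rewrite /a mulmnE mnm1E; case: (j == l); rewrite ?mul1n.
(* The entry of [a j] at [i] is 0 or [q], and that of [k0] is not divisible by [q]. *)
have k0a j : x j = 0 -> k0 != a j.
  move=> xj; apply: contraNneq k0i => ->; rewrite aE; case: eqP => [->|_]; last by rewrite dvdn0.
  by rewrite qqi.
have [M MP] := exists_lattice_lift.
have [Q [N [NQ N_orth]]] := adapted_basis.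
have /choice[c cE] : forall l, exists c : 'I_n -> C,
    forall m, \sum_j c j * (pairing m (e j))%:~R = (pairing m (row l Q))%:~R.
  by move=> l; apply: real_combination.
pose zr l := nth i (zero_rays x) l.
have zr0 l : (l < r)%N -> x (zr l) = 0.
  by move=> lr; apply/eqP; rewrite -mem_zero_rays mem_nth.
(* The index type has [p.+2] elements: the first [r] stand for the rays, [None] for the extra
   irreducible element, and the others, sent to [None] by [kk], for characters orthogonal to the
   cone. *)
pose kk (t : option 'I_p.+1) : option 'X_{1..n} :=
  if t is Some l then if (l < r)%N then Some (a (zr l)) else None else Some k0.
pose ll (t : option 'I_p.+1) : 'I_p.+1 := odflt ord0 t.
have kk_irr t k : kk t = Some k -> irreducible_point k.
  case: t => [l|] /=; last by case=> <-.
  by case: ifP => // lr [<-]; apply/a_irr/zr0.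
have kk_none t : kk t = None -> (r <= ll t)%N.
  by case: t => [l|//] /=; case: ltnP.
have kk_inj t t' k : kk t = Some k -> kk t' = Some k -> t = t'.
  case: t t' => [l|] [l'|] //=.
  - case: ifP => // lr [<-]; case: ifP => // l'r /Some_inj all'.
    have : a (zr l') (zr l) != 0%N.
      by rewrite all' aE eqxx; have [/andP[]] := qqP _ (zr0 _ lr); rewrite lt0n.
    have [/eqP|/negPf zz] := eqVneq (zr l') (zr l); last by rewrite aE zz.
    by rewrite nth_uniq ?enum_uniq // => /eqP ll' _; congr Some; apply/esym/val_inj.
  - by case: ifP => // lr [<-] [k0E]; have := k0a _ (zr0 _ lr); rewrite k0E eqxx.
  - by move=> [<-]; case: ifP => // lr [k0E]; have := k0a _ (zr0 _ lr); rewrite k0E eqxx.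
have ll_inj t t' : kk t = None -> kk t' = None -> ll t = ll t' -> t = t'.
  by case: t t' => [l|] [l'|] //= _ _ ->.
pose f t := if kk t is Some k then coef x k else torus_deriv x (c (ll t)).
pose s t := if kk t is Some k then tmon (M k) else
  tmon (row (ll t) N) - (tmon_at e x (row (ll t) N))%:MP%:F.
pose v t := if kk t is Some k then point_value e x (M k) else tmon_at e x (row (ll t) N).
have lattice t k : kk t = Some k -> [/\ lattice_point k, k != 0%MM &
    forall j, x j = 0 -> (k j)%:Z = pairing (M k) (e j)].
  by move=> /kk_irr[kL k_neq0 _]; split=> // j; apply: MP.
have fsv t t' : cotangent_value e x (f t) (s t') (if t == t' then v t else 0).
  rewrite /f /s /v; case E: (kk t) => [k|]; case E': (kk t') => [k'|].
  - have [k'L k'0 k'E] := lattice _ _ E'.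
    have := coef_point k'L k'0 k'E k.
    have [kk'|kk'] := eqVneq k k'.
      by rewrite (kk_inj t t' k) ?eqxx -?kk' // E' kk'.
    by case: eqP => // tt'; case/eqP: kk'; apply: Some_inj; rewrite -E -E' tt'.
  - have [kL k_neq0 _] := lattice _ _ E.
    rewrite (_ : t == t' = false); last by apply/eqP => tt'; rewrite tt' E' in E.
    by apply: coef_orth k_neq0; apply: N_orth; apply: kk_none.
  - have [k'L k'0 k'E] := lattice _ _ E'.
    rewrite (_ : t == t' = false); last by apply/eqP => tt'; rewrite tt' E' in E.
    exact: (torus_deriv_point k'L k'0 k'E).
  have := torus_deriv_orth (N_orth _ (kk_none _ E')) (c (ll t)).
  rewrite cE NQ; have [tt'|tt'] := eqVneq t t'; first by rewrite tt' eqxx mulr1.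
  by case: eqP => [/ll_inj|_]; [move=> /(_ E' E) tt''; rewrite tt'' eqxx in tt' | rewrite mulr0].
suff : (#|{: option 'I_p.+1}| <= p.+1)%N by rewrite card_option card_ord ltnn.
apply: (smooth_at_cotangent smooth (f := f) (s := s) (v := v)) => // t.
- rewrite /f; case E: (kk t) => [k|]; last exact: cotangent_torus_deriv.
  exact: cotangent_coef (kk_irr _ _ E).
- by have [b [g [h [gb hb hx gx [E _]]]]] := fsv t t; exists b, g, h.
- rewrite /v; case E: (kk t) => [k|].
    by have [kL k_neq0 kE] := lattice _ _ E; apply: point_value_neq0 kE.
  by apply: tmon_at_neq0; apply: N_orth; apply: kk_none.
Qed.

(** With all least multiples equal to 1, the rays have integral dual vectors [D], completed by
    characters orthogonal to the cone. A nonzero determinant is what [Phi_tmon] asks of [B]. *)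
Lemma smooth_unimodular : exists B : 'M[int]_p.+1, \det B != 0 /\
  exists pos : 'I_n -> 'I_p.+1, forall j, x j = 0 ->
    forall l, pairing (row l B) (e j) = (l == pos j)%:R.
Proof.
have /choice[D DP] : forall i, exists m, x i = 0 ->
    forall j, x j = 0 -> pairing m (e j) = (j == i)%:R.
  move=> i; have [xi|xi] := eqVneq (x i) 0; last by exists 0 => /eqP; rewrite (negPf xi).
  have [q q_mul q_min] := exists_min_multiple fan xS xi.
  have /andP[_ /asboolP[m mE]] := q_mul; exists m => _ j xj.
  by rewrite mE // (min_multiple1 xi q_mul q_min) mul1n; case: (j == i).
have [Q [N [NQ N_orth]]] := adapted_basis.
have r_le : (r <= p.+1)%N.
  pose X : 'M[int]_(p.+1, r) := (\matrix_s D (ray s))^T.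
  apply: (mulmx1_min (A := cone_mx e x) (B := X)); apply/matrixP => s t.
  have := DP (ray t) (tnth_zero_rays t) _ (tnth_zero_rays s).
  rewrite (inj_eq (@tnth_zero_rays_inj _ _ x)) !mxE => <-.
  by rewrite /pairing; apply: eq_bigr => l _; rewrite !mxE mulrC.
pose ind j := index j (zero_rays x).
have ind_lt j : x j = 0 -> (ind j < r)%N by move/eqP; rewrite -mem_zero_rays index_mem.
(* [ohead (drop l _)] is the l-th ray if there is one, without a default ray. *)
pose B : 'M[int]_p.+1 := \matrix_l (if ohead (drop l (zero_rays x)) is Some j then D j else row l N).
have BE l j : x j = 0 -> pairing (row l B) (e j) = ((l : nat) == ind j)%:R.
  move=> xj; rewrite rowK; have [lr|lr] := ltnP l r.
    have xl : x (nth j (zero_rays x) l) = 0 by apply/eqP; rewrite -mem_zero_rays mem_nth.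
    rewrite (drop_nth j lr) /= DP //.
    congr (_%:R); congr nat_of_bool; apply/eqP/eqP => [->|->].
      by rewrite /ind index_uniq ?enum_uniq.
    by rewrite nth_index // mem_zero_rays xj.
  rewrite drop_oversize //= N_orth // (gtn_eqF (leq_trans (ind_lt _ xj) lr)) //.
exists B; split; last first.
  exists (fun j => inord (ind j)) => j xj l; rewrite BE //.
  by rewrite -(inj_eq val_inj) /= inordK // (leq_trans (ind_lt _ xj)).
(* Pairing a relation between the rows with the rays kills its first [r] coefficients; pairing it
   with the rows of [Q] then kills the others. *)
apply/det0P => -[v v_neq0 vB]; case/eqP: v_neq0.
have pE w : \sum_l v 0 l * pairing (row l B) w = 0.
  have := congr1 (fun u : 'rV[int]_p.+1 => pairing u w) vB; rewrite pairing0l => vB0.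
  by rewrite -[RHS]vB0 mulmx_sum_row pairing_suml; apply: eq_bigr => l _; rewrite pairingZl.
have v0 (l : 'I_p.+1) : (l < r)%N -> v 0 l = 0.
  move=> lr; pose s := Ordinal lr; have xj := tnth_zero_rays s.
  have := pE (e (ray s)); rewrite (bigD1 l) //= big1 ?addr0 => [|l' ll'].
    by rewrite BE // /ind (tnth_nth (ray s)) index_uniq ?enum_uniq // eqxx mulr1.
  rewrite BE // /ind (tnth_nth (ray s)) index_uniq ?enum_uniq //=.
  by rewrite (inj_eq val_inj) (negPf ll') mulr0.
apply/rowP => l; rewrite mxE; have [/v0//|rl] := ltnP l r.
have := pE (row l Q); rewrite (bigD1 l) //= big1 ?addr0 => [|l' ll'].
  by rewrite rowK drop_oversize //= NQ eqxx mulr1.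
have [/v0->|rl'] := ltnP l' r; first by rewrite mul0r.
by rewrite rowK drop_oversize //= NQ (negPf ll') mulr0.
Qed.
End UnimodularCone.

(** * Global sections *)

Lemma regroup (K : comNzRingType) (u f a X c t : K) :
  u * f * (a * X) * (c * t) = c * a * (u * f * (X * t)).
Proof. by ring. Qed.

Lemma regroup2 (K : comNzRingType) (u f X t : K) : u * f * (X * t) = u * (X * f) * t.
Proof. by ring. Qed.

Section AdmissibleVectors.
Variables (R : realType) (p n : nat) (e : 'I_n -> 'rV[int]_p.+1).
Variable Sigma : {set {set 'I_n}}.
Hypothesis fan : complete_simplicial_fan R e Sigma.
Local Notation C := R[i].
Local Notation S := {mpoly C[n]}.
Local Notation L := {fraction S}.
Local Notation ray i := (map_mx intr (e i) : 'rV[L]_p.+1).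
Local Notation Phi := (Phi (R := R) e).
Local Notation tmon := (tmon R e).
Implicit Types (m : 'rV[int]_p.+1) (k : 'X_{1..n}) (W : 'rV[L]_p.+1) (b : 'rV[int]_n).

Definition admissible_exponent k i : Prop :=
  forall l, k l = 0%N -> e l = e i \/ e l = - e i.

(** An inductive form of the sums of terms c z^a e_i, so that each claim is checked on a single
    term. *)
Inductive admissible b : 'rV[L]_p.+1 -> Prop :=
| admissible0 : admissible b 0
| admissible_cons a k i W : same_class e (expo k) b -> admissible_exponent k i ->
    admissible b W -> admissible b ((a *: 'X_[k])%:F *: ray i + W).

Lemma admissible1 b (a : C) k i : same_class e (expo k) b -> admissible_exponent k i ->
  admissible b ((a *: 'X_[k])%:F *: ray i).
Proof.
by move=> kb ki; rewrite -[X in admissible _ X]addr0; apply: admissible_cons => //; apply: admissible0.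
Qed.

Lemma admissibleD b W W' : admissible b W -> admissible b W' -> admissible b (W + W').
Proof.
move=> WP W'P; elim: WP => [|a k i W0 kb ki _ IH]; first by rewrite add0r.
by rewrite -addrA; apply: admissible_cons.
Qed.

Lemma admissible_sum b (I : Type) (s : seq I) (P : pred I) (F : I -> 'rV[L]_p.+1) :
  (forall i, P i -> admissible b (F i)) -> admissible b (\sum_(i <- s | P i) F i).
Proof. by move=> FP; elim/big_ind: _ => //; [exact: admissible0 | exact: admissibleD]. Qed.

(** The identity g h1 = h g1 with homogeneous [g1], [h1] persists between the components of [g] and
    [h] of one class, chosen so that the component of [h] is nonzero at [x]. *)
Lemma rat_local_ring (x : 'I_n -> C) (g h : S) : rat_fun e (g%:F / h%:F) -> h.@[x] != 0 ->
  local_ring e x (g%:F / h%:F).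
Proof.
move=> [c [g1 [h1 [g1c h1c h1_neq0 E]]]] hx.
have h_neq0 : h != 0 := nonvanishing_neq0 hx.
have [b hbx] := part_meval_neq0 e hx.
have gh : g * h1 = h * g1.
  apply/eqP; rewrite [h * g1]mulrC -(frac_div_eq g g1 h_neq0 h1_neq0); exact/eqP.
exists b, (part e b g), (part e b h); split; rewrite //; try exact: part_inS.
have /(congr1 (part e (b + c))) := gh; rewrite (partMr _ _ h1c) (partMr _ _ g1c) => gh1.
rewrite E; apply/eqP; rewrite (frac_div_eq g1 _ h1_neq0 (nonvanishing_neq0 hbx)).
by rewrite mulrC gh1.
Qed.

Let nonzero (h : S) : Prop := h != 0.
Let nonzero1 : nonzero 1. Proof. exact: oner_neq0. Qed.
Let nonzeroM g h : nonzero g -> nonzero h -> nonzero (g * h).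
Proof. exact: mulf_neq0. Qed.

Lemma rat_funM (r s : L) : rat_fun e r -> rat_fun e s -> rat_fun e (r * s).
Proof. exact: (deg0_fracM nonzeroM). Qed.

Lemma rat_fun_const (a : C) : rat_fun e (a%:MP%:F).
Proof. exact: (deg0_frac_const _ nonzero1). Qed.

Lemma rat_fun_int (a : int) : rat_fun e (a%:~R : L).
Proof. exact: (deg0_frac_int _ nonzero1). Qed.

Lemma rat_fun_tmon m : rat_fun e (tmon m).
Proof. by apply: (deg0_tmon (Q := nonzero)); apply: mpolyX_neq0. Qed.

Lemma intV (a : int) : (a%:~R : L)^-1 = ((a%:~R^-1)%:MP)%:F.
Proof.
have [->|a0] := eqVneq a 0; first by rewrite mulr0z invr0 invr0 mpolyC0 tofrac0.
apply: (mulIf (_ : (a%:~R : L) != 0)); rewrite ?intrL_eq0 //.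
by rewrite mulVf ?intrL_eq0 // intr_const -tofracM -mpolyCM mulVf ?intr_eq0 // mpolyC1 tofrac1.
Qed.

Variables (b : 'rV[int]_n) (f : S).
Hypotheses (f_inS : inS e b f) (f_neq0 : f != 0).

Lemma rat_fun_div (g : S) : inS e b g -> rat_fun e (g%:F / f%:F).
Proof. by move=> gb; exists b, g, f. Qed.

Lemma Phi_tmon_scaled (B : 'M[int]_p.+1) (c : L) i : \det B != 0 ->
  c *: Phi (ray i) = \sum_(l < p.+1)
    (c * ((\det B)%:~R^-1 * ((-1) ^+ l * pairing (row l B) (e i))%:~R
       * tmon (- \sum_s row s (row' l B))))
    *: dwedge (fun s => tmon (row s (row' l B))).
Proof.
move=> B0; rewrite (@Phi_tmon R p n e B (e i) B0) scaler_sumr; apply: eq_bigr => l _.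
by rewrite scalerA tmonN.
Qed.

Lemma rational_generator (a : C) k i : same_class e (expo k) b ->
  rational_form e ((f%:F)^-1 *: Phi ((a *: 'X_[k])%:F *: ray i)).
Proof.
move=> kb; rewrite PhiZ scalerA (@Phi_tmon_scaled 1%:M) ?det1 //.
apply: span_forms_sum => l _; apply: span_dwedge => [|s]; last exact: rat_fun_tmon.
apply: rat_funM; last first.
  apply: rat_funM; last exact: rat_fun_tmon.
  by apply: rat_funM; [rewrite intV; exact: rat_fun_const | exact: rat_fun_int].
rewrite mulrC; apply: rat_fun_div; apply: inSZ; apply: (inS_class kb); exact: inSX.
Qed.

Lemma tmon_mulX k m : 'X_[k]%:F * tmon (- m) =
  'X_[((k - mpos e m) + mpos e (- m))%MM]%:F / 'X_[(mpos e m - k)%MM]%:F.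
Proof.
rewrite tmonE opprK mulrA -tofracM -mpolyXD; apply/eqP.
rewrite frac_div_eq ?mpolyX_neq0 // -!mpolyXD; apply/eqP; congr 'X_[_].
by apply/mnmP => l; rewrite !mnmDE !mnmBE; lia.
Qed.

(** In the basis [B] the l-th term has poles only from t^(-M), simple along z_j = 0 when [pos j]
    differs from [l]. If z^k does not cancel such a pole, then k_j = 0 and e_j is e_i or its
    opposite, so the l-th row pairs to zero with e_i and the term is absent. *)
Lemma regular_generator (x : 'I_n -> C) (u : L) (a : C) k i :
  inU Sigma x -> smooth_at e x -> local_equation_at e f x u ->
  same_class e (expo k) b -> admissible_exponent k i ->
  regular_at e x (u *: ((f%:F)^-1 *: Phi ((a *: 'X_[k])%:F *: ray i))).
Proof.
move=> /(inU_zeros fan) xS x_smooth [u_rat [g [h [gx hx uE]]]] kb ki.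
have [B [B0 [pos BP]]] := smooth_unimodular fan xS x_smooth.
rewrite PhiZ !scalerA (@Phi_tmon_scaled B) //.
apply: span_forms_sum => l _; apply: span_dwedge => [|s]; last first.
  apply: local_tmon => j xj; rewrite (_ : row s _ = row (lift l s) B).
    by rewrite BP // ler0n.
  by apply/rowP => j'; rewrite !mxE.
set M := \sum_s _.
have [Bl|Bl] := eqVneq (pairing (row l B) (e i)) 0.
  rewrite Bl mulr0 mulr0z mulr0 mul0r mulr0 -tofrac0 -mpolyC0.
  exact: local_const.
pose c : L := (\det B)%:~R^-1 * ((-1) ^+ l * pairing (row l B) (e i))%:~R * a%:MP%:F.
pose v : L := u / f%:F * ('X_[k]%:F * tmon (- M)).
have -> : u / f%:F * (a *: 'X_[k])%:F * ((\det B)%:~R^-1 *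
    ((-1) ^+ l * pairing (row l B) (e i))%:~R * tmon (- M)) = c * v.
  by rewrite -mul_mpolyC tofracM /c /v regroup.
apply: localM; first last.
  have fF : f%:F != 0 :> L by rewrite tofrac_eq0.
  have v_rat : rat_fun e v.
    rewrite /v regroup2; apply: rat_funM; last exact: rat_fun_tmon.
    apply: rat_funM => //; apply: rat_fun_div.
    apply: (inS_class kb); exact: inSX.
  have vE : v = (g * 'X_[((k - mpos e M) + mpos e (- M))%MM])%:F /
                (h * 'X_[(mpos e M - k)%MM])%:F.
    by rewrite /v tmon_mulX uE [f%:F * _]mulrC mulfK // mulf_div -!tofracM.
  rewrite vE in v_rat *; apply: rat_local_ring => //; rewrite mevalM mulf_neq0 //.
  apply/nonvanishingX => j xj; rewrite mnmBE; apply/eqP; rewrite subn_eq0 mnmE.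
  have ME : pairing M (e j) = (pos j != l)%:R.
    rewrite pairing_suml.
    rewrite (eq_bigr (fun s : 'I_p => (lift l s == pos j)%:R)) => [|s _]; last first.
      rewrite (_ : row s _ = row (lift l s) B) ?BP //.
      by apply/rowP => j'; rewrite !mxE.
    have [lj|lj] := eqVneq (pos j) l.
      by rewrite lj big1 // => s _; rewrite eq_sym (negPf (neq_lift _ _)).
    case: (unliftP l (pos j)) lj => [s ->|-> /eqP//] _.
    rewrite (bigD1 s) //= eqxx big1 ?addr0 // => s' ss'.
    by rewrite (inj_eq lift_inj) (negPf ss').
  rewrite ME; case: eqVneq => [//|lj]; have [kj|//] := posnP (k j).
  case/eqP: Bl; have [Ej|Ej] := ki j kj.
    by rewrite -Ej BP // eq_sym (negPf lj).
  by rewrite -[e i]opprK -Ej pairingNr BP // eq_sym (negPf lj) oppr0.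
apply: localM; last exact: local_const.
apply: localM; first by rewrite intV; apply: local_const.
by rewrite intr_const; apply: local_const.
Qed.

Lemma Phi0 : Phi 0 = 0.
Proof.
apply/ffunP => k; rewrite ffunE [RHS]ffunE bdetE big1 ?mul0r // => l _.
by rewrite mxE mul0r.
Qed.

Lemma form_addE (w w' : diff_form R n p) q : (w + w') q = w q + w' q.
Proof. exact: ffunE. Qed.

Lemma PhiE V q : Phi V q = bdet V (map_mx intr (ray_rows e q)) / \prod_t z R (q t).
Proof. exact: ffunE. Qed.

Lemma PhiD V W : Phi (V + W) = Phi V + Phi W.
Proof.
apply/ffunP => k; rewrite form_addE !PhiE -mulrDl.
congr (_ * _); rewrite !bdetE -big_split; apply: eq_bigr => l _.
by rewrite mxE mulrDl.
Qed.

Lemma admissible_rational W : admissible b W -> rational_form e ((f%:F)^-1 *: Phi W).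
Proof.
elim=> [|a k i W' kb ki _ IH].
  by rewrite Phi0 scaler0; apply: span_forms0.
by rewrite PhiD scalerDr; exact: (span_formsD (rational_generator a i kb) IH).
Qed.

Lemma admissible_regular (x : 'I_n -> C) (u : L) W :
  inU Sigma x -> smooth_at e x -> local_equation_at e f x u -> admissible b W ->
  regular_at e x (u *: ((f%:F)^-1 *: Phi W)).
Proof.
move=> xU x_smooth uP; elim=> [|a k i W' kb ki _ IH].
  by rewrite Phi0 !scaler0; apply: span_forms0.
rewrite PhiD !scalerDr.
exact: (span_formsD (regular_generator a xU x_smooth uP kb ki) IH).
Qed.

Lemma admissible_H0 W : cartier e Sigma f -> admissible b W ->
  H0 e Sigma f ((f%:F)^-1 *: Phi W).
Proof.
move=> f_cartier Wb; have w_rat := admissible_rational Wb; split=> // x xU.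
have [h [u [hh hx hu]]] := f_cartier x xU.
exists h, u; split; [exact: hh | exact: hx | exact: hu | split].
  by apply: span_formsZ w_rat; [exact: rat_funM | case: (hu x xU hx)].
by move=> y yU hy y_smooth; apply: admissible_regular => //; exact: hu.
Qed.

End AdmissibleVectors.

(** * From sections to polynomial vectors *)

Lemma cancel_fraction (K : fieldType) (a g h w : K) : g != 0 -> h != 0 ->
  a * w = a * (g / h) * w * (h / g).
Proof. by move=> g0 h0; field; rewrite g0 h0. Qed.

Section SectionsArePolynomial.
Variables (R : realType) (p n : nat) (e : 'I_n -> 'rV[int]_p.+1).
Variable Sigma : {set {set 'I_n}}.
Hypothesis fan : complete_simplicial_fan R e Sigma.
Local Notation C := R[i].
Local Notation S := {mpoly C[n]}.
Local Notation L := {fraction S}.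
Local Notation Phi := (Phi (R := R) e).
Implicit Types (m : 'rV[int]_p.+1) (k : 'X_{1..n}) (W : 'rV[L]_p.+1).

Lemma form_scaleE (a : L) q (w : diff_form R n q) a0 : (a *: w) a0 = a * w a0.
Proof. exact: ffunE. Qed.

Section RegularFunctions.
Variable x : 'I_n -> C.

(* The local ring of affine space at x. *)
Definition regular (r : L) : Prop := exists g h : S, h.@[x] != 0 /\ r = g%:F / h%:F.

Lemma regularM r s : regular r -> regular s -> regular (r * s).
Proof.
move=> [g [h [hx ->]]] [g' [h' [h'x ->]]]; exists (g * g'), (h * h').
by rewrite mevalM mulf_neq0 // mulf_div -!tofracM.
Qed.

Lemma regularD r s : regular r -> regular s -> regular (r + s).
Proof.
move=> [g [h [hx ->]]] [g' [h' [h'x ->]]]; exists (g * h' + g' * h), (h * h').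
rewrite mevalM mulf_neq0 // addf_div ?tofrac_eq0 ?(nonvanishing_neq0 (x := x)) //.
by rewrite -!tofracM -tofracD.
Qed.

Lemma regular_tofrac (g : S) : regular g%:F.
Proof. by exists g, 1; rewrite meval1 oner_neq0 tofrac1 divr1. Qed.

Lemma regular_dfrac j r : regular r -> regular (dfrac j r).
Proof.
move=> [g [h [hx ->]]]; exists (g^`M(j) * h - g * h^`M(j)), (h ^+ 2).
split; last exact/dfrac_div/(nonvanishing_neq0 (x := x)).
by rewrite rmorphXn expf_neq0.
Qed.

Lemma regular_sum (I : Type) (s : seq I) (P : pred I) (F : I -> L) :
  (forall i, P i -> regular (F i)) -> regular (\sum_(i <- s | P i) F i).
Proof.
move=> FP; elim/big_ind: _ => //; last exact: regularD.
by rewrite -tofrac0; apply: regular_tofrac.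
Qed.

Lemma regular_prod (I : Type) (s : seq I) (P : pred I) (F : I -> L) :
  (forall i, P i -> regular (F i)) -> regular (\prod_(i <- s | P i) F i).
Proof.
move=> FP; elim/big_ind: _ => //; last exact: regularM.
by rewrite -tofrac1; apply: regular_tofrac.
Qed.

Lemma regular_det q (M : 'M[L]_q) : (forall i j, regular (M i j)) -> regular (\det M).
Proof.
move=> MP; apply: regular_sum => s _; apply: regularM; last by apply: regular_prod.
rewrite -signr_odd; case: odd; last by rewrite -tofrac1; apply: regular_tofrac.
by rewrite expr1 -tofrac1 -tofracN; apply: regular_tofrac.
Qed.

Lemma regular_at_component q (w : diff_form R n q) a0 : regular_at e x w -> regular (w a0).
Proof.
move=> [r [a [b [aP bP ->]]]]; rewrite sum_ffunE; apply: regular_sum => s _.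
have local_regular t : local_ring e x t -> regular t.
  by move=> [c [g [h [_ _ hx ->]]]]; exists g, h.
rewrite ffunE; apply: regularM; first exact: local_regular.
rewrite ffunE; apply: regular_det => i j; rewrite mxE.
exact/regular_dfrac/local_regular.
Qed.

End RegularFunctions.

Lemma inU_one_zero (x : 'I_n -> C) : (forall i j, x i = 0 -> x j = 0 -> i = j) ->
  inU Sigma x /\ smooth_at e x.
Proof.
move=> x1; have [g _] := exists_rays_basis fan.
have [i iP] : exists i, forall j, j != i -> x j != 0.
  have [[i xi]|H] := pselect (exists i, x i = 0).
    by exists i => j; apply: contra_neq => xj; apply: x1.
  (* No coordinate vanishes and any index will do; a basis of rays supplies one. *)
  by exists (g ord0) => j _; apply/eqP => xj; apply: H; exists j.
split.
  apply/(inU_zeros fan); case: fan => _ _ subS rayS _; apply: subS (rayS i) _.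
  apply/subsetP => j; rewrite !inE => /eqP xj; apply/negPn/negP => /iP.
  by rewrite xj eqxx.
have [B B_unit BP] := primitive_dual_basis (@fan_primitive _ _ _ _ _ fan i).
exact: smooth_at_one_zero BP iP.
Qed.

(** At a point with at most one zero coordinate the local equation is [f] times a unit of the local
    ring of affine space, so [f%:F * w q] is regular there and [hartogs] applies. *)
Lemma component_polynomial (f : S) (w : diff_form R n p) q : H0 e Sigma f w ->
  exists s : S, f%:F * w q = s%:F.
Proof.
move=> [_ wP]; have [P [Q [Q0 E]]] := fracP (f%:F * w q).
have [s sE] : exists s, P = s * Q; last first.
  by exists s; rewrite E sE tofracM mulfK // tofrac_eq0.
apply: hartogs => // x /inU_one_zero[xU x_smooth].
have [h [u [_ hx hu [_ /(_ x xU hx x_smooth) uw_reg]]]] := wP x xU.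
have [_ [g [h' [gx h'x uE]]]] := hu x xU hx.
have [g1 [h1 [h1x E1]]] := regular_at_component q uw_reg.
exists (g1 * h'), (h1 * g); split; first by rewrite mevalM; exact: (mulf_neq0 h1x gx).
have nz t : t.@[x] != 0 -> (t : S)%:F != 0 :> L.
  by move=> tx; rewrite tofrac_eq0 (nonvanishing_neq0 tx).
have hg0 : h1 * g != 0.
  by apply: mulf_neq0; [exact: nonvanishing_neq0 h1x | exact: nonvanishing_neq0 gx].
apply/eqP; rewrite [Q * _]mulrC -(frac_div_eq P (g1 * h') Q0 hg0).
rewrite -E; apply/eqP.
have {E1} : u * w q = g1%:F / h1%:F by rewrite -E1 form_scaleE.
rewrite uE !tofracM => E1.
rewrite (cancel_fraction _ _ (nz g gx) (nz h' h'x)) E1 mulf_div //.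
Qed.

Variable f : S.

Lemma ray_rows_lift g (t : 'I_p.+1) :
  map_mx intr (ray_rows e [ffun s => g (lift t s)]) = row' t (map_mx intr (rays e g)) :> 'M[L]_(p, p.+1).
Proof. by apply/matrixP => s l; rewrite !mxE ffunE. Qed.

(* On a basis of rays the coordinates of W are, up to sign and a nonzero
   constant, components of the form multiplied by monomials. *)
Lemma adj_coordinate w W g t : H0 e Sigma f w -> f%:F *: w = Phi W ->
  exists s : S, (W *m \adj (map_mx intr (rays e g))) 0 t =
    (s * \prod_(u : 'I_p) 'X_(g (lift t u)))%:F.
Proof.
move=> wH0 wE; pose q : {ffun 'I_p -> 'I_n} := [ffun s => g (lift t s)].
have [s sE] := component_polynomial q wH0.
have {sE} : Phi W q = s%:F by rewrite -sE -wE form_scaleE.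
rewrite ffunE ray_rows_lift bdet_row' => sE.
have prod0 : \prod_u z R (q u) != 0 by apply/prodf_neq0 => u _; apply: z_neq0.
exists ((-1) ^+ t * s); rewrite -mulrA tofracM tofracXn tofracN tofrac1.
move/(canRL (divfK prod0)): sE => /(congr1 (fun r => (-1) ^+ t * r)).
rewrite mulrA -expr2 sqrr_sign mul1r => ->; congr (_ * _).
rewrite tofracM rmorph_prod; congr (_ * _); apply: eq_bigr => u _.
by rewrite ffunE.
Qed.

Definition coef_vec (P : 'rV[S]_p.+1) k : 'rV[C]_p.+1 := map_mx (mcoeff k) P.

Lemma coef_vec_mul (P : 'rV[S]_p.+1) k (M : 'M[int]_p.+1) :
  coef_vec P k *m map_mx intr M = coef_vec (P *m map_mx intr M) k.
Proof.
apply/rowP => l; rewrite !mxE raddf_sum; apply: eq_bigr => j _.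
by rewrite !mxE mulrzr /= mulrzr raddfMz.
Qed.

End SectionsArePolynomial.

Section SectionsAreAdmissible.
Variables (R : realType) (p n : nat) (e : 'I_n -> 'rV[int]_p.+1).
Variable Sigma : {set {set 'I_n}}.
Hypothesis fan : complete_simplicial_fan R e Sigma.
Local Notation C := R[i].
Local Notation S := {mpoly C[n]}.
Local Notation L := {fraction S}.
Local Notation ray F i := (map_mx intr (e i) : 'rV[F]_p.+1).
Local Notation Phi := (Phi (R := R) e).
Local Notation tofrac := (@FracField.tofrac {mpoly R[i][n]}).
Implicit Types (m : 'rV[int]_p.+1) (k : 'X_{1..n}) (W : 'rV[L]_p.+1).
Variables (b : 'rV[int]_n) (f : S) (w : diff_form R n p) (P : 'rV[S]_p.+1).
Hypotheses (f_inS : inS e b f) (f_neq0 : f != 0) (wH0 : H0 e Sigma f w).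

Lemma mcoeff_mulX0 k i (g : S) : k i = 0%N -> (g * 'X_i)@_k = 0.
Proof.
move=> ki; apply: memN_msupp_eq0; apply/negP => /msuppM_le/allpairsP[[k1 k2] /= [_]].
rewrite msuppX inE => /eqP -> kE.
by move: ki; rewrite kE mnmDE mnm1E eqxx addn1.
Qed.

Lemma mul_map_adj (F : comNzRingType) (G : 'M[int]_p.+1) (v : 'rV[F]_p.+1) :
  v *m map_mx intr (\adj G) *m map_mx intr G = (\det G)%:~R *: v.
Proof.
by rewrite -mulmxA -map_mxM mul_adj_mx map_scalar_mx mul_mx_scalar.
Qed.

Lemma polynomial_vector W : f%:F *: w = Phi W -> exists P0 : 'rV[S]_p.+1, W = map_mx tofrac P0.
Proof.
move=> wE; have [g g0] := exists_rays_basis fan; set G := rays e g in g0.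
have /choice[T TP] := fun t => adj_coordinate fan g t wH0 wE.
pose s : 'rV[S]_p.+1 := \row_t (T t * \prod_(u : 'I_p) 'X_(g (lift t u))).
exists (((\det G)%:~R^-1)%:MP *: (s *m map_mx intr G)).
have sE : W *m map_mx intr (\adj G) = map_mx tofrac s.
  by apply/rowP => t; rewrite map_mx_adj TP !mxE.
have detG : ((\det G)%:~R : L) != 0 by rewrite intrL_eq0.
rewrite map_mxZ map_mxM /= -sE -intV.
have -> : map_mx tofrac (map_mx intr G) = map_mx intr G :> 'M[L]_p.+1.
  by apply/matrixP => i j; rewrite !mxE tofrac_int.
by rewrite mul_map_adj scalerK.
Qed.

Lemma polynomial_inS W (V : 'rV[L]_p.+1) : W = map_mx tofrac P -> W = f%:F *: V ->
  (forall l, rat_fun e (V 0 l)) -> forall l, inS e b (P 0 l).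
Proof.
move=> WP WV V_rat l; have [c [g [h [gc hc h0 E]]]] := V_rat l.
have Pl : (P 0 l)%:F = f%:F * (g%:F / h%:F).
  have := congr1 (fun u : 'rV[L]_p.+1 => u 0 l) WP.
  by rewrite WV 2!mxE E => <-.
apply: (inS_mulr (c := c) h0 hc); have -> : P 0 l * h = f * g.
  apply/eqP; rewrite -tofrac_eq !tofracM Pl mulrA divfK // tofrac_eq0 //.
exact: inSM.
Qed.

Hypothesis wP : f%:F *: w = Phi (map_mx tofrac P).

(** In a basis of rays through [i], each coordinate other than that of [e i] is divisible by z_i,
    and so does not contribute to z^k when k_i = 0. *)
Lemma coef_vec_ray k i : k i = 0%N -> exists c : C, coef_vec P k = c *: ray C i.
Proof.
move=> ki; have [g [t0 [gt0 g0]]] := exists_rays_basis_through fan i.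
set G := rays e g in g0; set v := coef_vec P k.
have adjE t : t != t0 -> (v *m map_mx intr (\adj G)) 0 t = 0.
  move=> tt0; rewrite coef_vec_mul mxE.
  have [s sE] := adj_coordinate fan g t wH0 wP.
  have -> : (P *m map_mx intr (\adj G)) 0 t = s * \prod_(u : 'I_p) 'X_(g (lift t u)).
    apply/eqP; rewrite -tofrac_eq -sE; apply/eqP.
    rewrite !mxE rmorph_sum; apply: eq_bigr => j _ /=.
    by rewrite tofracM -map_mx_adj !mxE tofrac_int.
  case: (unliftP t t0) tt0 => [u Eu|-> /eqP//] _.
  by rewrite (bigD1 u) //= -Eu gt0 [_ * \prod_(_ | _) _]mulrC mulrA mcoeff_mulX0.
pose a := (v *m map_mx intr (\adj G)) 0 t0.
have vE : v *m map_mx intr (\adj G) = a *: delta_mx 0 t0.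
  apply/rowP => t; rewrite [RHS]mxE [delta_mx _ _ _ _]mxE eqxx /=.
  by have [->|tt0] := eqVneq t t0; rewrite ?mulr1 // mulr0 adjE.
have detG : ((\det G)%:~R : C) != 0 by rewrite intr_eq0.
exists ((\det G)%:~R^-1 * a); rewrite -scalerA; apply: (canRL (scalerK detG)).
rewrite -(mul_map_adj G v) vE -scalemxAl -rowE -map_row; congr (_ *: map_mx _ _).
by rewrite rowK gt0.
Qed.

Definition const_vec (v : 'rV[C]_p.+1) : 'rV[L]_p.+1 := \row_l (v 0 l)%:MP%:F.

Lemma const_vecZ (c : C) (v : 'rV[C]_p.+1) : const_vec (c *: v) = c%:MP%:F *: const_vec v.
Proof. by apply/rowP => l; rewrite !mxE mpolyCM tofracM. Qed.

Lemma const_vec_ray i : const_vec (ray C i) = ray L i.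
Proof. by apply/rowP => l; rewrite !mxE -intr_const. Qed.

Lemma const_vec_sum (I : finType) (F : I -> 'rV[C]_p.+1) :
  const_vec (\sum_i F i) = \sum_i const_vec (F i).
Proof.
apply/rowP => l; rewrite mxE !summxE !raddf_sum; apply: eq_bigr => i _.
by rewrite mxE.
Qed.

Lemma polynomial_vector_sum : exists N, map_mx tofrac P =
  \sum_(k : 'X_{1..n < N}) ('X_[k])%:F *: const_vec (coef_vec P k).
Proof.
exists (\max_(l < p.+1) msize (P ord0 l)); apply/rowP => l; rewrite summxE mxE.
rewrite [P 0 l in LHS](mpolywE (leq_bigmax (F := fun l => msize (P ord0 l)) l)) raddf_sum; apply: eq_bigr => k _ /=.
by rewrite !mxE -mul_mpolyC tofracM mulrC.
Qed.

Lemma ray_parallel (v : 'rV[C]_p.+1) (c c' : C) i j : v != 0 ->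
  v = c *: ray C i -> v = c' *: ray C j -> e j = e i \/ e j = - e i.
Proof.
move=> v0 vi vj; apply: primitive_parallel => [||k l]; try exact: (fan_primitive fan).
have c0 : c != 0 by apply: contraNneq v0 => c0; rewrite vi c0 scale0r.
have c'0 : c' != 0 by apply: contraNneq v0 => c'0; rewrite vj c'0 scale0r.
have vE q : c * (e i 0 q)%:~R = c' * (e j 0 q)%:~R.
  by have := congr1 (fun u : 'rV[C]_p.+1 => u 0 q) vi; rewrite {1}vj !mxE => ->.
apply/eqP; rewrite -(eqr_int C) !intrM; apply/eqP.
apply: (mulfI (mulf_neq0 c'0 c0)).
by rewrite mulrACA [RHS]mulrACA -!vE mulrC.
Qed.

Hypothesis P_inS : forall l, inS e b (P 0 l).

(** If several exponents vanish, the nonzero coefficient vector is parallel to all the corresponding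
    rays. If none does, admissibility is vacuous and the vector is expanded in any basis of rays. *)
Lemma monomial_admissible k : admissible e b (('X_[k])%:F *: const_vec (coef_vec P k)).
Proof.
have [->|v0] := eqVneq (coef_vec P k) 0.
  rewrite (_ : const_vec 0 = 0) ?scaler0; first exact: admissible0.
  by apply/rowP => l; rewrite !mxE mpolyC0 tofrac0.
have kb : same_class e (expo k) b.
  have /rV0Pn[l] := v0; rewrite mxE -mcoeff_msupp; exact: P_inS.
have termE c i : ('X_[k])%:F *: const_vec (c *: ray C i) = (c *: 'X_[k])%:F *: ray L i.
  by rewrite const_vecZ const_vec_ray scalerA -mul_mpolyC tofracM mulrC.
have [[i ki]|k_pos] := pselect (exists i, k i = 0%N).
  have [c vi] := coef_vec_ray ki; rewrite vi termE; apply: admissible1 => // l kl.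
  by have [c' vl] := coef_vec_ray kl; apply: ray_parallel vi vl.
have [g g0] := exists_rays_basis fan.
have detG : ((\det (rays e g))%:~R : C) != 0 by rewrite intr_eq0.
have -> : coef_vec P k = \sum_t
    ((\det (rays e g))%:~R^-1 * (coef_vec P k *m map_mx intr (\adj (rays e g))) 0 t) *: ray C (g t).
  rewrite -[LHS](scalerK detG) -mul_map_adj mulmx_sum_row scaler_sumr.
  by apply: eq_bigr => t _; rewrite scalerA -map_row rowK.
rewrite const_vec_sum scaler_sumr; apply: admissible_sum => t _; rewrite termE.
by apply: admissible1 => // l kl; case: k_pos; exists l.
Qed.

End SectionsAreAdmissible.

Lemma H0_admissible (R : realType) p n (e : 'I_n -> 'rV[int]_p.+1) Sigma
    (fan : complete_simplicial_fan R e Sigma) b (f : {mpoly R[i][n]})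
    (w : diff_form R n p) : inS e b f -> f != 0 -> H0 e Sigma f w ->
  exists W, admissible e b W /\ w = (f%:F)^-1 *: Phi e W.
Proof.
move=> fb f0 wH0; have [w_rat _] := wH0.
pose nonzero (h : {mpoly R[i][n]}) : Prop := h != 0.
have nonzeroM g h : nonzero g -> nonzero h -> nonzero (g * h) by exact: mulf_neq0.
have w_deg0 : span_forms (deg0_frac e nonzero) w by exact: w_rat.
have [//|V [V_rat wV]] := span_forms_Phi (Q := nonzero) (oner_neq0 _) nonzeroM _ w_deg0.
have fF : f%:F != 0 by rewrite tofrac_eq0.
have wE : f%:F *: w = Phi e (f%:F *: V) by rewrite PhiZ wV.
have [P WP] := polynomial_vector fan wH0 wE.
exists (f%:F *: V); split; last by rewrite -wE scalerA mulVf // scale1r.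
have P_inS := polynomial_inS fb WP (erefl _) V_rat.
rewrite WP in wE *; have [N ->] := polynomial_vector_sum P.
by apply: admissible_sum => k _; apply: (monomial_admissible fan wH0 wE P_inS).
Qed.

(** * Numerators of the theorem *)

Section Numerators.
Variables (R : realType) (p n : nat) (e : 'I_n -> 'rV[int]_p.+1).
Variable Sigma : {set {set 'I_n}}.
Hypothesis fan : complete_simplicial_fan R e Sigma.
Local Notation C := R[i].
Local Notation S := {mpoly C[n]}.
Local Notation L := {fraction S}.
Local Notation ray i := (map_mx intr (e i) : 'rV[L]_p.+1).
Local Notation Phi := (Phi (R := R) e).
Implicit Types (k : 'X_{1..n}) (W : 'rV[L]_p.+1) (A : {set 'I_n}) (b : 'rV[int]_n).

Definition zhat_expo A : 'X_{1..n} := [multinom (l \notin A : nat) | l < n].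

Lemma zhatE A : zhat R A = 'X_[zhat_expo A].
Proof.
rewrite mpolyXE_id /zhat big_mkcond; apply: eq_bigr => l _.
by rewrite mnmE; case: (l \notin A).
Qed.

Lemma expo_zhat1 i : expo (zhat_expo [set i]) = deg0 n - degz i.
Proof.
apply/rowP => l; rewrite !mxE summxE (bigD1 l) //= big1 => [|j /negPf jl].
  by rewrite mnmE inE !mxE !eqxx /=; case: (l == i).
by rewrite mxE eq_sym jl andbF.
Qed.

Lemma expo_zhat2 i j : i != j -> expo (zhat_expo [set i; j]) = deg0 n - degz i - degz j.
Proof.
move=> /negPf ij; rewrite -expo_zhat1; apply/rowP => l; rewrite !mxE !mnmE !inE.
have [->|li] := eqVneq l i; first by rewrite ij.
by case: (l == j).
Qed.

Lemma zhat_factor A k (a : C) : (forall l, l \notin A -> k l != 0%N) ->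
  (a *: 'X_[k] : S) = (a *: 'X_[k - zhat_expo A]) * zhat R A /\
  expo (k - zhat_expo A)%MM = expo k - expo (zhat_expo A).
Proof.
move=> kA; have le_k : (zhat_expo A <= k)%MM.
  by apply/mnm_lepP => l; rewrite mnmE; case: (boolP (l \in A)) => // /kA; rewrite lt0n.
split; first by rewrite zhatE -scalerAl -mpolyXD submK.
by apply/rowP => l; rewrite !mxE mnmBE -subzn // (mnm_lepP le_k).
Qed.

Lemma zhat_inS A k b c (a : C) : (forall l, l \notin A -> k l != 0%N) ->
  same_class e (expo k) b -> b - expo (zhat_expo A) = c ->
  inS e c (a *: 'X_[k - zhat_expo A] : S).
Proof.
move=> kA kb <-; have [_ E] := zhat_factor 0 kA; apply: inSZ.
apply: (@inS_class _ _ _ _ (expo (k - zhat_expo A)%MM)); last exact: inSX.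
by rewrite E; apply: same_classD => //; apply: same_class_refl.
Qed.

Lemma zhat_admissible A i b c (g : S) : i \in A ->
  (forall j, j \in A -> e j = e i \/ e j = - e i) ->
  inS e c g -> b - expo (zhat_expo A) = c ->
  admissible e b (g%:F *: ((zhat R A)%:F *: ray i)).
Proof.
move=> iA eA gc Ec; rewrite scalerA -tofracM {1}[g]mpolyE mulr_suml raddf_sum scaler_suml.
rewrite big_seq; apply: admissible_sum => k k_g /=.
rewrite zhatE -scalerAl -mpolyXD; apply: admissible1 => [|l].
  rewrite expoD; have -> : b = c + expo (zhat_expo A) by rewrite -Ec subrK.
  by apply: same_classD; [exact: gc | exact: same_class_refl].
rewrite mnmDE mnmE => /eqP; rewrite addn_eq0 eqb0 negbK => /andP[_ lA].
exact: eA.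
Qed.

Definition numerator1 (D1 : 'I_n -> S) : 'rV[L]_p.+1 :=
  \sum_(i | I0 e i) (D1 i)%:F *: ((zhat R [set i])%:F *: ray i).

Definition numerator2 (D2 : 'I_n -> 'I_n -> S) : 'rV[L]_p.+1 :=
  \sum_i \sum_(j | I1 e i j) (D2 i j)%:F *: ((zhat R [set i; j])%:F *: ray i).

Definition numerator (D1 : 'I_n -> S) : 'rV[L]_p.+1 :=
  \sum_i (D1 i)%:F *: ((zhat R [set i])%:F *: ray i).

Lemma I1_neq i j : I1 e i j -> (i != j) /\ e i = - e j.
Proof. by move=> /andP[ij /eqP]; rewrite -(inj_eq val_inj) neq_ltn ij. Qed.

Lemma numerators_admissible b D1 D2 :
  (forall i, I0 e i -> inS e (b - deg0 n + degz i) (D1 i)) ->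
  (forall i j, I1 e i j -> inS e (b - deg0 n + degz i + degz j) (D2 i j)) ->
  admissible e b (numerator1 D1 + numerator2 D2).
Proof.
move=> D1P D2P; apply: admissibleD; apply: admissible_sum => i.
  move=> /D1P Ai; apply: (zhat_admissible (set11 i) _ Ai) => [j /set1P ->|]; first by left.
  by rewrite expo_zhat1 opprD opprK addrA.
move=> _; apply: admissible_sum => j ij; have [neq_ij eij] := I1_neq ij.
apply: (zhat_admissible (set21 i j) _ (D2P _ _ ij)) => [l /set2P[]->|].
- by left.
- by right; rewrite eij opprK.
- by rewrite expo_zhat2 // !opprD !opprK !addrA.
Qed.

Lemma numerator_admissible b D1 :
  (forall i, inS e (b - deg0 n + degz i) (D1 i)) -> admissible e b (numerator D1).
Proof.
move=> D1P; apply: admissible_sum => i _.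
apply: (zhat_admissible (set11 i) _ (D1P i)) => [j /set1P ->|]; first by left.
by rewrite expo_zhat1 opprD opprK addrA.
Qed.

Lemma numerator_single i (g : S) :
  numerator (fun j => if j == i then g else 0) = g%:F *: ((zhat R [set i])%:F *: ray i).
Proof.
rewrite /numerator (bigD1 i) //= eqxx big1 ?addr0 // => j /negPf ->.
by rewrite tofrac0 scale0r.
Qed.

Lemma numerator1_single i (g : S) : I0 e i ->
  numerator1 (fun j => if j == i then g else 0) = g%:F *: ((zhat R [set i])%:F *: ray i).
Proof.
move=> i0; rewrite /numerator1 (bigD1 i) //= eqxx big1 ?addr0 // => j /andP[_ /negPf ->].
by rewrite tofrac0 scale0r.
Qed.

Lemma numerator2_single i j (g : S) : I1 e i j ->
  numerator2 (fun i' j' => if (i' == i) && (j' == j) then g else 0) =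
  g%:F *: ((zhat R [set i; j])%:F *: ray i).
Proof.
move=> ij; rewrite /numerator2 (bigD1 i) //= (bigD1 j) //= !eqxx /=.
rewrite big1 ?addr0 => [|j' /andP[_ /negPf ->]]; last by rewrite tofrac0 scale0r.
rewrite big1 ?addr0 // => i' /negPf ->; apply: big1 => j' _.
by rewrite tofrac0 scale0r.
Qed.

Lemma numerator1D D1 E1 : numerator1 (fun i => D1 i + E1 i) = numerator1 D1 + numerator1 E1.
Proof. by rewrite -big_split; apply: eq_bigr => i _; rewrite tofracD scalerDl. Qed.

Lemma numerator2D D2 E2 :
  numerator2 (fun i j => D2 i j + E2 i j) = numerator2 D2 + numerator2 E2.
Proof.
rewrite -big_split; apply: eq_bigr => i _; rewrite -big_split; apply: eq_bigr => j _.
by rewrite tofracD scalerDl.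
Qed.

Lemma numeratorD D1 E1 : numerator (fun i => D1 i + E1 i) = numerator D1 + numerator E1.
Proof. by rewrite -big_split; apply: eq_bigr => i _; rewrite tofracD scalerDl. Qed.

Lemma numerator10 : numerator1 (fun=> 0) = 0.
Proof. by apply: big1 => i _; rewrite tofrac0 scale0r. Qed.

Lemma numerator20 : numerator2 (fun _ _ => 0) = 0.
Proof. by apply: big1 => i _; apply: big1 => j _; rewrite tofrac0 scale0r. Qed.

Lemma numerator0 : numerator (fun=> 0) = 0.
Proof. by apply: big1 => i _; rewrite tofrac0 scale0r. Qed.

Lemma zhat_ray A k (a : C) i : (forall l, l \notin A -> k l != 0%N) ->
  (a *: 'X_[k] : S)%:F *: ray i =
  (a *: 'X_[k - zhat_expo A] : S)%:F *: ((zhat R A)%:F *: ray i).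
Proof. by move=> kA; have [-> _] := zhat_factor a kA; rewrite scalerA -tofracM. Qed.

Lemma scale_ray_opp (a : C) k i j : e i = - e j ->
  (a *: 'X_[k] : S)%:F *: ray i = (- a *: 'X_[k] : S)%:F *: ray j.
Proof.
move=> eij; rewrite scaleNr tofracN scaleNr -scalerN; congr (_ *: _).
by apply/rowP => l; rewrite eij !mxE mulrNz.
Qed.

(** Rays are distinct, so the exponents can vanish only at [i], or at [i] and the index of its
    opposite ray; the monomial is then divisible by the corresponding [zhat]. *)
Lemma admissible_numerators b W : admissible e b W -> exists D1 D2,
  [/\ forall i, I0 e i -> inS e (b - deg0 n + degz i) (D1 i),
      forall i j, I1 e i j -> inS e (b - deg0 n + degz i + degz j) (D2 i j)
    & W = numerator1 D1 + numerator2 D2].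
Proof.
elim=> [|a k i W' kb ki _ [D1 [D2 [D1P D2P ->]]]].
  exists (fun=> 0), (fun _ _ => 0); split=> [i _|i j _|]; try exact: inS0.
  by rewrite numerator10 numerator20 addr0.
suff [E1 [E2 [E1P E2P ->]]] : exists E1 E2,
    [/\ forall i, I0 e i -> inS e (b - deg0 n + degz i) (E1 i),
        forall i j, I1 e i j -> inS e (b - deg0 n + degz i + degz j) (E2 i j)
      & (a *: 'X_[k])%:F *: ray i = numerator1 E1 + numerator2 E2].
  exists (fun i => E1 i + D1 i), (fun i j => E2 i j + D2 i j); split=> [i' i'0|i' j' ij'|].
  - by apply: inSD; [exact: E1P | exact: D1P].
  - by apply: inSD; [exact: E2P | exact: D2P].
  - by rewrite numerator1D numerator2D addrACA.
have pair_case i1 j1 a1 : I1 e i1 j1 -> (forall l, l \notin [set i1; j1] -> k l != 0%N) ->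
    exists E1 E2,
    [/\ forall i, I0 e i -> inS e (b - deg0 n + degz i) (E1 i),
        forall i j, I1 e i j -> inS e (b - deg0 n + degz i + degz j) (E2 i j)
      & (a1 *: 'X_[k])%:F *: ray i1 = numerator1 E1 + numerator2 E2].
  move=> ij kA; exists (fun=> 0).
  exists (fun i' j' => if (i' == i1) && (j' == j1)
            then a1 *: 'X_[k - zhat_expo [set i1; j1]] else 0).
  split=> [i' _|i' j' _|]; first exact: inS0.
    case: ifP => [/andP[/eqP-> /eqP->]|_]; last exact: inS0.
    apply: zhat_inS kA kb _; have [neq_ij _] := I1_neq ij.
    by rewrite expo_zhat2 // !opprD !opprK !addrA.
  by rewrite numerator10 add0r (numerator2_single _ ij) (zhat_ray _ _ kA).
have [i0|] := boolP (I0 e i).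
  have kA l : l \notin [set i] -> k l != 0%N.
    rewrite inE => li; apply/eqP => /ki[/(fan_inj fan)/eqP|/eqP eli]; first by apply/negP.
    by move/forallP: i0 => /(_ l)/negP.
  exists (fun j => if j == i then a *: 'X_[k - zhat_expo [set i]] else 0), (fun _ _ => 0).
  split=> [j _|j j' _|]; last first.
  - by rewrite numerator20 addr0 (numerator1_single _ i0) (zhat_ray _ _ kA).
  - exact: inS0.
  case: eqP => [->|_]; last exact: inS0.
  by apply: zhat_inS kA kb _; rewrite expo_zhat1 opprD opprK addrA.
rewrite negb_forall => /existsP[j]; rewrite negbK => /eqP eji.
have kA l : l \notin [set i; j] -> k l != 0%N.
  rewrite !inE negb_or => /andP[li lj]; apply/eqP => /ki[/(fan_inj fan)/eqP|eli].
    exact/negP.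
  by case/eqP: lj; apply: (fan_inj fan); rewrite eli eji.
have ij : i != j.
  apply/eqP => ij; have := opp_not_in_cone fan (i := i) (j := j).
  rewrite eji opprK => /(_ [set i] erefl).
  by case: fan => _ _ _ -> _ => /(_ isT (set11 i)); rewrite ij set11.
have := ltn_neqAle i j; have [ij_lt _|ji_lt _|/val_inj/eqP] := ltngtP i j; last by rewrite (negPf ij).
  by apply: pair_case kA; apply/andP; split; [exact: ij_lt | rewrite eji opprK].
(* [I1] contains only ordered pairs, so the term is rewritten with the opposite ray and the opposite
   coefficient. *)
have eij : e i = - e j by rewrite eji opprK.
rewrite (scale_ray_opp a k eij).
apply: pair_case => [|l]; last by rewrite setUC; apply: kA.
by apply/andP; split; [exact: ji_lt | apply/eqP].
Qed.

(** The monomial equals 1 at the point with coordinates 0 where its exponent vanishes and 1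
    elsewhere, which therefore lies in [inU]. *)
Lemma zero_set_in_fan k : inB Sigma ('X_[k] : S) -> [set l | k l == 0%N] \in Sigma.
Proof.
move=> kB; pose x l : C := if k l == 0%N then 0 else 1.
have -> : [set l | k l == 0%N] = [set l | x l == 0].
  by apply/setP => l; rewrite !inE /x; case: (k l == 0%N); rewrite ?eqxx ?oner_eq0.
apply/(inU_zeros fan); exists 'X_[k] => //; rewrite mevalX; apply/prodf_neq0 => l _.
rewrite /x; have [->|_] := eqVneq (k l) 0%N; first by rewrite expr0 oner_neq0.
by rewrite expr1n oner_neq0.
Qed.

Lemma admissible_numerator b W : (forall g : S, inS e b g -> inB Sigma g) ->
  admissible e b W -> exists D1, (forall i, inS e (b - deg0 n + degz i) (D1 i)) /\
    W = numerator D1.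
Proof.
move=> bB; elim=> [|a k i W' kb ki _ [D1 [D1P ->]]].
  by exists (fun=> 0); split=> [i|]; [exact: inS0 | rewrite numerator0].
suff [E1 [E1P ->]] : exists E1, (forall i, inS e (b - deg0 n + degz i) (E1 i)) /\
    (a *: 'X_[k])%:F *: ray i = numerator E1.
  exists (fun i => E1 i + D1 i); split=> [i'|]; last by rewrite numeratorD.
  by apply: inSD.
have one_case i1 a1 : (forall l, l \notin [set i1] -> k l != 0%N) ->
    exists E1, (forall i, inS e (b - deg0 n + degz i) (E1 i)) /\
    (a1 *: 'X_[k])%:F *: ray i1 = numerator E1.
  move=> kA; exists (fun j => if j == i1 then a1 *: 'X_[k - zhat_expo [set i1]] else 0).
  split=> [j|]; last by rewrite numerator_single (zhat_ray _ _ kA).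
  case: eqP => [->|_]; last exact: inS0.
  by apply: zhat_inS kA kb _; rewrite expo_zhat1 opprD opprK addrA.
have kS : [set l | k l == 0%N] \in Sigma.
  by apply/zero_set_in_fan/bB; apply: (inS_class kb); exact: inSX.
have [[l [li kl]]|no_l] := pselect (exists l, l != i /\ k l = 0%N); last first.
  by apply: one_case => l; rewrite inE => li; apply/eqP => kl; apply: no_l; exists l.
have eli : e l = - e i.
  by case: (ki l kl) => // /(fan_inj fan) li'; rewrite li' eqxx in li.
have eil : e i = - e l by rewrite eli opprK.
(* The exponent at [l] vanishes, so the term is moved to the ray [l]; the exponent at [i] is then
   nonzero, since opposite rays do not share a cone. *)
rewrite (scale_ray_opp a k eil).
apply: one_case => l'; rewrite inE => l'l; apply/eqP => kl'.
case: (ki l' kl') => [el'|el']; last by case/eqP: l'l; apply: (fan_inj fan); rewrite el' eli.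
have := opp_not_in_cone fan (i := l) (j := l') (s := [set l | k l == 0%N]).
by rewrite el' inE kl inE kl' => /(_ eli kS isT).
Qed.

Lemma Phi_numerators D1 D2 : Phi (numerator1 D1 + numerator2 D2) =
  \sum_(i | I0 e i) (D1 i)%:F *: Omega1 R e i
  + \sum_i \sum_(j | I1 e i j) (D2 i j)%:F *: Omega2 R e i j.
Proof.
rewrite PhiD Phi_sum; congr (_ + _); first by apply: eq_bigr => i _; rewrite Omega1E.
rewrite /numerator2 -[in LHS](eq_bigr _ (fun i _ => scale1r _)) Phi_sum.
apply: eq_bigr => i _; rewrite scale1r Phi_sum; apply: eq_bigr => j /I1_neq[_ eij].
by rewrite Omega2E.
Qed.

Lemma Phi_numerator D1 : Phi (numerator D1) = \sum_i (D1 i)%:F *: Omega1 R e i.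
Proof. by rewrite Phi_sum; apply: eq_bigr => i _; rewrite Omega1E. Qed.

End Numerators.

Theorem theorem9p13 (R : realType) (d n : nat) (d_gt0 : (0 < d)%N)
  (e : 'I_n -> 'rV[int]_d) (Sigma : {set {set 'I_n}})
  (fan_Sigma : complete_simplicial_fan R e Sigma)
  (b : 'rV[int]_n) (f : {mpoly R[i][n]})
  (f_inS : inS e b f) (f_neq0 : f != 0) (X_cartier : cartier e Sigma f) :
  (forall w : diff_form R n d.-1,
     H0 e Sigma f w <->
     exists (A : 'I_n -> {mpoly R[i][n]}) (A2 : 'I_n -> 'I_n -> {mpoly R[i][n]}),
       [/\ forall i, I0 e i -> inS e (b - deg0 n + degz i) (A i),
           forall i j, I1 e i j ->
             inS e (b - deg0 n + degz i + degz j) (A2 i j)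
         & w = (f%:F)^-1 *:
                 (\sum_(i | I0 e i) (A i)%:F *: Omega1 R e i
                  + \sum_i \sum_(j | I1 e i j) (A2 i j)%:F *: Omega2 R e i j)])
  /\
  ((forall g : {mpoly R[i][n]}, inS e b g -> inB Sigma g) ->
   forall w : diff_form R n d.-1,
     H0 e Sigma f w <->
     exists A : 'I_n -> {mpoly R[i][n]},
       (forall i, inS e (b - deg0 n + degz i) (A i)) /\
       w = (f%:F)^-1 *: \sum_i (A i)%:F *: Omega1 R e i).
Proof.
(* Writing the dimension as [p.+1] makes [d.-1] reduce to [p], the shape required by bordered
   matrices. *)
case: d d_gt0 e fan_Sigma f_inS X_cartier => // p _ e fan fb f_cartier.
split=> [w|bB w]; split.
- move=> /(H0_admissible fan fb f_neq0)[W [/(admissible_numerators fan)[A1 [A2 [A1P A2P ->]]] ->]].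
  exists A1, A2; split; [exact: A1P | exact: A2P | by rewrite Phi_numerators].
- move=> [A1 [A2 [A1P A2P ->]]]; rewrite -Phi_numerators.
  by apply: (admissible_H0 fan fb f_neq0 f_cartier); apply: numerators_admissible.
- move=> /(H0_admissible fan fb f_neq0)[W [/(admissible_numerator fan bB)[A1 [A1P ->]] ->]].
  by exists A1; split=> //; rewrite Phi_numerator.
- move=> [A1 [A1P ->]]; rewrite -Phi_numerator.
  by apply: (admissible_H0 fan fb f_neq0 f_cartier); apply: numerator_admissible.
Qed.
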